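(* There is an algorithm that, given a connected graph $G$ with $n$ vertices, $m$ edges and maximum degree $\Delta(G)$ such that $G$ does not admit a $1$-join, in $O(nm(\Delta(G)+\alpha(m,\Delta(G))))$ time either finds a $2$-join of $G$ or reports that $G$ has no $2$-join.
   Context: $\alpha(\cdot,\cdot)$ is the inverse Ackermann function. A $1$-join of $G$ is a partition $(V_1,V_2)$ of $V(G)$ with sets $A_1\subseteq V_1$, $A_2\subseteq V_2$ such that $A_1\cup A_2$ is a clique, $V_1\setminus A_1$ has no neighbor in $V_2$, $V_2\setminus A_2$ has no neighbor in $V_1$, and $A_i\neq\emptyset$, $V_i\setminus A_i\neq\emptyset$ for $i=1,2$. A generalized $2$-join of $G$ is a partition $(V_0,V_1,V_2)$ of $V(G)$ together with, for $i=1,2$, disjoint sets $A_i,B_i\subseteq V_i$ such that $V_0\cup A_1\cup A_2$ and $V_0\cup B_1\cup B_2$ are cliques, every edge of $G$ whose endpoints lie in two different sets among $V_0,V_1,V_2$ has both endpoints in $V_0\cup A_1\cup A_2$ or both in $V_0\cup B_1\cup B_2$, and $A_i$, $B_i$, $V_i\setminus(A_i\cup B_i)$ are nonempty for $i=1,2$. A $2$-join is a generalized $2$-join with $V_0=\emptyset$. *)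

(* Defs.v *)
From mathcomp Require Import all_boot.

Set Implicit Arguments.
Unset Strict Implicit.
Unset Printing Implicit Defensive.

Record sgraph (T : finType) := SGraph {
  adj :> rel T;
  adj_sym : symmetric adj;
  adj_irr : irreflexive adj
}.

Section Graphs.
Variables (T : finType) (G : sgraph T).

Definition connected : Prop := 0 < #|T| /\ forall x y : T, connect G x y.

Definition degree (x : T) : nat := #|[set y | G x y]|.

Definition max_degree : nat := \max_(x : T) degree x.

Definition edge_set : {set {set T}} :=
  [set E | [exists x, exists y, G x y && (E == [set x; y])]].

Definition nb_edges : nat := #|edge_set|.

Definition clique (K : {set T}) : Prop :=
  forall x y : T, x \in K -> y \in K -> x != y -> G x y.

Definition is_1join (V1 V2 A1 A2 : {set T}) : Prop :=
  [/\ V1 :|: V2 = [set: T] /\ [disjoint V1 & V2],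
      A1 \subset V1 /\ A2 \subset V2,
      clique (A1 :|: A2),
      (forall x y, x \in V1 :\: A1 -> y \in V2 -> ~~ G x y) /\
      (forall x y, x \in V2 :\: A2 -> y \in V1 -> ~~ G x y)
    & [/\ A1 != set0, A2 != set0, V1 :\: A1 != set0 & V2 :\: A2 != set0]].

Definition has_1join : Prop := exists V1 V2 A1 A2, is_1join V1 V2 A1 A2.

(* [V0] may be empty, hence covering + disjointness rather than the library's
   [partition], which excludes empty blocks. *)
Definition is_gen_2join (V0 V1 V2 A1 B1 A2 B2 : {set T}) : Prop :=
  [/\ V0 :|: V1 :|: V2 = [set: T] /\
      [/\ [disjoint V0 & V1], [disjoint V0 & V2] & [disjoint V1 & V2]],
      [/\ A1 \subset V1, B1 \subset V1 & [disjoint A1 & B1]] /\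
      [/\ A2 \subset V2, B2 \subset V2 & [disjoint A2 & B2]],
      clique (V0 :|: A1 :|: A2) /\ clique (V0 :|: B1 :|: B2),
      (forall x y, G x y ->
         ~~ [|| (x \in V0) && (y \in V0), (x \in V1) && (y \in V1)
              | (x \in V2) && (y \in V2)] ->
         (x \in V0 :|: A1 :|: A2 /\ y \in V0 :|: A1 :|: A2) \/
         (x \in V0 :|: B1 :|: B2 /\ y \in V0 :|: B1 :|: B2))
    & [/\ A1 != set0, B1 != set0 & V1 :\: (A1 :|: B1) != set0] /\
      [/\ A2 != set0, B2 != set0 & V2 :\: (A2 :|: B2) != set0]].

Definition is_2join (V1 V2 A1 B1 A2 B2 : {set T}) : Prop :=
  is_gen_2join set0 V1 V2 A1 B1 A2 B2.

Definition has_2join : Prop :=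
  exists V1 V2 A1 B1 A2 B2, is_2join V1 V2 A1 B1 A2 B2.

End Graphs.

(* Ackermann-Peter function. *)
Fixpoint ackermann (i : nat) : nat -> nat :=
  if i is i'.+1 then
    fix loop (j : nat) : nat :=
      if j is j'.+1 then ackermann i' (loop j') else ackermann i' 1
  else succn.

Lemma ackermannSS i j :
  ackermann i.+1 j.+1 = ackermann i (ackermann i.+1 j).
Proof. by []. Qed.

Lemma ackermann_gt i j : j < ackermann i j.
Proof.
elim: i j => [|i IHi] j //.
elim: j => [|j IHj]; first by apply: ltn_trans (IHi 1).
by rewrite ackermannSS; apply: leq_ltn_trans IHj (IHi _).
Qed.

Lemma ackermann_ltS i j : ackermann i j < ackermann i j.+1.
Proof. by case: i => [|i] //; rewrite ackermannSS ackermann_gt. Qed.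

Lemma ackermann_ge i j : i + j < ackermann i j.
Proof.
elim: i j => [|i IHi] j //.
elim: j => [|j IHj]; first by rewrite addn0 -addn1; apply: IHi.
rewrite ackermannSS addnS; apply: leq_ltn_trans IHj _.
exact: ackermann_gt.
Qed.

Lemma inv_ackermann_ex m n :
  exists i, (0 < i) && (n <= 2 ^ ackermann i (m %/ n)).
Proof.
exists n.+1; apply: leq_trans (ltnW (ltn_expl n (isT : 1 < 2))) _.
rewrite leq_exp2l //; apply: ltnW.
apply: leq_ltn_trans (ackermann_ge n.+1 _).
exact: leq_trans (leqnSn n) (leq_addr _ _).
Qed.

(* alpha(m, n) = min {i >= 1 : A(i, floor(m / n)) >= log_2 n} *)
Definition inv_ackermann (m n : nat) : nat := ex_minn (inv_ackermann_ex m n).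

(* Word RAM, presented as a structured language.  A program is a fixed [cmd];
   it uses registers and one-dimensional arrays, whose names are static (so
   finitely many occur in a program), with indirect addressing inside arrays.
   Every operation costs one unit. *)
Inductive binop := Add | Sub | Mul | Leq | Eq.

Inductive expr :=
  | Num of nat
  | Reg of nat
  | Cell of nat & expr
  | Bin of binop & expr & expr.

Inductive cmd :=
  | Skip
  | SetReg of nat & expr
  | SetCell of nat & expr & expr
  | Seq of cmd & cmd
  | If of expr & cmd & cmd
  | While of expr & cmd.

Record state := State { regs : nat -> nat; cells : nat -> nat -> nat }.

Definition set_reg (s : state) (r v : nat) : state :=
  State (fun r' => if r' == r then v else regs s r') (cells s).

Definition set_cell (s : state) (a i v : nat) : state :=
  State (regs s)
    (fun a' i' => if (a' == a) && (i' == i) then v else cells s a' i').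

Definition apply_binop (o : binop) (u v : nat) : nat :=
  match o with
  | Add => u + v
  | Sub => u - v
  | Mul => u * v
  | Leq => u <= v
  | Eq => u == v
  end.

(* All values, addresses included, must be smaller than [W]; evaluation is
   undefined on overflow. *)
Definition fit (W v : nat) : option nat := if v < W then Some v else None.

Fixpoint eval (W : nat) (s : state) (e : expr) : option nat :=
  match e with
  | Num k => fit W k
  | Reg r => fit W (regs s r)
  | Cell a i => if eval W s i is Some j then fit W (cells s a j) else None
  | Bin o e1 e2 =>
      match eval W s e1, eval W s e2 with
      | Some u, Some v => fit W (apply_binop o u v)
      | _, _ => None
      end
  end.

Fixpoint expr_cost (e : expr) : nat :=
  match e with
  | Num _ | Reg _ => 1
  | Cell _ i => (expr_cost i).+1
  | Bin _ e1 e2 => (expr_cost e1 + expr_cost e2).+1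
  end.

(* [exec W c s t s']: started in [s], the program [c] terminates in [s'] after
   [t] steps, without ever overflowing [W]. *)
Inductive exec (W : nat) : cmd -> state -> nat -> state -> Prop :=
  | exec_skip s : exec W Skip s 1 s
  | exec_set_reg s r e v : eval W s e = Some v ->
      exec W (SetReg r e) s (expr_cost e).+1 (set_reg s r v)
  | exec_set_cell s a i e j v : eval W s i = Some j -> eval W s e = Some v ->
      exec W (SetCell a i e) s (expr_cost i + expr_cost e).+1
        (set_cell s a j v)
  | exec_seq c1 c2 s s1 s2 t1 t2 :
      exec W c1 s t1 s1 -> exec W c2 s1 t2 s2 ->
      exec W (Seq c1 c2) s (t1 + t2) s2
  | exec_if e c1 c2 s s' v t : eval W s e = Some v ->
      exec W (if v != 0 then c1 else c2) s t s' ->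
      exec W (If e c1 c2) s ((expr_cost e).+1 + t) s'
  | exec_while_stop e c s : eval W s e = Some 0 ->
      exec W (While e c) s (expr_cost e).+1 s
  | exec_while_loop e c s s1 s2 v t1 t2 : eval W s e = Some v -> v != 0 ->
      exec W c s t1 s1 -> exec W (While e c) s1 t2 s2 ->
      exec W (While e c) s ((expr_cost e).+1 + t1 + t2) s2.

Definition adjacency_lists (n : nat) (G : sgraph 'I_n)
    (nbrs : 'I_n -> seq 'I_n) : Prop :=
  forall x, uniq (nbrs x) /\ nbrs x =i [pred y | G x y].

(* The input word: n, followed, for each vertex in turn, by its degree and its
   list of neighbors. *)
Definition encode_graph (n : nat) (nbrs : 'I_n -> seq 'I_n) : seq nat :=
  n :: flatten [seq size (nbrs x) :: map val (nbrs x) | x <- enum 'I_n].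

(* The input word is in array 0; everything else is 0. *)
Definition init_state (w : seq nat) : state :=
  State (fun=> 0) (fun a i => if a == 0 then nth 0 w i else 0).

(* The subset of 'I_n whose characteristic vector is in array [a]. *)
Definition output_set (n : nat) (s : state) (a : nat) : {set 'I_n} :=
  [set x : 'I_n | cells s a x != 0].

(* Register 0 holds the verdict; if it is 1, then arrays 1 to 6 hold V1, V2,
   A1, B1, A2, B2. *)
Definition correct_2join_output (n : nat) (G : sgraph 'I_n) (s : state) :
    Prop :=
  (regs s 0 = 1 /\
   is_2join G (output_set n s 1) (output_set n s 2) (output_set n s 3)
     (output_set n s 4) (output_set n s 5) (output_set n s 6)) \/
  (regs s 0 = 0 /\ ~ has_2join G).

(* Main.v *)
Require Import Defs.
From mathcomp Require Import all_boot.
From mathcomp Require Import zify.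

(** If [A1, A2] and [B1, B2] are the attachment sets of a 2-join, then for every
    edge [a b] between [A1] and [A2] the clique [A1 :|: A2] is [N[a] :&: N[b]],
    and likewise for [B].  Deleting the edges inside [A := A1 :|: A2] and
    [B := B1 :|: B2] separates the two sides; since there is no 1-join, every
    component with a vertex outside [A :|: B] meets both cliques, so [a] and [b]
    may be chosen in two such components.

    For each of the [m] edges [a b], delete the edges inside [A], let [D] be the
    distance from [a] (starting at 1) and [p 1, ..., p L] a shortest path from [a]
    to [b].  It crosses the 2-join exactly once, so [B] is [N[p i] :&: N[p i.+1]]
    for some [i]; all vertices of [B] then have [D <= i.+1], and the side of [b]
    may be taken to be its component [Q i] in the graph of the edges [x y] with
    [D x + D y >= 2 * i + 3].  The sets [Q i] are nested and are all obtained from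
    one bottleneck search from [b]; an edge can leave only the set [Q i] with
    [i = D x - 1], so that all [i] are tested together in [O(n * Delta)] time.
    Checking that both sides of a valid cut have a vertex outside [A :|: B] takes
    [O(n)] time, but can fail only for the two first and the two last [i],
    because two consecutive vertices of the path are never both in [A].

    The union-find structure behind the term [alpha] is thus not needed. *)

Set Implicit Arguments.
Unset Strict Implicit.
Unset Printing Implicit Defensive.

(** * Clique cuts along a shortest path *)

(* [lia] may not terminate in the presence of set-theoretic hypotheses. *)
Ltac nlia :=
  repeat match goal with
  | H : context [in_mem _ _] |- _ => clear H
  | H : context [clique _ _] |- _ => clear H
  end; lia.

(** The threshold [2 * i + 3] comes from the layers. An edge that survives the deletion joins equal
    or consecutive layers, so its weight [D x + D y] is at least [2 * i + 3] exactly when it reaches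
    beyond layer [i + 1]. Edges inside [B] stay within the first [i + 1] layers, so discarding light
    edges cuts through [B] although [B] has not been determined; the side of [b] depends on [i] only
    through a threshold.

    The obstacle is the number of candidates: pairing every edge [a b] with every edge across [B]
    would give [m * m] tests. The layers leave fewer than [n] candidates per edge [a b], and a
    vertex has to be scanned for only one of them.

    The component that is found may be a proper part of the side [V2] of a given 2-join; the rest of
    [V2] then moves to the other side. The danger is that the component has no vertex outside both
    cliques. Absence of a 1-join removes it: [b] can be chosen so that a path without edges inside
    [A] or [B] joins it to a vertex of [V2] outside both cliques, and such a path cannot leave the
    component. *)

Section CutSearch.
Variables (T : finType) (G : sgraph T).

Definition cladj (x y : T) : bool := (x == y) || G x y.

Definition cap2 (u v : T) : {set T} := [set x | cladj u x && cladj v x].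

Definition del (A : {set T}) (x y : T) : bool :=
  G x y && ~~ ((x \in A) && (y \in A)).

Lemma del_sym A : symmetric (del A).
Proof. by move=> x y; rewrite /del adj_sym andbC [X in ~~ X]andbC andbC. Qed.

Lemma clique_cladj (K : {set T}) x y :
  clique G K -> x \in K -> y \in K -> cladj x y.
Proof.
move=> cK xK yK; rewrite /cladj; case: eqVneq => //= ne; exact: cK.
Qed.

Variables (a b : T).
Local Notation A := (cap2 a b).

(** One plus the distance from [a], with 0 for unreachable vertices. The description is local, so
    that it can be read off the final keys of a search. *)
Definition layering (D : T -> nat) : Prop :=
  [/\ D a = 1,
      forall x y, 0 < D x -> del A x y -> 0 < D y <= (D x).+1,
      forall x, 1 < D x -> exists y, del A y x /\ (D y).+1 = D x
    & forall x, D x = 1 -> x = a].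

(** Only the values [p 1, ..., p (D b)] are constrained. The start of the path is fixed by its
    layer: [a] is the only vertex with [D] equal to 1. *)
Definition shortest (D : T -> nat) (p : nat -> T) : Prop :=
  p (D b) = b /\
  forall i, 0 < i < D b -> del A (p i) (p i.+1) /\ D (p i) = i.

Definition heavy (D : T -> nat) (i : nat) : rel T :=
  [rel x y | del A x y && (2 * i + 3 <= D x + D y)].

Variables (D : T -> nat) (p : nat -> T).
Hypotheses (lay : layering D) (sho : shortest D p).

Let Da : D a = 1. Proof. by case: lay. Qed.
Let D1 x y : 0 < D x -> del A x y -> 0 < D y <= (D x).+1.
Proof. by case: lay => _ h _ _; apply: h. Qed.
Let D2 x : 1 < D x -> exists y, del A y x /\ (D y).+1 = D x.
Proof. by case: lay => _ _ h _; apply: h. Qed.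

Lemma shortest_layer i : 0 < i <= D b -> D (p i) = i.
Proof.
case: sho => pb hp /andP[i0]; rewrite leq_eqVlt => /orP[/eqP->|lt].
  by rewrite pb.
by have [] := hp i; rewrite ?i0.
Qed.

(** An edge with an end in layer [i] or lower has its other end in layer [i + 1] at most, hence
    weight at most [2 * i + 1]. *)
Lemma heavy_layer i x : i < D b -> connect (heavy D i) b x -> i < D x.
Proof.
move=> ib /connectP[q qp ->] {x}.
suff: forall u, i < D u -> path (heavy D i) u q -> i < D (last u q) by apply.
elim: q {qp} => [|v q IH] u iu //= /andP[/andP[duv w] /IH]; apply.
have /andP[] := D1 (leq_ltn_trans (leq0n _) iu) duv => v0 _.
rewrite del_sym in duv; have := D1 v0 duv; nlia.
Qed.

Lemma heavy_path i j : 0 < i < j -> j <= D b -> connect (heavy D i) b (p j).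
Proof.
case: sho => pb hp /andP[i0 ij] jb.
have [k kE] : exists k, D b = j + k by exists (D b - j); rewrite subnKC.
elim: k j ij jb kE => [|k IH] j ij jb kE; first by rewrite -[j]addn0 -kE pb.
apply: connect_trans (IH j.+1 _ _ _) _; try nlia.
apply: connect1; rewrite /heavy /= del_sym.
have [|-> Dj] := hp j; first nlia.
by rewrite Dj shortest_layer //; nlia.
Qed.

(** The edge is light, so [D x + D y] is at most [2 * i + 2]; with [i < D x] and [D x <= D y + 1]
    this leaves one value for [D x]. *)
Lemma heavy_boundary i x y : i < D b -> connect (heavy D i) b x ->
  ~~ connect (heavy D i) b y -> del A x y -> D x = i.+1.
Proof.
move=> ib cx cy dxy.
have w : ~~ (2 * i + 3 <= D x + D y).
  by apply: contra cy => w; apply: connect_trans cx (connect1 _); rewrite /heavy /= dxy.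
have ix := heavy_layer ib cx.
have /andP[y0 _] := D1 (leq_ltn_trans (leq0n _) ix) dxy.
have dyx : del A y x by rewrite del_sym.
have := D1 y0 dyx; nlia.
Qed.

Variable i : nat.
Hypothesis ib : 0 < i < D b.
Local Notation B := (cap2 (p i) (p i.+1)).
Local Notation Q := ([set x | connect (heavy D i) b x]).

(** Restricted to layer [i + 1], the only layer that the program scans for cut [i]; [heavy_boundary]
    extends it to all kept edges that leave [Q]. *)
Definition separates : Prop :=
  forall x y, D x = i.+1 -> x \in Q -> y \notin Q -> del A x y ->
  x \in B /\ y \in B.

Lemma cap2_l u v : G u v -> u \in cap2 u v.
Proof. by move=> uv; rewrite inE /cladj eqxx (adj_sym G) uv orbT. Qed.

Lemma cap2_r u v : G u v -> v \in cap2 u v.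
Proof. by move=> uv; rewrite inE /cladj eqxx uv orbT. Qed.

Let pGi : G (p i) (p i.+1).
Proof. by case: sho => _ /(_ i ib)[/andP[]]. Qed.

(** Soundness. The layers show that the four attachment sets are inhabited: [a] and [p i] lie in
    layers at most [i], hence outside [Q], while [b] and [p i.+1] lie in [Q]. *)
Lemma cut_2join :
  G a b -> clique G A -> clique G B -> [disjoint A & B] -> separates ->
  (exists2 x, x \in Q & x \notin A :|: B) ->
  (exists2 x, x \notin Q & x \notin A :|: B) ->
  is_2join G (~: Q) Q (A :\: Q) (B :\: Q) (A :&: Q) (B :&: Q).
Proof.
move=> ab cA cB dAB sep [x2 x2Q x2AB] [x1 x1Q x1AB].
have aA : a \in A by apply: cap2_l.
have bA : b \in A by apply: cap2_r.
have piB : p i \in B by apply: cap2_l.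
have pSB : p i.+1 \in B by apply: cap2_r.
have bQ : b \in Q by rewrite inE connect0.
have ltQ x : x \in Q -> i < D x by rewrite inE; apply: heavy_layer; case/andP: ib.
have aQ : a \notin Q by apply/negP => /ltQ; rewrite Da; nlia.
have piQ : p i \notin Q by apply/negP => /ltQ; rewrite shortest_layer; nlia.
have pSQ : p i.+1 \in Q by rewrite inE; apply: heavy_path; nlia.
have cross x y : G x y -> x \in Q -> y \notin Q ->
    (x \in A /\ y \in A) \/ (x \in B /\ y \in B).
  move=> Gxy xQ yQ.
  case nA : ((x \in A) && (y \in A)); first by left; apply/andP.
  have dxy : del A x y by rewrite /del Gxy nA.
  right; apply: sep => //; move: xQ yQ; rewrite !inE => xQ yQ.
  by apply: heavy_boundary xQ yQ dxy; case/andP: ib.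
have dj (C : {set T}) : A :\: Q :|: A :&: Q = A.
  by rewrite setUC setID.
split; [|split|split|move=> x y Gxy|split].
- by rewrite set0U setUC setUCr -!setI_eq0 !set0I setIC setICr.
- rewrite -!setI_eq0 !setDE !subsetIr; split=> //.
  rewrite -setI_eq0 in dAB; by rewrite setIACA (eqP dAB) set0I.
- rewrite -!setI_eq0 !subsetIr; split=> //.
  rewrite -setI_eq0 in dAB; by rewrite setIACA (eqP dAB) set0I.
- by rewrite set0U setUC setID.
- by rewrite set0U setUC setID.
- rewrite !set0U ![_ :\: _ :|: _]setUC !setID !in_set0 /= !in_setC.
  case xQ: (x \in Q); case yQ: (y \in Q) => //= _.
    have /negbT yQ' := yQ; exact: cross yQ'.
  have /negbT xQ' := xQ; rewrite (adj_sym G) in Gxy.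
  by have [[]|[]] := cross _ _ Gxy yQ xQ'; [left|right].
- split; apply/set0Pn; [exists a|exists (p i)|exists x1]; rewrite ?inE.
  + by move: aQ aA; rewrite !inE => -> ->.
  + by move: piQ piB; rewrite !inE => -> ->.
  + by move: x1Q x1AB; rewrite !inE negb_or => -> /andP[/negbTE-> /negbTE->].
- split; apply/set0Pn; [exists b|exists (p i.+1)|exists x2]; rewrite ?inE.
  + by move: bQ bA; rewrite !inE => -> ->.
  + by move: pSQ pSB; rewrite !inE => -> ->.
  + by move: x2Q x2AB; rewrite !inE negb_or => -> /andP[/negbTE-> /negbTE->].
Qed.

(** One of [p i.+2], [p i.+3] is outside [A]. Neither is in [B]: it would be adjacent to [p i], by
    an edge that is kept because [p i] lies in [B] and so not in [A], and would then have layer at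
    most [i + 1]. *)
Lemma heavy_interior : i.+2 < D b -> [disjoint A & B] ->
  exists2 x, x \in Q & x \notin A :|: B.
Proof.
move=> i3 dAB.
have [dp _] : del A (p i.+2) (p i.+3) /\ D (p i.+2) = i.+2 by case: sho => _; apply; nlia.
have hB j : i.+1 < j <= D b -> p j \notin B.
  move=> hj; apply/negP; rewrite inE => /andP[/orP[/eqP E|Gp] _].
    by have := @shortest_layer i; rewrite E shortest_layer; nlia.
  have : del A (p i) (p j).
    rewrite /del Gp /=; apply/negP => /andP[piA _].
    move/pred0P: dAB => /(_ (p i)) /=; rewrite piA; by rewrite cap2_l.
  by move/D1; rewrite !shortest_layer; nlia.
have hQ j : i < j <= D b -> p j \in Q by rewrite inE => h; apply: heavy_path; nlia.
have [nA|nA] : p i.+2 \notin A \/ p i.+3 \notin A.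
  by apply/orP; rewrite -negb_and; case/andP: dp.
  by exists (p i.+2); [apply: hQ; nlia | rewrite inE negb_or nA hB //; nlia].
by exists (p i.+3); [apply: hQ; nlia | rewrite inE negb_or nA hB //; nlia].
Qed.

(** Mirror image, with [p i.-2] and [p i.-1]: a vertex [p j] of [B] with [j < i] would be joined to
    [p i.+1] by a kept edge, which skips a layer. *)
Lemma light_interior : 2 < i -> [disjoint A & B] ->
  exists2 x, x \notin Q & x \notin A :|: B.
Proof.
move=> i3 dAB.
have [dp _] : del A (p i.-2) (p i.-1) /\ D (p i.-2) = i.-2.
  have E : i.-2.+1 = i.-1 by nlia.
  by case: sho => _ /(_ i.-2); rewrite E; apply; nlia.
have hB j : 0 < j < i -> p j \notin B.
  move=> hj; apply/negP; rewrite inE => /andP[_ /orP[/eqP E|Gp]].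
    by have := @shortest_layer i.+1; rewrite E shortest_layer; nlia.
  have : del A (p j) (p i.+1).
    rewrite /del adj_sym Gp /=; apply/negP => /andP[_ piA].
    move/pred0P: dAB => /(_ (p i.+1)) /=; rewrite piA; by rewrite cap2_r.
  by move/D1; rewrite !shortest_layer; nlia.
have hQ j : 0 < j < i -> p j \notin Q.
  rewrite inE => h; apply/negP => /heavy_layer; rewrite shortest_layer; nlia.
have [nA|nA] : p i.-2 \notin A \/ p i.-1 \notin A.
  by apply/orP; rewrite -negb_and; case/andP: dp.
  by exists (p i.-2); [apply: hQ; nlia | rewrite inE negb_or nA hB //; nlia].
by exists (p i.-1); [apply: hQ; nlia | rewrite inE negb_or nA hB //; nlia].
Qed.

End CutSearch.

(** * Completeness *)

Section Completeness.
Variables (T : finType) (G : sgraph T).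

Lemma is_2join_sym (V1 V2 A1 B1 A2 B2 : {set T}) :
  is_2join G V1 V2 A1 B1 A2 B2 -> is_2join G V2 V1 A2 B2 A1 B1.
Proof.
move=> [[cov [d1 d2 d3]] [sub1 sub2] [cA cB] cross [ne1 ne2]].
split; [split|split|split|move=> x y Gxy nb|split] => //.
- by rewrite -setUA (setUC V2) setUA.
- by split=> //; rewrite disjoint_sym.
- by rewrite -setUA (setUC A2) setUA.
- by rewrite -setUA (setUC B2) setUA.
rewrite -!setUA (setUC A2) (setUC B2) !setUA; apply: cross => //.
by move: nb; rewrite [X in _ || X]orbC.
Qed.

Lemma is_2join_swap (V1 V2 A1 B1 A2 B2 : {set T}) :
  is_2join G V1 V2 A1 B1 A2 B2 -> is_2join G V1 V2 B1 A1 B2 A2.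
Proof.
move=> [cov [[sa1 sb1 d1] [sa2 sb2 d2]] [cA cB] cross [[na1 nb1 i1] [na2 nb2 i2]]].
split=> //.
- by split; split; rewrite // disjoint_sym.
- by move=> x y Gxy nb; case: (cross x y Gxy nb); [right|left].
by split; split; rewrite // setUC.
Qed.

Section TwoJoin.
Variables V1 V2 A1 B1 A2 B2 : {set T}.
Hypothesis J : is_2join G V1 V2 A1 B1 A2 B2.

Lemma join_side x : (x \in V2) = (x \notin V1).
Proof.
case: J => [[cov [_ _ d]] _ _ _ _].
have := in_setT x; rewrite -cov set0U inE.
case x1: (x \in V1) => //= _; exact: disjointFr d x1.
Qed.

Lemma joinA1 x : x \in A1 -> x \in V1.
Proof. by case: J => [_ [[/subsetP h _ _] _] _ _ _]; apply: h. Qed.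
Lemma joinB1 x : x \in B1 -> x \in V1.
Proof. by case: J => [_ [[_ /subsetP h _] _] _ _ _]; apply: h. Qed.
Lemma joinA2 x : x \in A2 -> x \in V2.
Proof. by case: J => [_ [_ [/subsetP h _ _]] _ _ _]; apply: h. Qed.
Lemma joinB2 x : x \in B2 -> x \in V2.
Proof. by case: J => [_ [_ [_ /subsetP h _]] _ _ _]; apply: h. Qed.

Lemma join_cliqueA : clique G (A1 :|: A2).
Proof. by case: J => [_ _ [h _] _ _]; move: h; rewrite set0U. Qed.

Lemma join_cliqueB : clique G (B1 :|: B2).
Proof. by case: J => [_ _ [_ h] _ _]; move: h; rewrite set0U. Qed.

Lemma join_disjoint : [disjoint A1 :|: A2 & B1 :|: B2].
Proof.
case: J => [_ [[_ _ d1] [_ _ d2]] _ _ _].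
rewrite -setI_eq0; apply/set0Pn => -[x]; rewrite !inE.
move=> /andP[/orP[xA|xA] /orP[xB|xB]].
- by rewrite (disjointFr d1 xA) in xB.
- by have := joinB2 xB; rewrite join_side (joinA1 xA).
- by have := joinA2 xA; rewrite join_side (joinB1 xB).
- by rewrite (disjointFr d2 xA) in xB.
Qed.

Lemma join_cross x y : G x y -> x \in V1 -> y \in V2 ->
  (x \in A1 /\ y \in A2) \/ (x \in B1 /\ y \in B2).
Proof.
move=> Gxy x1 y2; have y1 : y \notin V1 by rewrite -join_side.
have x2 : x \in V2 = false by rewrite join_side x1.
have nA2 z : z \in V1 -> z \in A2 = false.
  by move=> z1; apply/negP => /joinA2; rewrite join_side z1.
have nB2 z : z \in V1 -> z \in B2 = false.
  by move=> z1; apply/negP => /joinB2; rewrite join_side z1.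
have nA1 z : z \notin V1 -> z \in A1 = false.
  by move=> z1; apply: contraNF z1 => /joinA1.
have nB1 z : z \notin V1 -> z \in B1 = false.
  by move=> z1; apply: contraNF z1 => /joinB1.
case: J => [_ _ _ /(_ x y Gxy) h _].
move: h; rewrite !inE x2 (negbTE y1) x1 y2 (nA2 x x1) (nB2 x x1) (nA1 y y1) (nB1 y y1).
by rewrite !orbF /= => /(_ isT); case=> h; [left|right].
Qed.

(** A common closed neighbor lies on one side and sees [a] or [b] across the join; since [a] and [b]
    are outside the [B] sets, that edge crosses through the [A] sets. *)
Lemma cap2_join a b : a \in A1 -> b \in A2 -> cap2 G a b = A1 :|: A2.
Proof.
move=> aA bA; apply/setP => x; rewrite inE; apply/idP/idP; last first.
  move=> xA; rewrite !(clique_cladj join_cliqueA) // inE ?aA ?bA ?orbT //.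
have aV := joinA1 aA; have bV := joinA2 bA; have bV1 := bV; rewrite join_side in bV1.
have dA z : z \in A1 :|: A2 -> z \in B1 :|: B2 = false.
  by move=> zA; rewrite (disjointFr join_disjoint zA).
have aB : a \in B1 = false by have := dA a; rewrite !inE aA => /(_ isT)/norP[/negbTE].
have bB : b \in B2 = false by have := dA b; rewrite !inE bA orbT => /(_ isT)/norP[_ /negbTE].
move=> /andP[ax bx]; rewrite inE.
case x1 : (x \in V1).
  move: bx; rewrite /cladj; case: eqVneq => [E|_ /=]; first by rewrite E x1 in bV1.
  rewrite adj_sym => /join_cross /(_ x1 bV) [[-> //]|[_]]; by rewrite bB.
have x2 : x \in V2 by rewrite join_side x1.
move: ax; rewrite /cladj; case: eqVneq => [E|_ /=]; first by rewrite -E aV in x1.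
move=> /join_cross /(_ aV x2) [[_ ->]|[]]; rewrite ?orbT //; by rewrite aB.
Qed.

End TwoJoin.

Definition inner (A B : {set T}) : rel T :=
  [rel x y | del G A x y && ~~ ((x \in B) && (y \in B))].

Lemma inner_sym A B : symmetric (inner A B).
Proof. by move=> x y; rewrite /inner /= del_sym [X in ~~ X]andbC. Qed.

Lemma inner_swap A B : inner A B =2 inner B A.
Proof. by move=> x y; rewrite /inner /del /= -andbA [X in _ && X]andbC andbA. Qed.

(* Otherwise the component would be one side of a 1-join through [B]. *)
Lemma component_meets (A B : {set T}) v u w :
  connected G -> ~ has_1join G -> clique G B -> [disjoint A & B] ->
  u \in A -> w \in B -> v \notin A :|: B -> ~~ connect (inner A B) v w ->
  exists2 x, x \in A & connect (inner A B) v x.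
Proof.
move=> [_ conn] no1 cB dAB uA wB; rewrite !inE negb_or => /andP[vA vB] vw.
pose C := [set x | connect (inner A B) v x].
have [/exists_inP[x xA cx]|/exists_inPn no] := boolP [exists x in A, connect (inner A B) v x].
  by exists x.
have CA x : x \in C -> x \notin A by rewrite inE => cx; apply/negP => /no; rewrite cx.
have vC : v \in C by rewrite inE connect0.
have wC : w \notin C by rewrite inE.
have Cc x y : G x y -> x \in C -> y \notin C -> x \in B /\ y \in B.
  move=> Gxy xC yC; case E : ((x \in B) && (y \in B)); first by apply/andP.
  case/negP: yC; move: (CA _ xC); rewrite !inE in xC *.
  move=> xA; apply: connect_trans xC (connect1 _).
  by rewrite /inner /del /= Gxy (negbTE xA) E.
case: no1; exists C, (~: C), (B :&: C), (B :\: C); split.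
- by split; [rewrite setUCr | rewrite -setI_eq0 setICr].
- by rewrite subsetIr setDE subsetIr.
- by rewrite setID.
- split=> x y.
    rewrite in_setD in_setI in_setC => /andP[xBC xC] yC; apply/negP => Gxy.
    by have [xB _] := Cc _ _ Gxy xC yC; rewrite xB xC in xBC.
  rewrite !in_setD in_setC => /andP[xBC xC] yC; apply/negP; rewrite adj_sym => Gyx.
  by have [_ xB] := Cc _ _ Gyx yC xC; rewrite xB xC in xBC.
split; apply/set0Pn.
(* A path of [G] from [v] to [w] leaves [C], and an edge can leave [C] only from a vertex of [B];
   this inhabits [B :&: C]. *)
- have /connectP[q] := conn v w.
  move: vC; move: {1 2 3}v => y; elim: q y => [|z q IH] y yC /=.
    by move=> _ E; rewrite E yC in wC.
  move=> /andP[yz zq] wq; case zC : (z \in C); first exact: IH zC zq wq.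
  by exists y; rewrite in_setI yC andbT; have [] := Cc _ _ yz yC (negbT zC).
- by exists w; rewrite in_setD wB wC.
- by exists v; rewrite in_setD in_setI vC (negbTE vB).
exists u; rewrite in_setD in_setD in_setC (disjointFr dAB uA) andbF /=.
by apply/negP => /CA; rewrite uA.
Qed.

(** What completeness asks of an edge. The two sides are treated differently because the cut is
    grown from [b]: an interior vertex of [V2] must be tied to [b], whereas one of [V1] only has to
    exist. The last connection makes [b] reachable, so that [D b] is positive. *)
Definition seed (a b : T) : Prop :=
  exists V1 V2 A1 B1 A2 B2, is_2join G V1 V2 A1 B1 A2 B2 /\
  exists v1 v2,
  [/\ a \in A1 /\ b \in A2,
      v1 \in V1 :\: (A1 :|: B1), v2 \in V2 :\: (A2 :|: B2),
      connect (inner (A1 :|: A2) (B1 :|: B2)) b v2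
    & connect (del G (A1 :|: A2)) a b].

Lemma inner_side V1 V2 A1 B1 A2 B2 x y :
  is_2join G V1 V2 A1 B1 A2 B2 ->
  connect (inner (A1 :|: A2) (B1 :|: B2)) x y -> x \in V1 -> y \in V1.
Proof.
move=> J /connectP[q + ->] {y}; elim: q x => [|z q IH] x //= /andP[xz /IH h] x1.
apply: h; apply: contraTT xz => z1; have z2 : z \in V2 by rewrite (join_side J).
apply/negP => /andP[/andP[Gxz nA] nB].
have [[xA zA]|[xB zB]] := join_cross J Gxz x1 z2.
  by case/negP: nA; rewrite !inE xA zA orbT.
by case/negP: nB; rewrite !inE xB zB orbT.
Qed.

(** No edge of [inner] crosses the join, so the component of [v] stays in [V1] and misses any vertex
    of [B2], which serves as the vertex [w] of [component_meets]. *)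
Lemma inner_reach V1 V2 A1 B1 A2 B2 v :
  connected G -> ~ has_1join G ->
  is_2join G V1 V2 A1 B1 A2 B2 -> v \in V1 :\: (A1 :|: B1) ->
  exists2 x, x \in A1 & connect (inner (A1 :|: A2) (B1 :|: B2)) v x.
Proof.
move=> conn no1 J vI.
have [nA1 nB2] : (exists u, u \in A1) /\ (exists w, w \in B2).
  by case: J => _ _ _ _ [[/set0Pn[u uA] _ _] [_ /set0Pn[w wB] _]]; split; [exists u|exists w].
case: nA1 nB2 => u uA [w wB].
move: vI; rewrite !inE negb_or => /andP[/andP[vA vB] vV].
have vA2 : v \in A2 = false by apply/negP => /(joinA2 J); rewrite (join_side J) vV.
have vB2 : v \in B2 = false by apply/negP => /(joinB2 J); rewrite (join_side J) vV.
have [||||x xA cx] := component_meets conn no1 (join_cliqueB J) (join_disjoint J)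
  (u := u) (w := w) (v := v).
- by rewrite inE uA.
- by rewrite inE wB orbT.
- by rewrite !inE (negbTE vA) (negbTE vB) vA2 vB2.
- by apply/negP => /(inner_side J) /(_ vV) w1; have := joinB2 J wB; rewrite (join_side J) w1.
exists x => //; have := inner_side J cx vV => x1.
move: xA; rewrite inE => /orP[//|/(joinA2 J)]; by rewrite (join_side J) x1.
Qed.

(** An interior vertex of each side reaches both cliques, by [inner_reach] for the four symmetric
    forms of the join; [a] and [b] are the vertices where the two components hit [A]. *)
Lemma seed_exists : connected G -> ~ has_1join G -> has_2join G ->
  exists a b, seed a b.
Proof.
move=> conn no1 [V1 [V2 [A1 [B1 [A2 [B2 J]]]]]].
have J' := is_2join_sym J; have K := is_2join_swap J; have K' := is_2join_sym K.
have [v1 [v2 [v1I v2I]]] : exists v1 v2, v1 \in V1 :\: (A1 :|: B1) /\ v2 \in V2 :\: (A2 :|: B2).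
  by case: J => _ _ _ _ [[_ _ /set0Pn[v1 h1]] [_ _ /set0Pn[v2 h2]]]; exists v1, v2.
have [a aA v1a] := inner_reach conn no1 J v1I.
have [b bA] := inner_reach conn no1 J' v2I.
rewrite (setUC A2) (setUC B2) => v2b.
have [x xB] : exists2 x, x \in B1 & connect (inner (A1 :|: A2) (B1 :|: B2)) v1 x.
  have [|x xB] := inner_reach conn no1 K (v := v1); first by rewrite setUC.
  by rewrite (eq_connect (inner_swap _ _)); exists x.
have [y yB] : exists2 y, y \in B2 & connect (inner (A1 :|: A2) (B1 :|: B2)) v2 y.
  have [|y yB] := inner_reach conn no1 K' (v := v2); first by rewrite setUC.
  by rewrite (eq_connect (inner_swap _ _)) (setUC A2) (setUC B2); exists y.
move=> v2y v1x.
have sc := sym_connect_sym (@inner_sym (A1 :|: A2) (B1 :|: B2)).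
exists a, b, V1, V2, A1, B1, A2, B2; split=> //; exists v1, v2; split=> //.
  by rewrite sc.
have sub z t : connect (inner (A1 :|: A2) (B1 :|: B2)) z t -> connect (del G (A1 :|: A2)) z t.
  by apply: connect_sub => ? ? /andP[h _]; apply: connect1.
(* The route is [a], [v1], [x], [y], [v2], [b]; only the edge [x y] crosses the join, and it
   survives because it lies inside [B], which is disjoint from [A]. *)
apply: connect_trans (sub a v1 _) _; first by rewrite sc.
apply: connect_trans (sub _ _ v1x) _.
apply: connect_trans (connect1 (y := y) _) _.
  have dAB := join_disjoint J.
  have xBU : x \in B1 :|: B2 by rewrite inE xB.
  have yBU : y \in B1 :|: B2 by rewrite inE yB orbT.
  rewrite /del (disjointFl dAB xBU) andbT; apply: (join_cliqueB J xBU yBU).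
  apply/eqP => E; have := joinB2 J yB; by rewrite (join_side J) -E (joinB1 J xB).
apply: connect_trans (sub y v2 _) _; first by rewrite sc.
exact: sub.
Qed.

(** Justifies the filters of the main loop: skipping non-edges, edges whose common closed
    neighborhood is not a clique, and pairs with [b] unreachable loses no seed. *)
Lemma seed_edge a b : seed a b ->
  [/\ G a b, clique G (cap2 G a b) & connect (del G (cap2 G a b)) a b].
Proof.
move=> [V1 [V2 [A1 [B1 [A2 [B2 [J [v1 [v2 [[aA bA] _ _ _ ab]]]]]]]]]].
rewrite (cap2_join J aA bA); split=> //; last exact: join_cliqueA J.
apply: (join_cliqueA J); rewrite ?inE ?aA ?bA ?orbT //.
by apply/eqP => E; have := joinA2 J bA; rewrite (join_side J) -E (joinA1 J aA).
Qed.

Lemma layering_reach a b D x :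
  layering G a b D -> connect (del G (cap2 G a b)) a x -> 0 < D x.
Proof.
move=> [Da D1 _ _] /connectP[q + ->] {x}.
have : 0 < D a by rewrite Da.
elim: q {1 3 4}a => [|z q IH] c //= c0 /andP[cz]; apply: IH.
by have /andP[] := D1 _ _ c0 cz.
Qed.

(** Completeness for one edge: the position [i] where the path enters [V2] passes all tests. The
    resulting 2-join may differ from the one behind the seed, since the component of [b] is only
    contained in [V2]. *)
Lemma seed_cut a b D p : seed a b -> layering G a b D -> shortest G a b D p ->
  exists i, [/\ 0 < i < D b, clique G (cap2 G (p i) (p i.+1)),
    [disjoint cap2 G a b & cap2 G (p i) (p i.+1)], separates G a b D p i
  & (exists2 x, connect (heavy G a b D i) b x &
       x \notin cap2 G a b :|: cap2 G (p i) (p i.+1)) /\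
    (exists2 x, ~~ connect (heavy G a b D i) b x &
       x \notin cap2 G a b :|: cap2 G (p i) (p i.+1))].
Proof.
move=> sd lay sho; have [Gab _ cab] := seed_edge sd.
have Db := layering_reach lay cab.
case: (lay) => Da D1 D2 D_1; case: (sho) => pb pd.
move: sd => [V1 [V2 [A1 [B1 [A2 [B2 [J [v1 [v2 [[aA bA] v1I v2I bv2 _]]]]]]]]]].
have EA := cap2_join J aA bA.
rewrite /separates EA in D1 D2 pd *.
have a1 := joinA1 J aA; have b2 := joinA2 J bA.
have dAB := join_disjoint J.
have delcross x y : del G (A1 :|: A2) x y -> x \in V1 -> y \in V2 -> x \in B1 /\ y \in B2.
  move=> /andP[Gxy nA] x1 y2; have [[xA yA]|//] := join_cross J Gxy x1 y2.
  by rewrite !inE xA yA orbT in nA.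
have delB x y : x \in B1 :|: B2 -> y \in B1 :|: B2 -> x != y -> del G (A1 :|: A2) x y.
  move=> xB yB ne; rewrite /del (disjointFl dAB xB) andbT; exact: (join_cliqueB J).
have nV x : x \in V2 -> x \in V1 -> False by rewrite (join_side J) => /negbTE->.
(* [i + 1] is the least position of the path in [V2]; it is not 1, since layer 1 consists of [a]. *)
have [i [ib i1 i2]] : exists i, [/\ 0 < i < D b, p i \in V1 & p i.+1 \in V2].
  have ex : exists j, (0 < j) && (p j \in V2) by exists (D b); rewrite Db pb.
  case: (ex_minnP ex) => j /andP[j0 j2] jmin.
  have jb : j <= D b by apply: jmin; rewrite Db pb.
  have j1 : 1 < j.
    rewrite ltn_neqAle j0 andbT; apply/eqP => E; case: (nV _ j2).
    by rewrite -E (D_1 (p 1)) // (shortest_layer sho) // Db.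
  have jE : j.-1.+1 = j by rewrite prednK.
  exists j.-1; rewrite jE; split=> //; first by clear -j1 jb; lia.
  apply/negPn/negP; rewrite -(join_side J) => h.
  have := jmin j.-1; rewrite h andbT; clear -j1; lia.
have [dp Dpi] := pd i ib.
have [piB pSB] := delcross _ _ dp i1 i2.
have EB := cap2_join (is_2join_swap J) piB pSB.
have DpS : D (p i.+1) = i.+1 by rewrite (shortest_layer sho) //; case/andP: ib.
have i0 : 0 < i by case/andP: ib.
have piBU : p i \in B1 :|: B2 by rewrite inE piB.
have pSBU : p i.+1 \in B1 :|: B2 by rewrite inE pSB orbT.
(* Every other vertex of the clique [B] is a neighbor of [p i] by a kept edge. *)
have DB x : x \in B1 :|: B2 -> D x <= i.+1.
  move=> xB; have [<-|ne] := eqVneq (p i) x; first by rewrite Dpi.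
  have := D1 (p i) x; rewrite Dpi i0 => /(_ isT (delB _ _ piBU xB ne)).
  by case/andP.
(* A vertex of [V2] in a layer up to [i] with predecessor in [V1] would be entered through [B]; that
   predecessor is adjacent to [p i.+1], which would then lie in a layer below [i + 1]. *)
have low k x : D x = k.+1 -> k < i -> x \in V1.
  elim: k x => [|k IH] x Dx ki; first by rewrite (D_1 x).
  have [|u [dux Du]] := D2 x; first by rewrite Dx ?ltnS ?i0.
  have Du' : D u = k.+1 by apply: succn_inj; rewrite Du.
  have u1 : u \in V1 by apply: IH => //; apply: ltnW.
  apply/negPn/negP; rewrite -(join_side J) => x2.
  have [uB xB] := delcross _ _ dux u1 x2.
  have uBU : u \in B1 :|: B2 by rewrite inE uB.
  have upne : u != p i.+1 by apply/eqP => E; apply: (nV u) => //; rewrite E.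
  have := D1 u (p i.+1); rewrite Du' DpS => /(_ isT (delB _ _ uBU pSBU upne)).
  by clear -ki; lia.
have high x : x \in V2 -> 0 < D x -> i < D x.
  move=> x2; case Dx : (D x) => [//|k] _; rewrite ltnS leqNgt; apply/negP => ki.
  by apply: nV x2 _; apply: low Dx ki.
(* A kept edge that crosses the join lies inside [B], so its weight is at most [2 * i + 2] and it is
   light. *)
have heavyV2 x : connect (heavy G a b D i) b x -> x \in V2.
  move=> /connectP[q + ->] {x}; move: b2; elim: q {1 3 4}b => [|z q IH] c c2 //= /andP[/andP[cz w]].
  apply: IH; rewrite (join_side J); apply/negP => z1; rewrite EA in cz.
  rewrite del_sym in cz; have [zB cB] := delcross _ _ cz z1 c2.
  have := DB c; have := DB z; rewrite !inE zB cB orbT => /(_ isT) l1 /(_ isT) l2.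
  clear -w l1 l2; lia.
(* The predecessor of such a vertex is in layer [i], hence in [V1], so the edge between them crosses
   through [B]. *)
have B2D x : x \in V2 -> D x = i.+1 -> x \in B2.
  move=> x2 Dx; have [|u [dux Du]] := D2 x; first by rewrite Dx ?ltnS ?i0.
  have Du' : D u = i by apply: succn_inj; rewrite Du.
  have u1 : u \in V1 by apply: (low i.-1); rewrite ?prednK.
  by have [] := delcross _ _ dux u1 x2.
(* An edge that leaves the component either crosses the join, or is a light edge inside [V2]; in the
   second case both ends are in layer [i + 1] and [B2D] applies to both. *)
have sep x y : D x = i.+1 -> connect (heavy G a b D i) b x ->
    ~~ connect (heavy G a b D i) b y -> del G (A1 :|: A2) x y ->
    x \in B1 :|: B2 /\ y \in B1 :|: B2.
  move=> Dx cx cy xy; have x2 := heavyV2 _ cx.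
  have w : ~~ (2 * i + 3 <= D x + D y).
    apply: contra cy => w; apply: connect_trans cx (connect1 _).
    by rewrite /heavy EA /= xy w.
  case y1: (y \in V1).
    have yx : del G (A1 :|: A2) y x by rewrite del_sym.
    have [yB xB] := delcross _ _ yx y1 x2.
    by rewrite !inE xB yB orbT.
  have y2 : y \in V2 by rewrite (join_side J) y1.
  have := D1 x y; rewrite Dx => /(_ isT xy) /andP[y0 _].
  have yi := high y y2 y0.
  have Dy : D y = i.+1 by clear -w Dx yi; lia.
  by rewrite !inE (B2D _ x2 Dx) (B2D _ y2 Dy) !orbT.
exists i; rewrite EB; split=> //.
- exact: join_cliqueB J.
- move=> x y Dx xQ yQ; apply: sep => //; by [move: xQ; rewrite inE|move: yQ; rewrite inE].
have out x : x \in V1 :\: (A1 :|: B1) -> x \notin A1 :|: A2 :|: (B1 :|: B2).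
  rewrite !inE negb_or => /andP[/andP[/negbTE-> /negbTE->] x1] /=.
  by apply/norP; split; apply/negP => h; apply: (nV x) => //; [exact: (joinA2 J h)|exact: (joinB2 J h)].
have out2 x : x \in V2 :\: (A2 :|: B2) -> x \notin A1 :|: A2 :|: (B1 :|: B2).
  rewrite !inE negb_or => /andP[/andP[/negbTE-> /negbTE->] x2] /=.
  by rewrite !orbF; apply/norP; split; apply/negP => h; apply: (nV x) => //; [exact: (joinA1 J h)|exact: (joinB1 J h)].
split.
  (* Along the path from [b] to [v2] an edge leaving the component would lie inside [B] by [sep],
     but the path has no such edge. *)
  exists v2; last exact: out2.
  move: bv2 => /connectP[q + ->].
  have : connect (heavy G a b D i) b b by [].
  elim: q {3 4 7}b => [|z q IH] c //= bc /andP[cz]; apply: IH.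
  move: cz => /andP[cz nB]; apply/negPn/negP => bz.
  have cz' : del G (cap2 G a b) c z by rewrite EA.
  have ib' : i < D b by case/andP: ib.
  have [cB zB] := sep c z (heavy_boundary lay ib' bc bz cz') bc bz cz.
  by rewrite cB zB in nB.
exists v1; last exact: out.
apply/negP => /heavyV2 /nV; apply.
by move: v1I; rewrite !inE => /andP[].
Qed.

End Completeness.

(** * Cost semantics without overflow *)

Fixpoint den (s : state) (e : expr) : nat :=
  match e with
  | Defs.Num k => k
  | Reg r => regs s r
  | Cell a i => cells s a (den s i)
  | Bin o e1 e2 => apply_binop o (den s e1) (den s e2)
  end.

(* [esz] bounds the exponent: over a state with values at most [X >= 2],
   every subterm of [e] has value at most [X ^ esz e]. *)
Fixpoint esz (e : expr) : nat :=
  match e with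
  | Defs.Num k => k.+1
  | Reg _ => 1
  | Cell _ i => esz i
  | Bin _ e1 e2 => esz e1 + esz e2
  end.

Fixpoint csz (c : cmd) : nat :=
  match c with
  | Skip => 0
  | SetReg _ e => esz e
  | SetCell _ i e => maxn (esz i) (esz e)
  | Seq c1 c2 => maxn (csz c1) (csz c2)
  | If e c1 c2 => maxn (esz e) (maxn (csz c1) (csz c2))
  | While e c => maxn (esz e) (csz c)
  end.

Definition bounded (X : nat) (s : state) : Prop :=
  (forall r, regs s r <= X) /\ (forall a i, cells s a i <= X).

(** The costs are those of [exec], but only stored values are bounded, by a polynomial [X].
    Addresses and intermediate results are absorbed by a word size that is a fixed power of [X], so
    program proofs never meet overflow. *)
Inductive steps (X : nat) : cmd -> state -> nat -> state -> Prop :=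
  | steps_skip s : steps X Skip s 1 s
  | steps_set_reg s r e : den s e <= X ->
      steps X (SetReg r e) s (expr_cost e).+1 (set_reg s r (den s e))
  | steps_set_cell s a i e : den s e <= X ->
      steps X (SetCell a i e) s (expr_cost i + expr_cost e).+1
        (set_cell s a (den s i) (den s e))
  | steps_seq c1 c2 s s1 s2 t1 t2 :
      steps X c1 s t1 s1 -> steps X c2 s1 t2 s2 ->
      steps X (Seq c1 c2) s (t1 + t2) s2
  | steps_if e c1 c2 s s' t :
      steps X (if den s e != 0 then c1 else c2) s t s' ->
      steps X (If e c1 c2) s ((expr_cost e).+1 + t) s'
  | steps_while_stop e c s : den s e = 0 ->
      steps X (While e c) s (expr_cost e).+1 s
  | steps_while_loop e c s s1 s2 t1 t2 : den s e != 0 ->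
      steps X c s t1 s1 -> steps X (While e c) s1 t2 s2 ->
      steps X (While e c) s ((expr_cost e).+1 + t1 + t2) s2.

Lemma esz_gt0 e : 0 < esz e.
Proof. by elim: e => //= o e1 H1 e2 H2; rewrite addn_gt0 H1. Qed.

Lemma den_bound X s e : 1 < X -> bounded X s -> den s e <= X ^ esz e.
Proof.
move=> X1 [Br Bc]; elim: e => [k|r|a i IH|o e1 IH1 e2 IH2] /=.
- apply: leq_trans (ltnW (ltn_expl k.+1 X1)); exact: leqnSn.
- by rewrite expn1.
- by apply: leq_trans (Bc _ _) _; rewrite -{1}(expn1 X) leq_exp2l // esz_gt0.
(* Both powers are at least 2, so a sum is bounded by their product, as a product of values is. *)
have p1 : X ^ 1 <= X ^ esz e1 by rewrite leq_exp2l // esz_gt0.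
have p2 : X ^ 1 <= X ^ esz e2 by rewrite leq_exp2l // esz_gt0.
rewrite expn1 in p1 p2.
rewrite expnD; case: o => /=; set u := den s e1 in IH1 *; set v := den s e2 in IH2 *.
- by nia.
- by nia.
- exact: leq_mul.
- by case: leqP; nia.
- by case: eqP; nia.
Qed.

Lemma eval_den X S W s e :
  1 < X -> X ^ S < W -> bounded X s -> esz e <= S -> eval W s e = Some (den s e).
Proof.
move=> X1 XW B.
have fitE v m : v <= X ^ m -> m <= S -> fit W v = Some v.
  move=> vm mS; rewrite /fit (leq_ltn_trans vm) //.
  by apply: leq_ltn_trans XW; rewrite leq_exp2l.
elim: e => [k|r|a i IH|o e1 IH1 e2 IH2] /= le.
- exact: fitE (den_bound (Defs.Num k) X1 B) le.
- exact: fitE (den_bound (Reg r) X1 B) le.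
- by rewrite IH //; apply: fitE (den_bound (Cell a i) X1 B) le.
rewrite IH1 ?IH2; try by apply: leq_trans le; rewrite ?leq_addr ?leq_addl.
exact: fitE (den_bound (Bin o e1 e2) X1 B) le.
Qed.

Lemma bounded_set_reg X s r v : bounded X s -> v <= X -> bounded X (set_reg s r v).
Proof. by move=> [Br Bc] vX; split=> //= r'; case: ifP. Qed.

Lemma bounded_set_cell X s a i v :
  bounded X s -> v <= X -> bounded X (set_cell s a i v).
Proof. by move=> [Br Bc] vX; split=> //= a' i'; case: ifP. Qed.

(** [X ^ S] bounds every subterm evaluated over stored values at most [X], and that bound on the
    stored values is preserved by each step. *)
Lemma steps_exec X S W c s t s' :
  1 < X -> X ^ S < W -> csz c <= S -> bounded X s -> steps X c s t s' ->
  exec W c s t s' /\ bounded X s'.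
Proof.
move=> X1 XW + + st.
have ev e s0 : bounded X s0 -> esz e <= S -> eval W s0 e = Some (den s0 e).
  exact: eval_den.
elim: st => {c s t s'}.
- by move=> s _ B; split=> //; constructor.
- move=> s r e eX /= le B; split; last exact: bounded_set_reg.
  by constructor; apply: ev.
- move=> s a i e eX /=; rewrite geq_max => /andP[li le] B.
  split; last exact: bounded_set_cell.
  by constructor; apply: ev.
- move=> c1 c2 s s1 s2 t1 t2 _ IH1 _ IH2 /=; rewrite geq_max => /andP[l1 l2] B.
  have [E1 B1] := IH1 l1 B; have [E2 B2] := IH2 l2 B1.
  by split=> //; apply: exec_seq E1 E2.
- move=> e c1 c2 s s' t _ IH /=; rewrite !geq_max => /and3P[le l1 l2] B.
  have [|E B'] := IH _ B; first by case: ifP.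
  by split=> //; apply: exec_if E; apply: ev.
- move=> e c s e0 /=; rewrite geq_max => /andP[le lc] B; split=> //.
  by constructor; rewrite ev // e0.
- move=> e c s s1 s2 t1 t2 e0 _ IH1 _ IH2 /= l; have := l.
  rewrite geq_max => /andP[le lc] B.
  have [E1 B1] := IH1 lc B; have [E2 B2] := IH2 l B1.
  by split=> //; apply: exec_while_loop E1 E2; first exact: ev.
Qed.

(** * Footprints: what a command may change *)

Fixpoint wregs (c : cmd) : seq nat :=
  match c with
  | SetReg r _ => [:: r]
  | Seq c1 c2 | If _ c1 c2 => wregs c1 ++ wregs c2
  | While _ c => wregs c
  | _ => [::]
  end.

Fixpoint warrs (c : cmd) : seq nat :=
  match c with
  | SetCell a _ _ => [:: a]
  | Seq c1 c2 | If _ c1 c2 => warrs c1 ++ warrs c2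
  | While _ c => warrs c
  | _ => [::]
  end.

Definition frame (rs ars : seq nat) (s s' : state) : Prop :=
  (forall r, r \notin rs -> regs s' r = regs s r) /\
  (forall a i, a \notin ars -> cells s' a i = cells s a i).

Notation cframe c := (frame (wregs c) (warrs c)).

Lemma frame_refl rs ars s : frame rs ars s s. Proof. by []. Qed.

Lemma frame_trans rs ars s1 s2 s3 :
  frame rs ars s1 s2 -> frame rs ars s2 s3 -> frame rs ars s1 s3.
Proof.
by move=> [r1 c1] [r2 c2]; split=> [r|a i] h; rewrite ?r2 ?r1 // ?c2 ?c1.
Qed.

Lemma frame_subset (rs ars rs' ars' : seq nat) s s' :
  {subset rs <= rs'} -> {subset ars <= ars'} ->
  frame rs ars s s' -> frame rs' ars' s s'.
Proof.
move=> sr sa [fr fa]; split=> [r|a i] h.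
  by apply: fr; apply: contraNN h => /sr.
by apply: fa; apply: contraNN h => /sa.
Qed.

Lemma frame_sub (rs ars rs' ars' : seq nat) s s' :
  frame rs ars s s' -> all (mem rs') rs && all (mem ars') ars -> frame rs' ars' s s'.
Proof. by move=> F /andP[/allP h1 /allP h2]; apply: frame_subset F. Qed.

Lemma frame_set_reg (rs ars : seq nat) s r v :
  r \in rs -> frame rs ars s (set_reg s r v).
Proof.
by move=> rrs; split=> [r'|//] /=; case: eqP => // ->; rewrite rrs.
Qed.

Lemma frame_set_cell (rs ars : seq nat) s a i v :
  a \in ars -> frame rs ars s (set_cell s a i v).
Proof.
by move=> h; split=> [//|a' i'] /=; case: eqP => //= ->; rewrite h.
Qed.

Lemma steps_frame X c s t s' : steps X c s t s' -> cframe c s s'.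
Proof.
elim=> {c s t s'}; try by move=> *; apply: frame_refl.
- by move=> s r e _; apply: frame_set_reg; rewrite inE.
- by move=> s a i e _; apply: frame_set_cell; rewrite inE.
- move=> c1 c2 s s1 s2 t1 t2 _ F1 _ F2; apply: frame_trans.
    by apply: frame_subset F1 => x /= h; rewrite mem_cat h.
  by apply: frame_subset F2 => x /= h; rewrite mem_cat h orbT.
- move=> e c1 c2 s s' t _; case: ifP => _; apply: frame_subset => x /= h;
    by rewrite mem_cat h ?orbT.
- by move=> e c s s1 s2 t1 t2 _ _ F1 _ F2; apply: frame_trans F1 F2.
Qed.

(** * Total correctness with a time bound *)

Definition spec (X : nat) (c : cmd) (s : state) (T : nat) (Q : state -> Prop) :=
  exists t s', [/\ steps X c s t s', t <= T & Q s'].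

Lemma spec_imp X c s T T' (Q Q' : state -> Prop) :
  spec X c s T Q -> T <= T' ->
  (forall s', cframe c s s' -> Q s' -> Q' s') -> spec X c s T' Q'.
Proof.
move=> [t [s' [st le q]]] TT' QQ'; exists t, s'; split=> //; first exact: leq_trans TT'.
exact: QQ' (steps_frame st) q.
Qed.

Lemma spec_le X c s T T' Q : spec X c s T Q -> T <= T' -> spec X c s T' Q.
Proof. by move=> h le; apply: spec_imp h le _. Qed.

Lemma spec_seq X c1 c2 s T1 T2 (Q1 Q : state -> Prop) :
  spec X c1 s T1 Q1 ->
  (forall s1, cframe c1 s s1 -> Q1 s1 -> spec X c2 s1 T2 Q) ->
  spec X (Seq c1 c2) s (T1 + T2) Q.
Proof.
move=> [t1 [s1 [st1 le1 q1]]] /(_ s1 (steps_frame st1) q1) [t2 [s2 [st2 le2 q2]]].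
by exists (t1 + t2), s2; split=> //; [apply: steps_seq st1 st2 | apply: leq_add].
Qed.

Lemma spec_if X e c1 c2 s T Q :
  (den s e != 0 -> spec X c1 s T Q) -> (den s e = 0 -> spec X c2 s T Q) ->
  spec X (If e c1 c2) s ((expr_cost e).+1 + T) Q.
Proof.
move=> h1 h2.
have [t [s' [st le q]]] : spec X (if den s e != 0 then c1 else c2) s T Q.
  by case: eqP => [/h2|/eqP/h1].
exists ((expr_cost e).+1 + t), s'; split=> //; first exact: steps_if.
by rewrite leq_add2l.
Qed.

Lemma spec_skip X s (Q : state -> Prop) : Q s -> spec X Skip s 1 Q.
Proof. by exists 1, s; split=> //; constructor. Qed.

(** Weakest precondition of loop-free code, so that straight-line pieces are verified by
    computation. Loops are refused here and go through [spec_while]. *)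
Fixpoint wpl (X : nat) (c : cmd) (s : state) (Q : state -> Prop) : Prop :=
  match c with
  | Skip => Q s
  | SetReg r e => den s e <= X /\ Q (set_reg s r (den s e))
  | SetCell a i e => den s e <= X /\ Q (set_cell s a (den s i) (den s e))
  | Seq c1 c2 => wpl X c1 s (fun s1 => wpl X c2 s1 Q)
  | If e c1 c2 => if den s e != 0 then wpl X c1 s Q else wpl X c2 s Q
  | While _ _ => False
  end.

Fixpoint ccost (c : cmd) : nat :=
  match c with
  | Skip => 1
  | SetReg _ e => (expr_cost e).+1
  | SetCell _ i e => (expr_cost i + expr_cost e).+1
  | Seq c1 c2 => ccost c1 + ccost c2
  | If e c1 c2 => (expr_cost e).+1 + maxn (ccost c1) (ccost c2)
  | While _ _ => 0
  end.

Lemma spec_wpl X c s Q : wpl X c s Q -> spec X c s (ccost c) Q.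
Proof.
elim: c s Q => [|r e|a i e|c1 IH1 c2 IH2|e c1 IH1 c2 IH2|//] s Q /=.
- exact: spec_skip.
- by move=> [le q]; exists (expr_cost e).+1, (set_reg s r (den s e)); split=> //; constructor.
- move=> [le q]; exists (expr_cost i + expr_cost e).+1.
  by exists (set_cell s a (den s i) (den s e)); split=> //; constructor.
- by move=> /IH1 h; apply: spec_seq h _ => s1 _ /IH2.
move=> h; apply: spec_if => e0.
  by rewrite e0 in h; apply: spec_le (IH1 _ _ h) _; rewrite leq_maxl.
by rewrite e0 eqxx /= in h; apply: spec_le (IH2 _ _ h) _; rewrite leq_maxr.
Qed.

(* [Phi] is a potential: each iteration is paid for by its decrease. *)
Lemma spec_while X e c s0 (Inv : state -> Prop) (Phi : state -> nat) (Q : state -> Prop) :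
  (forall s, cframe c s0 s -> Inv s -> den s e != 0 ->
     exists T, spec X c s T (fun s' =>
       Inv s' /\ (expr_cost e).+1 + T + Phi s' <= Phi s)) ->
  (forall s, cframe c s0 s -> Inv s -> den s e = 0 -> Q s) ->
  Inv s0 -> spec X (While e c) s0 (Phi s0 + (expr_cost e).+1) Q.
Proof.
move=> step stop inv0.
suff main k s : Phi s <= k -> cframe c s0 s -> Inv s ->
    spec X (While e c) s (Phi s + (expr_cost e).+1) Q.
  exact: main (leqnn _) (frame_refl _ _ _) inv0.
elim: k s => [|k IH] s le F inv.
  have [e0|e0] := eqVneq (den s e) 0.
    exists (expr_cost e).+1, s; split; [exact: steps_while_stop|exact: leq_addl|exact: stop].
  by have [T [t [s1 [_ _ [_ ]]]]] := step _ F inv e0; lia.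
have [e0|e0] := eqVneq (den s e) 0.
  exists (expr_cost e).+1, s; split; [exact: steps_while_stop|exact: leq_addl|exact: stop].
have [T [t [s1 [st1 tT [inv1 dec]]]]] := step _ F inv e0.
have le1 : Phi s1 <= k by lia.
have [t2 [s2 [st2 le2 q]]] := IH s1 le1 (frame_trans F (steps_frame st1)) inv1.
exists ((expr_cost e).+1 + t + t2), s2; split=> //; last by lia.
exact: steps_while_loop st1 st2.
Qed.

(** The bound [e] is evaluated again at each iteration; the rules below therefore ask that its value
    be stable under the footprint of the loop. The comparison [r + 1 <= e] expresses [r < e]. *)
Definition For (r : nat) (e : expr) (c : cmd) : cmd :=
  Seq (SetReg r (Defs.Num 0))
      (While (Bin Leq (Bin Add (Reg r) (Defs.Num 1)) e)
             (Seq c (SetReg r (Bin Add (Reg r) (Defs.Num 1))))).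

Lemma frame_reg rs ars s s' r : frame rs ars s s' -> r \notin rs -> regs s' r = regs s r.
Proof. by case=> h _; apply: h. Qed.

Lemma frame_cell rs ars s s' a i :
  frame rs ars s s' -> a \notin ars -> cells s' a i = cells s a i.
Proof. by case=> _ h; apply: h. Qed.

(** Covers the test and the increment of one iteration; charged once more, it covers the
    initialization and the last test. *)
Definition for_cost (e : expr) := expr_cost e + 12.

(* Invariants only have to mention what the body writes: the rest follows from
   [frame]. *)
Lemma spec_for_pot X (r : nat) e c s0 N (T : nat -> nat) (pot : state -> nat)
    (Inv : nat -> state -> Prop) :
  r \notin wregs c -> N <= X ->
  (forall s, cframe (For r e c) s0 s -> den s e = N) ->
  (forall i s, i < N -> cframe (For r e c) s0 s -> regs s r = i -> Inv i s ->
     exists Ti, spec X c s Ti (fun s' => Inv i.+1 (set_reg s' r i.+1) /\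
       Ti + pot (set_reg s' r i.+1) <= T i + pot s)) ->
  Inv 0 (set_reg s0 r 0) ->
  spec X (For r e c) s0
    (\sum_(i < N) (T i + for_cost e) + for_cost e + pot (set_reg s0 r 0))
    (fun s' => Inv N s').
Proof.
move=> rc NX eN step inv0.
have Fsub s1 : cframe (Seq c (SetReg r (Bin Add (Reg r) (Defs.Num 1)))) (set_reg s0 r 0) s1 ->
    cframe (For r e c) s0 s1.
  move=> F; apply: (@frame_trans _ _ _ (set_reg s0 r 0)).
    by apply: frame_set_reg; rewrite inE eqxx.
  by apply: frame_subset F => x //=; rewrite in_cons => ->; rewrite orbT.
rewrite /For; apply: spec_le.
  have init : spec X (SetReg r (Defs.Num 0)) s0 2 (fun s1 => s1 = set_reg s0 r 0).
    exact: (spec_wpl (c := SetReg r (Defs.Num 0))).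
  apply: spec_seq init _ => s1 _ ->.
  apply: (spec_while (Inv := fun s => regs s r <= N /\ Inv (regs s r) s)
     (Phi := fun s => \sum_(regs s r <= i < N) (T i + for_cost e) + pot s)).
  - move=> s F [le inv] /=.
    have eqN := eN _ (Fsub _ F).
    rewrite eqN addn1; case: (ltnP (regs s r) N) => // lt _.
    have [Ti h] := step _ _ lt (Fsub _ F) erefl inv.
    exists (Ti + 5); apply: spec_le.
      apply: spec_seq h _ => s1' F1 [inv1 pot1].
      have r1 : regs s1' r = regs s r by apply: frame_reg F1 rc.
      apply: spec_wpl => /=; rewrite r1 addn1; split; first by apply: leq_trans NX.
      rewrite eqxx; split=> //.
      by rewrite [X in _ <= X + _]big_ltn //= /for_cost; lia.
    by rewrite /=; lia.
  - move=> s F [le inv] /=.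
    rewrite (eN _ (Fsub _ F)) addn1; case: (ltnP (regs s r) N) => // ge _.
    have E : regs s r = N by apply/eqP; rewrite eqn_leq le ge.
    by move: inv; rewrite E.
  by rewrite /= eqxx.
rewrite /= eqxx big_mkord /for_cost; move: (bigop _ _ _) => S; lia.
Qed.

Lemma spec_for X (r : nat) e c s0 N (T : nat -> nat) (Inv : nat -> state -> Prop) :
  r \notin wregs c -> N <= X ->
  (forall s, cframe (For r e c) s0 s -> den s e = N) ->
  (forall i s, i < N -> cframe (For r e c) s0 s -> regs s r = i -> Inv i s ->
     spec X c s (T i) (fun s' => Inv i.+1 (set_reg s' r i.+1))) ->
  Inv 0 (set_reg s0 r 0) ->
  spec X (For r e c) s0 (\sum_(i < N) (T i + for_cost e) + for_cost e)
    (fun s' => Inv N s').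
Proof.
move=> rc NX eN step inv0.
have := @spec_for_pot X r e c s0 N T (fun=> 0) Inv rc NX eN _ inv0; rewrite addn0; apply.
move=> i s iN F ri inv; exists (T i).
by apply: spec_imp (step i s iN F ri inv) (leqnn _) _ => s' _ h.
Qed.

Lemma spec_for_const X (r : nat) e c s0 N T (Inv : nat -> state -> Prop) :
  r \notin wregs c -> N <= X ->
  (forall s, cframe (For r e c) s0 s -> den s e = N) ->
  (forall i s, i < N -> cframe (For r e c) s0 s -> regs s r = i -> Inv i s ->
     spec X c s T (fun s' => Inv i.+1 (set_reg s' r i.+1))) ->
  Inv 0 (set_reg s0 r 0) ->
  spec X (For r e c) s0 (N * (T + for_cost e) + for_cost e) (fun s' => Inv N s').
Proof.
move=> rc NX eN step inv0.
apply: spec_le (spec_for rc NX eN (T := fun=> T) step inv0) _.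
by rewrite sum_nat_const card_ord.
Qed.

(** * Registers, arrays and loops over neighbors *)

Notation rOK := 0 (only parsing).
Notation rN := 1 (only parsing).
Notation rA := 2 (only parsing).
Notation rJ := 3 (only parsing).
Notation rB := 4 (only parsing).
Notation rL := 5 (only parsing).
Notation rI := 6 (only parsing).
Notation rU := 7 (only parsing).
Notation rV := 8 (only parsing).
Notation rX := 10 (only parsing).
Notation rW := 11 (only parsing).
Notation rY := 12 (only parsing).
Notation rK := 13 (only parsing).
Notation rZ := 14 (only parsing).
Notation rF := 15 (only parsing).
Notation rS := 16 (only parsing).
Notation rT := 17 (only parsing).
Notation aDEG := 7 (only parsing).
Notation aNB := 8 (only parsing).
Notation aCL := 9 (only parsing).
Notation aCAND := 10 (only parsing).
Notation aD := 11 (only parsing).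
Notation aKEY := 12 (only parsing).
Notation aP := 13 (only parsing).
Notation aBAD := 14 (only parsing).
Notation aCNT := 15 (only parsing).
Notation aSTK := 16 (only parsing).

Notation "c1 ;;; c2" := (Seq c1 c2) (at level 65, right associativity).
Notation "$ k" := (Defs.Num k) (at level 1, format "$ k").
Notation "# r" := (Reg r) (at level 1, format "# r").
Notation "e1 +' e2" := (Bin Defs.Add e1 e2) (at level 50, left associativity).
Notation "e1 -' e2" := (Bin Defs.Sub e1 e2) (at level 50, left associativity).
Notation "e1 *' e2" := (Bin Defs.Mul e1 e2) (at level 40, left associativity).
Notation "e1 <=' e2" := (Bin Defs.Leq e1 e2) (at level 60).
Notation "e1 ==' e2" := (Bin Defs.Eq e1 e2) (at level 60).
Notation "r <<- e" := (SetReg r e) (at level 62).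
Notation "a '@@' i <<- e" := (SetCell a i e) (at level 62, i at level 61).

(** Written without subtraction, so that the effect of changing one counter on a total is linear
    arithmetic. *)
Lemma sum_upd N (g h : nat -> nat) u : u < N ->
  (forall v, v < N -> v != u -> g v = h v) ->
  \sum_(v < N) g v + h u = \sum_(v < N) h v + g u.
Proof.
move=> uN E; rewrite (bigD1 (Ordinal uN)) //= [in RHS](bigD1 (Ordinal uN)) //=.
rewrite (eq_bigr (fun v : 'I_N => h v)); first by lia.
by move=> v vu; apply: E => //; apply: contra vu => /eqP vu; apply/eqP/val_inj.
Qed.

Lemma sum_ge N (g : nat -> nat) u : u < N -> g u <= \sum_(v < N) g v.
Proof. by move=> uN; rewrite (bigD1 (Ordinal uN)) //= leq_addr. Qed.

Lemma pair_index_inj M u j v k :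
  j < M -> k < M -> (u * M + j == v * M + k) = (u == v) && (j == k).
Proof.
move=> jM kM; apply/idP/andP=> [/eqP E|[/eqP-> /eqP->]//].
have M0 : 0 < M by apply: leq_ltn_trans jM.
have := congr1 (divn^~ M) E; rewrite !divnMDl // !divn_small // !addn0 => uv.
by move: E; rewrite uv => /addnI->; rewrite !eqxx.
Qed.

Definition closed_nb (nb : nat -> seq nat) (x y : nat) := (x == y) || (y \in nb x).

(** Adjacency lists of stride [n] for loops over neighbors, and a matrix for constant-time tests.
    The matrix includes the diagonal, so that membership in [cap2] is a product of two cells. *)
Definition graph_mem (n : nat) (nb : nat -> seq nat) (s : state) : Prop :=
  regs s rN = n /\ forall x, x < n ->
  [/\ cells s aDEG x = size (nb x),
      forall j, j < size (nb x) -> cells s aNB (x * n + j) = nth 0 (nb x) j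
    & forall y, y < n -> cells s aCL (x * n + y) = closed_nb nb x y].

Lemma graph_mem_frame n nb (rs ars : seq nat) s s' :
  graph_mem n nb s -> frame rs ars s s' ->
  [&& rN \notin rs, aDEG \notin ars, aNB \notin ars & aCL \notin ars] ->
  graph_mem n nb s'.
Proof.
move=> [rn h] F /and4P[h1 h2 h3 h4]; split; first by rewrite (frame_reg F).
move=> x /h[e1 e2 e3]; split=> [|j /e2|y /e3]; by rewrite (frame_cell _ F).
Qed.

Definition ForNb (rx rj rz : nat) (c : cmd) : cmd :=
  For rj (Cell aDEG #rx) (rz <<- Cell aNB (#rx *' #rN +' #rj) ;;; c).

(** Fetching the neighbor costs 7 and the loop 14 per iteration. *)
Definition nb_cost (T : nat) := T + 21.

Lemma wregs_For r e c : wregs (For r e c) = r :: (wregs c ++ [:: r]).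
Proof. by []. Qed.

Lemma wregs_SetSeq r e c : wregs (Seq (SetReg r e) c) = r :: wregs c.
Proof. by []. Qed.

Lemma spec_nb X n nb x rx rj rz c s0 T (Inv : nat -> state -> Prop) :
  graph_mem n nb s0 -> x < n -> regs s0 rx = x -> size (nb x) <= X ->
  (forall z, z \in nb x -> z <= X) ->
  rj \notin rz :: wregs c ->
  [&& rx != rj, rx != rz, rx \notin wregs c, rN != rj, rN != rz, rN \notin wregs c,
     aDEG \notin warrs c & aNB \notin warrs c] ->
  (forall i s, i < size (nb x) -> cframe (ForNb rx rj rz c) s0 s -> regs s rj = i ->
     Inv i s ->
     spec X c (set_reg s rz (nth 0 (nb x) i)) T
       (fun s' => Inv i.+1 (set_reg s' rj i.+1))) ->
  Inv 0 (set_reg s0 rj 0) ->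
  spec X (ForNb rx rj rz c) s0 (size (nb x) * nb_cost T + 14)
    (fun s' => Inv (size (nb x)) s').
Proof.
move=> [rn gm] xn rxx sX nbX nj /and5P[n1 n2 n3 n4 /and4P[n5 n6 n7 n8]] step inv0.
have [gd gn _] := gm x xn.
have rj_c : rj \notin wregs c by move: nj; rewrite inE negb_or => /andP[].
have nf r : r != rj -> r != rz -> r \notin wregs c -> r \notin wregs (ForNb rx rj rz c).
  move=> h1 h2 h3; apply/negP; rewrite wregs_For in_cons mem_cat wregs_SetSeq in_cons.
  by rewrite (negbTE h1) (negbTE h2) (negbTE h3) mem_seq1 (negbTE h1).
apply: spec_le.
  apply: (spec_for_const (N := size (nb x)) (Inv := Inv) (T := T + 7)) => //.
  - move=> s F /=; rewrite (frame_cell _ F) /= ?cats0 //.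
    by rewrite (frame_reg F) ?rxx ?nf.
  - move=> i s ilt F ri inv.
    have eN : regs s rN = n by rewrite (frame_reg F) // nf.
    have ex : regs s rx = x by rewrite (frame_reg F) // nf.
    have ez : cells s aNB (x * n + i) = nth 0 (nb x) i.
      by rewrite (frame_cell _ F) //= ?cats0 ?gn.
    apply: spec_le.
      apply: spec_seq (spec_wpl (Q := fun s1 => s1 = set_reg s rz (nth 0 (nb x) i)) _) _.
        by rewrite /= ex eN ri ez; split=> //; apply/nbX/mem_nth.
      by move=> s1 _ ->; apply: step.
    by rewrite /=; lia.
by rewrite /for_cost /nb_cost /=; lia.
Qed.

Lemma spec_fill X r e a v s0 N (g : nat -> nat) : N <= X ->
  (forall s, frame [:: r] [:: a] s0 s -> den s e = N) ->
  (forall s i, frame [:: r] [:: a] s0 s -> i < N -> regs s r = i ->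
     den s v = g i /\ g i <= X) ->
  spec X (For r e (a @@ #r <<- v)) s0
    (N * (expr_cost v + 2 + for_cost e) + for_cost e)
    (fun s => forall x, x < N -> cells s a x = g x).
Proof.
move=> NX eN ev.
have Fs s : cframe (For r e (a @@ #r <<- v)) s0 s -> frame [:: r] [:: a] s0 s.
  by move=> F; apply: frame_sub F _; rewrite /= !mem_seq1 !eqxx.
apply: (spec_for_const (Inv := fun i s => forall x, x < i -> cells s a x = g x)) => //.
  by move=> s /Fs; apply: eN.
move=> i s iN F ri inv; have [E gX] := ev s i (Fs _ F) iN ri.
apply: spec_le; first apply: spec_wpl => /=.
  rewrite E ri; split=> // x; rewrite ltnS leq_eqVlt eqxx /=.
  by case: eqVneq => [->//|_ /= /inv].
by rewrite /=; lia.
Qed.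

(** * Bucket search *)

(* A queued key is at most [2 * n + 2] plus the number of visited vertices. *)
Definition bucket_count : expr := $3 *' #rN +' $3.
Definition stack_index (u : expr) : expr := u *' (#rN *' #rN +' $1) +' Cell aCNT u.

Definition search_push (E F : expr) : cmd :=
  If E Skip
    (rF <<- F ;;;
     aSTK @@ stack_index #rF <<- #rZ ;;;
     aCNT @@ #rF <<- Cell aCNT #rF +' $1).

(** A vertex may be queued many times; entries of visited vertices are dropped when popped, so that
    no key is ever decreased in a queue. *)
Definition search_step (E F : expr) : cmd :=
  If (Cell aCNT #rW)
    (aCNT @@ #rW <<- Cell aCNT #rW -' $1 ;;;
     rY <<- Cell aSTK (stack_index #rW) ;;;
     If (Cell aKEY #rY) Skip
       (aKEY @@ #rY <<- #rW +' $1 ;;; ForNb rY rK rZ (search_push E F)))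
    (rW <<- #rW +' $1).

(* A Dijkstra-style search from the vertex in [rS]: [E] tells which edges are
   ignored, [F] computes the key of [rZ] from the key [rW] of [rY].  Keys are
   stored plus one, 0 meaning that the vertex is not visited. *)
Definition search (E F : expr) : cmd :=
  For rX #rN (aKEY @@ #rX <<- $0) ;;;
  For rX bucket_count (aCNT @@ #rX <<- $0) ;;;
  aSTK @@ $0 <<- #rS ;;;
  aCNT @@ $0 <<- $1 ;;;
  rW <<- $0 ;;;
  While (#rW +' $1 <=' bucket_count) (search_step E F).

Definition search_rs : seq nat := [:: rX; rW; rY; rK; rZ; rF].
Definition search_as : seq nat := [:: aKEY; aCNT; aSTK].

(** The keys realized by walks from the source along allowed edges: lengths for breadth-first
    search, and for the bottleneck search the largest value of [2 * n + 2] minus an edge weight. *)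
Inductive reach (nb : nat -> seq nat) (ok : rel nat) (f : nat -> nat -> nat -> nat)
    (src : nat) : nat -> nat -> Prop :=
  | reach_src : reach nb ok f src 0 src
  | reach_step k y z : reach nb ok f src k y -> z \in nb y -> ok y z ->
      reach nb ok f src (f k y z) z.

Section Search.
Variables (n : nat) (nb : nat -> seq nat) (X src dl : nat).
Variables (f : nat -> nat -> nat -> nat) (ok : rel nat) (E F : expr) (s0 : state).
Hypotheses (srcn : src < n) (XH : 4 * (n + 2) * (n + 2) <= X).
Hypothesis nbn : forall x z, x < n -> z \in nb x -> z < n.
Hypotheses (nbs : forall x, x < n -> size (nb x) <= n).
Hypotheses (nbd : forall x, x < n -> size (nb x) <= dl).
(** Keys do not decrease along a walk, so the buckets can be emptied in increasing order. The upper
    bound accommodates both [w + 1] for distances and complemented weights up to [2 * n + 2]. *)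
Hypothesis f_ge : forall w y z, w <= f w y z.
Hypothesis f_le : forall w y z, f w y z <= maxn w.+1 (2 * n + 2).
Hypothesis hE : forall s, frame search_rs search_as s0 s ->
  regs s rY < n -> regs s rZ < n -> (den s E != 0) = ~~ ok (regs s rY) (regs s rZ).
Hypothesis hF : forall s, frame search_rs search_as s0 s ->
  regs s rY < n -> regs s rZ < n -> den s F = f (regs s rW) (regs s rY) (regs s rZ).
Hypotheses (gm : graph_mem n nb s0) (hS : regs s0 rS = src).

Local Notation reach := (reach nb ok f src).
Local Notation wmax := (3 * n + 3).
Local Notation M := (n * n + 1).

Definition pend (s : nat -> nat -> nat) (u z : nat) : Prop :=
  exists2 j, j < s aCNT u & s aSTK (u * M + j) = z.

(** The obligation that a scanned edge leaves behind. Popping preserves it, since the popped vertex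
    is then visited with a key that is small enough. *)
Definition queued (s : nat -> nat -> nat) (u z : nat) : Prop :=
  0 < s aKEY z <= u.+1 \/ pend s u z.

Definition visited (s : nat -> nat -> nat) : nat := \sum_(x < n) (s aKEY x != 0).
Definition pending (s : nat -> nat -> nat) : nat := \sum_(u < wmax) s aCNT u.

(* [act] selects the edges already scanned, [slack] counts the pushes still to
   come: every bucket holds at most [n * n + 1] entries. *)
Record search_inv (s : nat -> nat -> nat) (w slack : nat) (act : rel nat) : Prop := SearchInv {
  si_pend : forall u z, u < wmax -> pend s u z ->
    [/\ z < n, reach u z, w <= u & u <= 2 * n + 2 + visited s];
  si_key : forall x, x < n -> 0 < s aKEY x ->
    [/\ s aKEY x <= w.+1, s aKEY x <= 2 * n + 2 + visited s
      & reach (s aKEY x).-1 x];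
  si_src : queued s 0 src;
  si_clo : forall y z, y < n -> 0 < s aKEY y -> z \in nb y -> ok y z ->
    act y z -> queued s (f (s aKEY y).-1 y z) z;
  si_bud : pending s + n * (n - visited s) + slack <= 1 + n * n;
  si_w : w <= wmax }.

Lemma visited_le s : visited s <= n.
Proof.
rewrite -[X in _ <= X]card_ord -sum1_card; apply: leq_sum => x _.
by case: (_ != _).
Qed.

(** An ignored edge creates no obligation, and an allowed one is met by the new entry. The budget
    with one push to spare keeps all counters below the stride [M], so the entry overwrites nothing
    in use in another bucket. *)
Lemma push_inv s w slack act y i : i < size (nb y) -> y < n ->
  search_inv s w slack.+1 act -> s aKEY y = w.+1 ->
  act =2 (fun y' z => (y' == y) ==> (z \in take i (nb y))) ->
  let z := nth 0 (nb y) i in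
  let u := f w y z in
  let act' := fun y' z => (y' == y) ==> (z \in take i.+1 (nb y)) in
  (~~ ok y z -> search_inv s w slack act') /\
  (ok y z -> forall s' : nat -> nat -> nat,
    s' aKEY =1 s aKEY ->
    (forall v, s' aCNT v = if v == u then (s aCNT u).+1 else s aCNT v) ->
    (forall k, s' aSTK k = if k == u * M + s aCNT u then z else s aSTK k) ->
    search_inv s' w slack act' /\ pending s' = (pending s).+1).
Proof.
move=> iy yn [ip ik isrc ic ib iw] ky actE z u act'.
have y0 : 0 < s aKEY y by rewrite ky.
have [_ wv ry] := ik y yn y0; rewrite ky /= in wv ry.
have zn : z < n by apply: nbn yn _; apply: mem_nth.
have act'E y' t : act' y' t -> act y' t \/ (y' = y /\ t = z).
  rewrite actE /act'; case: eqP => /= [-> |_]; last by left.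
  rewrite (take_nth 0 iy) mem_rcons inE => /orP[/eqP->|->]; [by right|by left].
split=> [nok|okz s' eK eC eS].
  split=> //; last by lia.
  move=> y' t y'n ky' tn okt /act'E[|[yE tE]]; first exact: ic.
  by move: okt; rewrite yE tE (negbTE nok).
have uw : w <= u by apply: f_ge.
have vn := visited_le s.
have ub : u < wmax by have := f_le w y z; rewrite -/u; lia.
have vis' : visited s' = visited s by apply: eq_bigr => x _; rewrite eK.
have cM v : v < wmax -> s aCNT v < M.
  by move=> vw; have := @sum_ge wmax (s aCNT) v vw; rewrite -/(pending s); lia.
have pnd : pending s' = (pending s).+1.
  have H v : v < wmax -> v != u -> s' aCNT v = s aCNT v.
    by move=> _ vu; rewrite eC (negbTE vu).
  have := sum_upd ub H; rewrite -/(pending s) -/(pending s') eC eqxx; lia.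
have pend_old v t : v < wmax -> pend s v t -> pend s' v t.
  move=> vw [j jc <-]; exists j; first by rewrite eC; case: eqP jc => // -> /leqW.
  rewrite eS pair_index_inj ?(ltn_trans jc) ?cM //.
  by case: eqP => //= vu; case: eqP => // jE; rewrite vu -jE ltnn in jc.
have q_old v t : v < wmax -> queued s v t -> queued s' v t.
  by move=> vw [h|h]; [left; rewrite eK|right; apply: pend_old].
have q_new : queued s' u z.
  by right; exists (s aCNT u); rewrite ?eC ?eS !eqxx.
split=> //; split.
- move=> v t vw [j]; rewrite eC eS vis'; case: (eqVneq v u) => [->|vu] jc.
    rewrite pair_index_inj ?cM //; last first.
      by apply: leq_trans jc _; apply: cM.
    rewrite eqxx /=; case: eqP => [_ <-|/eqP jne tE].
      split=> //; last by have := f_le w y z; rewrite -/u; lia.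
      by apply: reach_step ry (mem_nth 0 iy) okz.
    by apply: (ip u t ub); exists j => //; lia.
  rewrite pair_index_inj ?cM ?(ltn_trans jc) ?cM // (negbTE vu) /= => tE.
  by apply: (ip v t vw); exists j.
- by move=> x xn; rewrite eK vis'; apply: ik.
- by apply: q_old => //; lia.
- move=> y' t y'n; rewrite eK => ky' tn okt /act'E[at_|[-> ->]].
    apply: q_old; last exact: ic.
    have [kw _ _] := ik _ y'n ky'.
    have := f_le (s aKEY y').-1 y' t; lia.
  by rewrite ky.
- by rewrite pnd vis'; lia.
- exact: iw.
Qed.

Lemma search_frame_graph s : frame search_rs search_as s0 s -> graph_mem n nb s.
Proof. by move=> F'; apply: graph_mem_frame gm F' _. Qed.

Let push_cost := ccost (search_push E F).
Let visit_cost := dl * (nb_cost push_cost + 100) + 100.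

(** Advancing to the next bucket and popping an entry are worth 100 each. [visit_cost] pays for
    scanning the neighbors and endows each of the at most [dl] entries pushed with its 100. *)
Definition potential (s : nat -> nat -> nat) (w : nat) : nat :=
  100 * (wmax - w) + 100 * pending s + visit_cost * (n - visited s).

Lemma visit_ok s y w : frame search_rs search_as s0 s -> regs s rY = y -> y < n ->
  regs s rW = w ->
  search_inv (cells s) w (size (nb y)) (fun y' z => y' != y) -> cells s aKEY y = w.+1 ->
  spec X (ForNb rY rK rZ (search_push E F)) s (dl * nb_cost push_cost + 14)
   (fun s' => [/\ search_inv (cells s') w 0 (fun _ _ => true),
      visited (cells s') = visited (cells s)
      & pending (cells s') <= pending (cells s) + dl]).
Proof.
move=> Fs ry yn rw inv ky.
have sX : size (nb y) <= X by have := nbs yn; nia.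
pose Inv i (s' : state) := [/\
   search_inv (cells s') w (size (nb y) - i) (fun y' z => (y' == y) ==> (z \in take i (nb y))),
   cells s' aKEY =1 cells s aKEY & pending (cells s') <= pending (cells s) + i].
apply: spec_imp.
- apply: (spec_nb (Inv := Inv) (T := push_cost) (search_frame_graph Fs) yn ry) => //.
  + by move=> z /(nbn yn) zn; nia.
  + move=> i s1 iy F1 ri [inv1 eK pd].
    pose z := nth 0 (nb y) i.
    have zn : z < n by apply: nbn yn _; apply: mem_nth.
    have Fz : frame search_rs search_as s0 (set_reg s1 rZ z).
      apply: frame_trans Fs _; apply: (@frame_trans _ _ _ s1); last exact: frame_set_reg.
      exact: frame_sub F1 _.
    have ey : regs s1 rY = y by rewrite (frame_reg F1).
    have ew : regs s1 rW = w by rewrite (frame_reg F1).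
    have en : regs s1 rN = n.
      by have [<- _] := search_frame_graph Fz.
    have ky1 : cells s1 aKEY y = w.+1 by rewrite eK.
    have slE : size (nb y) - i = (size (nb y) - i.+1).+1 by rewrite subnSK.
    rewrite slE in inv1.
    have [nok isok] := push_inv iy yn inv1 ky1 (fun _ _ => erefl).
    have uE := hF Fz; rewrite /= ey ew in uE; have {}uE := uE yn zn.
    have ub : f w y z <= X /\ (cells s1 aCNT (f w y z)).+1 <= X.
      have [_ ik _ _ ib iw] := inv1.
      have y0 : 0 < cells s1 aKEY y by rewrite ky1.
      have [_ wv _] := ik y yn y0; rewrite ky1 in wv.
      have vn := visited_le (cells s1); have fl := f_le w y z.
      have uw : f w y z < wmax by lia.
      have := sum_ge (cells s1 aCNT) uw; rewrite -/(pending (cells s1)); nia.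
    apply: spec_wpl; rewrite /search_push /wpl (hE Fz) /= ?ey // -/z uE en.
    case okz : (ok y z) => /=.
      split; first by case: ub.
      split; first by nia.
      split; first by rewrite addn1; case: ub.
      have [|||inv' pd'] := isok okz (cells
         (set_cell (set_cell s1 aSTK (f w y z * M + cells s1 aCNT (f w y z)) z)
            aCNT (f w y z) (cells s1 aCNT (f w y z) + 1))).
      * by [].
      * by move=> v; rewrite /= addn1.
      * by [].
      split=> //.
      have pd2 : (pending (cells s1)).+1 <= pending (cells s) + i.+1 by lia.
      by rewrite -pd' in pd2.
    split=> //; first by apply: nok; rewrite okz.
    by rewrite /=; lia.
  + split=> //; last by rewrite /= addn0.
    rewrite subn0 take0; case: inv => ip ik isrc ic ib iw; split=> // y' z y'n ky' zy okz; rewrite ?in_nil ?implybF => h; apply: ic.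
- by rewrite leq_add2r leq_mul2r nbd ?orbT.
move=> s' F' [inv' eK pd']; split.
- case: inv' => ip ik isrc ic ib iw; split=> //; last by move: ib; rewrite subnn.
  by move=> y' z y'n ky' zy okz _; apply: ic => //; case: eqP => //= E'; rewrite take_size -E'.
- by apply: eq_bigr => x _; rewrite eK.
- by apply: leq_trans pd' _; rewrite leq_add2l nbd.
Qed.

(** The lost entry is replaced by visitedness of [y], whose key is at most [w + 1]. On a first visit
    the budget term [n * (n - visited)] drops by [n], which pays for the pushes to come as slack. *)
Lemma pop_inv (c c' : nat -> nat -> nat) w j :
  w < wmax -> search_inv c w 0 (fun _ _ => true) -> c aCNT w = j.+1 ->
  let y := c aSTK (w * M + j) in
  (forall v, c' aCNT v = if v == w then j else c aCNT v) ->
  c' aSTK =1 c aSTK ->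
  [/\ y < n, pending c = (pending c').+1,
      0 < c aKEY y -> c' aKEY =1 c aKEY ->
      search_inv c' w 0 (fun _ _ => true) /\ visited c' = visited c
    & c aKEY y = 0 -> (forall x, c' aKEY x = if x == y then w.+1 else c aKEY x) ->
      search_inv c' w (size (nb y)) (fun y' _ => y' != y) /\
      visited c' = (visited c).+1].
Proof.
move=> wlt [ip ik isrc ic ib iw] cw y eC eS.
have [yn ry _ wv] : [/\ y < n, reach w y, w <= w & w <= 2 * n + 2 + visited c].
  by apply: ip => //; exists j; rewrite ?cw.
have pE : pending c = (pending c').+1.
  have H v : v < wmax -> v != w -> c' aCNT v = c aCNT v.
    by move=> _ vu; rewrite eC (negbTE vu).
  have := sum_upd wlt H; rewrite -/(pending c) -/(pending c') eC eqxx cw; lia.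
have pend' u z : pend c' u z -> pend c u z.
  move=> [k]; rewrite eC eS => kc <-; exists k => //.
  by case: eqP kc => // ->; rewrite cw => /leqW.
have pend_old u z : pend c u z -> pend c' u z \/ (u = w /\ z = y).
  move=> [k kc <-]; have [uw|uw] := eqVneq u w; last first.
    by left; exists k; rewrite ?eC ?eS // (negbTE uw).
  subst u; have [kj|kj] := eqVneq k j; first by right; rewrite kj.
  left; exists k; rewrite ?eS // eC eqxx; move: kc; rewrite cw ltnS leq_eqVlt.
  by rewrite (negbTE kj).
split=> // [y0 eK|y0 eK].
  have vE : visited c' = visited c by apply: eq_bigr => x _; rewrite eK.
  have [kw _ _] := ik y yn y0.
  have q_old u z : w <= u \/ u < w -> queued c u z -> queued c' u z.
    move=> _ [h|/pend_old[h|[-> ->]]]; [by left; rewrite eK|by right|].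
    by left; rewrite eK y0.
  split=> //; split=> //.
  - by move=> u z uw /pend' /(ip u z uw); rewrite vE.
  - by move=> x xn; rewrite eK vE; apply: ik.
  - by apply: q_old => //; lia.
  - move=> y' z y'n; rewrite eK => ky' zy okz _; apply: q_old; [lia|exact: ic].
  - by rewrite vE; lia.
have vE : visited c' = (visited c).+1.
  have H v : v < n -> v != y -> nat_of_bool (c' aKEY v != 0) = (c aKEY v != 0).
    by move=> _ vy; rewrite eK (negbTE vy).
  have := sum_upd (g := fun v => c' aKEY v != 0) (h := fun v => c aKEY v != 0) yn H.
  by rewrite -/(visited c) -/(visited c') eK eqxx y0 addn0 addn1.
have q_old u z : queued c u z -> queued c' u z.
  move=> [h|/pend_old[h|[-> ->]]]; [|by right|by left; rewrite eK eqxx /=].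
  by left; rewrite eK; case: eqP h => // ->; rewrite y0.
split=> //; split=> //.
- move=> u z uw /pend' /(ip u z uw)[? ? ? ?]; split=> //; rewrite vE; lia.
- move=> x xn; rewrite eK vE; case: eqP => [->|_] => [_|kx]; first by split=> //; lia.
  by have [? ? ?] := ik x xn kx; split=> //; lia.
- exact: q_old.
- move=> y' z y'n; rewrite eK; case: eqP => // _ ky' zy okz _; apply: q_old; exact: ic.
have := visited_le c'; have := nbs yn; rewrite vE => sy vn.
have : n - visited c = (n - (visited c).+1).+1 by lia.
move=> E1; move: ib; rewrite E1 mulnS pE; lia.
Qed.

Lemma step_ok s w : frame search_rs search_as s0 s -> regs s rW = w -> w < wmax ->
  search_inv (cells s) w 0 (fun _ _ => true) ->
  exists T, spec X (search_step E F) s T (fun s' =>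
    search_inv (cells s') (regs s' rW) 0 (fun _ _ => true) /\
    10 + T + potential (cells s') (regs s' rW) <= potential (cells s) w).
Proof.
move=> Fs ew wlt inv; have [ip ik isrc ic ib iw] := inv.
have en : regs s rN = n by have [] := search_frame_graph Fs.
have [cw|cw] := posnP (cells s aCNT w).
  exists (3 + 4); apply: (@spec_if _ (Cell aCNT #rW)) => /=; rewrite ew cw //= => _.
    apply: spec_wpl => /=; rewrite ew addn1; split; first by nia.
    split; last by rewrite /potential /=; nia.
    split=> // [u z uw pd|x xn kx].
      have [zn rz wu uv] := ip u z uw pd; split=> //.
      rewrite ltn_neqAle wu andbT; apply/eqP => E1; case: pd => j.
      by rewrite /= -E1 cw.
    by have [kw kv rk] := ik x xn kx; split=> //; apply: leqW.
have wX : w.+1 <= X by nia.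
pose j := (cells s aCNT w).-1; pose y := cells s aSTK (w * M + j).
have jE : cells s aCNT w = j.+1 by rewrite prednK.
have jX : j <= X.
  by have := sum_ge (cells s aCNT) wlt; rewrite -/(pending (cells s)) jE; nia.
pose s1 := set_cell s aCNT w j; pose s2 := set_reg s1 rY y.
have [||yn pE old new] := @pop_inv (cells s) (cells s1) w j wlt inv jE.
- by move=> v.
- by [].
have F2 : frame search_rs search_as s0 s2.
  apply: frame_trans Fs _; apply: (@frame_trans _ _ _ s1).
    exact: frame_set_cell.
  exact: frame_set_reg.
have prefix T Q : spec X (If (Cell aKEY #rY) Skip
       (aKEY @@ #rY <<- #rW +' $1 ;;; ForNb rY rK rZ (search_push E F))) s2 T Q ->
    spec X (search_step E F) s (T + 30) Q.
  move=> h; apply: spec_le.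
    apply: spec_if => /= c0; last by rewrite ew in c0; rewrite c0 in cw.
    apply: spec_seq.
      by apply: spec_wpl => /=; rewrite ew jE subn1 /=; split; [exact: jX|exact: (erefl s1)].
    move=> _ _ <-; apply: spec_seq.
      apply: spec_wpl => /=; rewrite ew eqxx /= en; split; first by rewrite -/y; nia.
      exact: (erefl s2).
    by move=> _ _ <-; exact: h.
  by rewrite /=; lia.
have [ky|ky] := posnP (cells s aKEY y).
  pose s3 := set_cell s2 aKEY y w.+1.
  have [||_ _ _ new3] := @pop_inv (cells s) (cells s3) w j wlt inv jE.
  - by move=> v.
  - by [].
  have [inv3 vE3] := new3 ky (fun=> erefl).
  have F3 : frame search_rs search_as s0 s3.
    by apply: frame_trans F2 _; apply: frame_set_cell.
  exists (3 + (5 + (dl * nb_cost push_cost + 14)) + 30).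
  apply: prefix; apply: spec_if => /=; rewrite -/y ky // => _.
  apply: spec_seq.
    by apply: spec_wpl => /=; rewrite ew addn1; split; [exact: wX|exact: (erefl s3)].
  move=> _ _ <-.
  apply: spec_imp (visit_ok F3 _ yn ew inv3 _) (leqnn _) _ => //=; first by rewrite eqxx.
  move=> s4 F4 [inv4 vE4 p4].
  have ew4 : regs s4 rW = w by rewrite (frame_reg F4) // ew.
  rewrite ew4; split=> //.
  have pE3 : pending (cells s3) = pending (cells s1) by [].
  have vn := visited_le (cells s4).
  rewrite /potential vE4 vE3 in vn *; move: p4; rewrite pE3 pE => p4.
  have -> : n - visited (cells s) = (n - (visited (cells s)).+1).+1 by lia.
  have p5 : 100 * pending (cells s4) <= 100 * pending (cells s1) + 100 * dl by lia.
  rewrite (mulnS visit_cost) /visit_cost mulnDr.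
  move: (dl * nb_cost push_cost) (_ * (n - _)) p5 => q1 q2; lia.
have [inv' vE] := old ky (fun=> erefl).
exists (3 + 1 + 30); apply: prefix; apply: spec_if => /=; last by rewrite -/y; lia.
move=> _; apply: spec_skip; rewrite /= ew; split; first exact: inv'.
have -> : potential (cells s2) w = potential (cells s1) w by [].
rewrite /potential vE pE; move: (visit_cost * _) (wmax - w) => q1 q2; lia.
Qed.

Lemma init_inv (c : nat -> nat -> nat) :
  (forall x, x < n -> c aKEY x = 0) ->
  (forall u, u < wmax -> c aCNT u = (u == 0)) -> c aSTK 0 = src ->
  [/\ search_inv c 0 0 (fun _ _ => true), pending c = 1 & visited c = 0].
Proof.
move=> k0 c0 s0E.
have pE : pending c = 1.
  have H v : v < wmax -> v != 0 -> c aCNT v = 0 by move=> vw /negbTE; rewrite c0 // => ->.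
  have w0 : 0 < wmax by lia.
  have := sum_upd (h := fun=> 0) w0 H.
  by rewrite -/(pending c) c0 // eqxx sum_nat_const muln0 addn0.
have vE : visited c = 0 by apply: big1 => x _; rewrite k0.
split=> //; split=> //.
- move=> u z uw [j]; rewrite c0 //; case: eqP => // -> /=.
  rewrite ltnS leqn0 => /eqP->; rewrite mul0n s0E => <-; split=> //; exact: reach_src.
- by move=> x xn; rewrite k0.
- by right; exists 0; rewrite ?c0 ?mul0n //; lia.
- by move=> y z yn; rewrite k0.
by rewrite pE vE; lia.
Qed.

(** Minimality without reference to the run: every key is realized by a walk, and no allowed edge
    could lower a key. *)
Definition search_post (c : nat -> nat -> nat) : Prop :=
  [/\ c aKEY src = 1,
      forall x, x < n -> 0 < c aKEY x -> reach (c aKEY x).-1 x,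
      forall x, x < n -> c aKEY x <= 3 * n + 2
    & forall y z, y < n -> 0 < c aKEY y -> z \in nb y -> ok y z ->
      0 < c aKEY z <= (f (c aKEY y).-1 y z).+1].

(** Pending entries sit in buckets from [w] on, so none is left at [wmax] and every obligation has
    become a visited vertex. *)
Lemma final_post c : search_inv c wmax 0 (fun _ _ => true) -> search_post c.
Proof.
move=> [ip ik isrc ic ib iw].
have q u z : u < wmax -> queued c u z -> 0 < c aKEY z <= u.+1.
  move=> uw [//|/(ip _ _ uw)[_ _]]; lia.
split.
- have : 0 < wmax by lia.
  by move=> /q /(_ isrc); lia.
- by move=> x xn kx; have [] := ik x xn kx.
- move=> x xn; have [->//|kx] := posnP (c aKEY x).
  by have [_ + _] := ik x xn kx; have := visited_le c; lia.
move=> y z yn ky zy okz; apply: q; last exact: ic.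
have [_ kv _] := ik y yn ky; have := f_le (c aKEY y).-1 y z; have := visited_le c; lia.
Qed.

Definition search_cost := push_cost + 2000.

Lemma search_ok :
  spec X (search E F) s0 (search_cost * (n.+1 * dl.+1)) (fun s => search_post (cells s)).
Proof.
have en : regs s0 rN = n by case: gm.
have nX : n <= X /\ wmax <= X by split; nia.
apply: spec_le.
  apply: spec_seq.
    apply: (spec_fill (N := n) (g := fun=> 0)); first by case: nX.
      by move=> s F1 /=; rewrite (frame_reg F1).
    by [].
  move=> s1 F1 k1; have Fs1 : frame search_rs search_as s0 s1 by apply: frame_sub F1 _.
  apply: spec_seq.
    apply: (spec_fill (N := wmax) (g := fun=> 0)); first by case: nX.
      by move=> s F2 /=; rewrite (frame_reg F2) // (frame_reg Fs1) // en.
    by [].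
  move=> s2 F2 k2; have Fs2 : frame search_rs search_as s0 s2.
    by apply: frame_trans Fs1 _; apply: frame_sub F2 _.
  pose s3 := set_cell s2 aSTK 0 src.
  pose s4 := set_reg (set_cell s3 aCNT 0 1) rW 0.
  have Fs4 : frame search_rs search_as s0 s4.
    apply: frame_trans Fs2 _; apply: (@frame_trans _ _ _ s3); first exact: frame_set_cell.
    apply: (@frame_trans _ _ _ (set_cell s3 aCNT 0 1)); first exact: frame_set_cell.
    exact: frame_set_reg.
  apply: spec_seq.
    apply: spec_wpl; rewrite /= (frame_reg Fs2) // hS; split; first by nia.
    exact: (erefl s3).
  move=> _ _ <-; apply: spec_seq.
    apply: spec_wpl; rewrite /=; split; first by nia.
    exact: (erefl (set_cell s3 aCNT 0 1)).
  move=> _ _ <-; apply: spec_seq.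
    apply: spec_wpl; rewrite /=; split; first by [].
    exact: (erefl s4).
  move=> _ _ <-.
  have [inv0 p0 v0] : [/\ search_inv (cells s4) 0 0 (fun _ _ => true), pending (cells s4) = 1
      & visited (cells s4) = 0].
    apply: init_inv => //=.
      by move=> x xn; rewrite (frame_cell _ F2) // k1.
    by move=> [//|u] uw /=; rewrite k2.
  apply: (@spec_le _ _ _ (potential (cells s4) (regs s4 rW) + 10)
    (100 * wmax + 100 + visit_cost * n + 10)); last first.
    by rewrite /potential p0 v0 /=; lia.
  apply: (spec_while (Inv := fun s => search_inv (cells s) (regs s rW) 0 (fun _ _ => true))
     (Phi := fun s => potential (cells s) (regs s rW))) => //.
  - move=> s F5 inv /= c5.
    have Fs : frame search_rs search_as s0 s by apply: frame_trans Fs4 _; apply: frame_sub F5 _.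
    apply: step_ok => //; move: c5; rewrite (frame_reg (r := rN) Fs) // en addn1.
    by case: ltnP.
  - move=> s F5 inv /= c5.
    have Fs : frame search_rs search_as s0 s by apply: frame_trans Fs4 _; apply: frame_sub F5 _.
    apply: final_post; have iw := si_w inv.
    suff -> : wmax = regs s rW by [].
    by move: c5; rewrite (frame_reg (r := rN) Fs) // en addn1; case: ltnP; lia.
rewrite /= /for_cost /= /visit_cost /search_cost /nb_cost.
move: push_cost => p; nia.
Qed.

End Search.

(** * From search keys to layers and cut sides *)

Section NatGraph.
Variables (n : nat) (G : sgraph 'I_n) (nbrs : 'I_n -> seq 'I_n).
Hypothesis adjl : adjacency_lists G nbrs.

Definition nat_nbrs (x : nat) : seq nat :=
  if insub x is Some o then map val (nbrs o) else [::].

Local Notation nb := nat_nbrs.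

Lemma nat_nbrsE (x : 'I_n) : nb x = map val (nbrs x).
Proof. by rewrite /nat_nbrs valK. Qed.

Lemma mem_nat_nbrs (x y : 'I_n) : (val y \in nb x) = G x y.
Proof.
by rewrite nat_nbrsE (mem_map val_inj); have [_ ->] := adjl x; rewrite inE.
Qed.

Lemma closed_nat_nbrs (x y : 'I_n) : closed_nb nb x y = cladj G x y.
Proof. by rewrite /closed_nb mem_nat_nbrs. Qed.

Lemma nat_nbrs_lt x z : x < n -> z \in nb x -> z < n.
Proof.
by move=> xn; rewrite -[x]/(val (Ordinal xn)) nat_nbrsE => /mapP[o _ ->]; apply: ltn_ord.
Qed.

Lemma size_nat_nbrs (x : 'I_n) : size (nb x) = degree G x.
Proof.
rewrite nat_nbrsE size_map /degree; have [un E] := adjl x.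
by rewrite -(card_uniqP un); apply: eq_card => y; move: (E y); rewrite !inE => ->.
Qed.

Lemma size_nat_nbrs_max x : x < n -> size (nb x) <= max_degree G.
Proof.
by move=> xn; rewrite -[x]/(val (Ordinal xn)) size_nat_nbrs /max_degree leq_bigmax.
Qed.

Lemma size_nat_nbrs_n x : x < n -> size (nb x) <= n.
Proof.
move=> xn; rewrite -[x]/(val (Ordinal xn)) size_nat_nbrs /degree.
by rewrite -[X in _ <= X]card_ord max_card.
Qed.

Variables a b : 'I_n.

Definition nat_cap (u v x : nat) : bool := closed_nb nb u x && closed_nb nb v x.

Lemma nat_capE (u v x : 'I_n) : nat_cap u v x = (x \in cap2 G u v).
Proof. by rewrite /nat_cap !closed_nat_nbrs inE. Qed.

Definition kept (y z : nat) : bool := ~~ (nat_cap a b y && nat_cap a b z).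

Local Notation A := (cap2 G a b).

Lemma keptE (y z : 'I_n) : (val z \in nb y) && kept y z = del G A y z.
Proof. by rewrite mem_nat_nbrs /kept !nat_capE. Qed.

Lemma reach_ind_ord f (src : 'I_n) (P : nat -> 'I_n -> Prop) :
  P 0 src ->
  (forall k (y z : 'I_n), reach nb kept f src k y -> P k y -> del G A y z -> P (f k y z) z) ->
  forall k (x : 'I_n), reach nb kept f src k x -> P k x.
Proof.
move=> P0 PS k x r.
suff H : forall k y, reach nb kept f src k y -> forall o : 'I_n, val o = y -> P k o.
  exact: H r _ erefl.
move=> {k x r} k y; elim=> {k y} [o /val_inj->//|k y z r IH zy okz o oz].
have yn : y < n.
  case: r {IH} => [|k' y' z' r' zy' _] => //.
  elim: r' z' zy' => [|k2 y2 z2 _ IH zy2 _] z'; first exact: nat_nbrs_lt.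
  exact/nat_nbrs_lt/IH.
rewrite -oz -[y]/(val (Ordinal yn)) in zy okz r IH *.
apply: PS => //; first exact: IH.
by rewrite -keptE zy.
Qed.

(** Induction along the walk: monotonicity of [f] in the key lets the bound at one vertex pass over
    the next edge. *)
Lemma reach_min f (src : 'I_n) (c : nat -> nat -> nat) :
  (forall k k' y z, k <= k' -> f k y z <= f k' y z) ->
  search_post n nb src f kept c ->
  forall k (x : 'I_n), reach nb kept f src k x -> 0 < c aKEY x <= k.+1.
Proof.
move=> fm [Ks _ _ Kc]; apply: reach_ind_ord; first by rewrite Ks.
move=> k y z _ /andP[ky kk]; rewrite -keptE => /andP[zy okz].
have /andP[-> le] := Kc y z (ltn_ord y) ky zy okz.
by apply: leq_trans le _; rewrite ltnS; apply: fm; lia.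
Qed.

Definition bfs_next (w y z : nat) : nat := w.+1.

Lemma bfs_layering (c : nat -> nat -> nat) :
  search_post n nb a bfs_next kept c -> layering G a b (fun x : 'I_n => c aKEY x).
Proof.
move=> P; have min := reach_min (c := c) (fun k k' _ _ h => h : bfs_next k 0 0 <= bfs_next k' 0 0) P.
case: P => Ka Kr _ Kc; split=> //.
- move=> x y kx; rewrite -keptE => /andP[yx okz].
  by have := Kc x y (ltn_ord x) kx yx okz; rewrite /bfs_next prednK.
- move=> x k1; have kx := ltnW k1; have := Kr x (ltn_ord x) kx.
  move: k1 {kx}; set k := c aKEY x => k1 r.
  (* The last edge of a walk that realizes the key of [x]. Minimality bounds the key of [y] from
     above, and the edge to [x] bounds it from below. *)
  have [y [kk [ry dyx kE]]] : exists (y : 'I_n) k', [/\ reach nb kept bfs_next a k' y, del G A y x & k.-1 = k'.+1].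
    move: r; have : 0 < k.-1 by lia.
    move: k.-1 => m m0 r; move: m m0 x r {k k1}.
    have H : forall m (x : 'I_n), reach nb kept bfs_next a m x -> 0 < m ->
       exists (y : 'I_n) k', [/\ reach nb kept bfs_next a k' y, del G A y x & m = k'.+1].
      by apply: reach_ind_ord => // m y z ry _ dyz _; exists y, m.
    by move=> m m0 x /H; apply.
  exists y; split=> //; have /andP[ky kyk] := min _ _ ry.
  move: (dyx); rewrite -keptE => /andP[xy okx].
  have := Kc y x (ltn_ord y) ky xy okx; rewrite -/k /bfs_next; lia.
move=> x k1; have := Kr x (ltn_ord x); rewrite k1 => /(_ isT) /=.
suff H : forall m (x : 'I_n), reach nb kept bfs_next a m x -> m = 0 -> x = a.
  by move=> /H; apply.
exact: reach_ind_ord.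
Qed.

Variables (D : 'I_n -> nat) (d : nat -> nat).
Hypothesis dE : forall x : 'I_n, d x = D x.
Hypothesis lay : layering G a b D.

(** Maximizing the least weight on a walk is turned into minimizing the largest complemented weight,
    to fit a search that minimizes keys. *)
Definition heavy_next (w y z : nat) : nat := maxn w (2 * n + 2 - (d y + d z)).

(** The vertices of the path lie in distinct layers. *)
Lemma shortest_bound p : shortest G a b D p -> D b <= n.
Proof.
move=> sho; have inj : injective (fun i : 'I_(D b) => p i.+1).
  move=> i j /(congr1 D); rewrite !(shortest_layer sho) ?ltn_ord // => /succn_inj.
  exact: val_inj.
by have := leq_card _ inj; rewrite !card_ord.
Qed.

(** A stored key is [k + 1], and the inequality says [k <= 2 * n + 2 - (2 * i + 3)]: some walk uses
    only edges of weight at least [2 * i + 3]. Since [i < n], truncation of the subtraction does no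
    harm. One array of keys thus represents all the sets [Q i]. *)
Lemma heavy_keys (c : nat -> nat -> nat) i (x : 'I_n) : 0 < i < D b -> D b <= n ->
  search_post n nb b heavy_next kept c ->
  (0 < c aKEY x) && (c aKEY x + 2 * i <= 2 * n) = connect (heavy G a b D i) b x.
Proof.
move=> ib bn P; have [Kb Kr _ Kc] := P; apply/idP/idP.
  move=> /andP[kx le]; have := Kr x (ltn_ord x) kx.
  have : (c aKEY x).-1 + 2 * i < 2 * n by lia.
  move: (c aKEY x).-1 => k {kx le} le r; move: k x r le.
  apply: reach_ind_ord => [_|k y z _ IH dyz le]; first exact: connect0.
  have [k1 k2] : k + 2 * i < 2 * n /\ 2 * n + 2 - (d y + d z) + 2 * i < 2 * n.
    move: le; rewrite /heavy_next; lia.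
  apply: connect_trans (IH k1) (connect1 _); rewrite /heavy /= dyz.
  by move: k2; rewrite !dE; lia.
move=> /connectP[q + ->] {x}.
have : (0 < c aKEY b) && (c aKEY b + 2 * i <= 2 * n) by rewrite Kb; lia.
elim: q {1 2 4 5 6}b => [|z q IH] y //= hy /andP[/andP[dyz w]]; apply: IH.
move: dyz; rewrite -keptE => /andP[zy okz]; have /andP[ky kl] := hy.
have := Kc y z (ltn_ord y) ky zy okz.
by rewrite /heavy_next !dE; lia.
Qed.

End NatGraph.

(** * Testing all cuts of a path *)

Definition in_cap (u v e : expr) : expr :=
  Cell aCL (u *' #rN +' e) *' Cell aCL (v *' #rN +' e).
Definition in_A : expr -> expr := in_cap #rA #rB.
Definition in_B : expr -> expr := in_cap #rU #rV.
Definition removed_edge : expr := in_A #rY *' in_A #rZ.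

Definition find_path : cmd :=
  rL <<- Cell aD #rB ;;;
  aP @@ #rL <<- #rB ;;;
  rY <<- #rB ;;;
  For rT (#rL -' $1)
    (ForNb rY rK rZ
       (If removed_edge Skip
          (If (Cell aD #rZ +' $1 ==' Cell aD #rY)
             (aP @@ #rL -' $1 -' #rT <<- #rZ) Skip)) ;;;
     rY <<- Cell aP (#rL -' $1 -' #rT)).

Definition in_Q (e i : expr) : expr :=
  ($1 <=' Cell aKEY e) *' (Cell aKEY e +' $2 *' i <=' $2 *' #rN).

Definition scan_crossing : cmd :=
  ForNb rY rK rZ
    (If removed_edge Skip
      (If (in_Q #rZ #rI) Skip
        (If (in_B #rX *' in_B #rZ) Skip (aBAD @@ #rI <<- $1)))).

(* An edge leaving [x] can only cross the cut number [D x - 1]. *)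
Definition mark_bad : cmd :=
  For rX #rN (aBAD @@ #rX <<- $0) ;;;
  For rX #rN
    (rI <<- Cell aD #rX -' $1 ;;;
     If (($1 <=' #rI) *' (#rI +' $1 <=' #rL) *' in_Q #rX #rI)
       (rU <<- Cell aP #rI ;;;
        rV <<- Cell aP (#rI +' $1) ;;;
        rY <<- #rX ;;;
        scan_crossing)
       Skip).

Definition fill_vertex : cmd :=
  20 <<- in_Q #rX #rI ;;;
  21 <<- in_A #rX ;;;
  22 <<- in_B #rX ;;;
  1 @@ #rX <<- $1 -' #20 ;;;
  2 @@ #rX <<- #20 ;;;
  3 @@ #rX <<- #21 *' ($1 -' #20) ;;;
  4 @@ #rX <<- #22 *' ($1 -' #20) ;;;
  5 @@ #rX <<- #21 *' #20 ;;;
  6 @@ #rX <<- #22 *' #20 ;;;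
  If (#21 +' #22) Skip (If #20 (19 <<- $1) (18 <<- $1)).

(* Registers 18 and 19 tell whether the light, resp. heavy, side has a vertex
   outside both cliques. *)
Definition fill_cut : cmd :=
  18 <<- $0 ;;; 19 <<- $0 ;;; For rX #rN fill_vertex ;;; rOK <<- #18 *' #19.

(** [B] lies in the closed neighborhood of [p i], so disjointness from [A] is tested in time linear
    in a degree; whether [B] is a clique is looked up in a table computed once for all edges. *)
Definition check_cut : cmd :=
  rI <<- #rT +' $1 ;;;
  rU <<- Cell aP #rI ;;;
  rV <<- Cell aP (#rI +' $1) ;;;
  rY <<- #rU ;;;
  If (in_A #rU) (aBAD @@ #rI <<- $1) Skip ;;;
  ForNb rY rK rZ (If (in_B #rZ *' in_A #rZ) (aBAD @@ #rI <<- $1) Skip) ;;;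
  If (Cell aBAD #rI) Skip
    (If (Cell aCAND (#rU *' #rN +' #rV)) fill_cut Skip).

Definition check_cuts : cmd := For rT (#rL -' $1) (If #rOK Skip check_cut).

Section Phases.
Variables (n : nat) (G : sgraph 'I_n) (nbrs : 'I_n -> seq 'I_n) (X dl : nat).
Hypothesis adjl : adjacency_lists G nbrs.
Hypothesis XH : 4 * (n + 2) * (n + 2) <= X.
Hypothesis dlE : dl = max_degree G.
Variables (a b : 'I_n).
Local Notation nb := (nat_nbrs nbrs).
Local Notation A := (cap2 G a b).

Let nX : n <= X. Proof. by move: XH; clear; nia. Qed.
Let X_gt0 : 0 < X. Proof. by move: XH; clear; nia. Qed.
Let ordX (z : 'I_n) : z <= X. Proof. exact: leq_trans (ltnW (ltn_ord z)) nX. Qed.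

Definition pair_mem (s : state) : Prop :=
  [/\ graph_mem n nb s, regs s rA = a & regs s rB = b].

Lemma pair_mem_frame (rs ars : seq nat) s s' :
  pair_mem s -> frame rs ars s s' ->
  [&& rA \notin rs, rB \notin rs, rN \notin rs,
      aDEG \notin ars, aNB \notin ars & aCL \notin ars] -> pair_mem s'.
Proof.
move=> [gm ea eb] F /and3P[h1 h2 h3]; split; last 2 first.
- by rewrite (frame_reg F).
- by rewrite (frame_reg F).
exact: graph_mem_frame gm F h3.
Qed.

Lemma den_in_cap s u v e (x y z : 'I_n) : graph_mem n nb s ->
  den s u = x -> den s v = y -> den s e = z ->
  den s (in_cap u v e) = (z \in cap2 G x y).
Proof.
move=> [rn gm] ux vy ez; rewrite /= rn ux vy ez.
have [_ _ ->] := gm x (ltn_ord x); last exact: ltn_ord.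
have [_ _ ->] := gm y (ltn_ord y); last exact: ltn_ord.
by rewrite mulnb -(nat_capE adjl).
Qed.

Lemma den_removed s (y z : 'I_n) : pair_mem s -> regs s rY = y -> regs s rZ = z ->
  den s removed_edge = (y \in A) && (z \in A).
Proof.
move=> [gm ea eb] ey ez; rewrite -mulnb -(den_in_cap (u := #rA) (v := #rB) (e := #rY) gm ea eb ey).
by rewrite -(den_in_cap (u := #rA) (v := #rB) (e := #rZ) gm ea eb ez).
Qed.

(** The cost keeps the actual degree: in the outer loop over all edges the degrees sum to at most
    twice the number of edges, which a bound by the maximum degree would not give. *)
Lemma spec_nbrs_size (x : 'I_n) rx rj rz c s0 T (Inv : nat -> state -> Prop) :
  graph_mem n nb s0 -> regs s0 rx = x ->
  rj \notin rz :: wregs c ->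
  [&& rx != rj, rx != rz, rx \notin wregs c, rN != rj, rN != rz, rN \notin wregs c,
     aDEG \notin warrs c & aNB \notin warrs c] ->
  (forall i (z : 'I_n) s, i < size (nbrs x) -> z \in nbrs x -> nth x (nbrs x) i = z ->
     cframe (ForNb rx rj rz c) s0 s -> regs s rj = i -> Inv i s ->
     spec X c (set_reg s rz z) T (fun s' => Inv i.+1 (set_reg s' rj i.+1))) ->
  Inv 0 (set_reg s0 rj 0) ->
  spec X (ForNb rx rj rz c) s0 (degree G x * nb_cost T + 14)
    (fun s' => Inv (size (nbrs x)) s').
Proof.
move=> gm ex h1 h2 step inv0.
have nE := nat_nbrsE nbrs x.
have sE : size (nb x) = size (nbrs x) by rewrite nE size_map.
rewrite -(size_nat_nbrs adjl) -sE; apply: (spec_nb gm (ltn_ord x) ex) h1 h2 _ inv0.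
- by apply: leq_trans (size_nat_nbrs_n adjl (ltn_ord x)) nX.
- by move=> z /(nat_nbrs_lt (ltn_ord x)) /ltnW zn; apply: leq_trans zn nX.
move=> i s; rewrite sE => iy F ej inv.
by rewrite nE (nth_map x) //; apply: step => //; apply: mem_nth.
Qed.

Lemma spec_nbrs (x : 'I_n) rx rj rz c s0 T (Inv : nat -> state -> Prop) :
  graph_mem n nb s0 -> regs s0 rx = x ->
  rj \notin rz :: wregs c ->
  [&& rx != rj, rx != rz, rx \notin wregs c, rN != rj, rN != rz, rN \notin wregs c,
     aDEG \notin warrs c & aNB \notin warrs c] ->
  (forall i (z : 'I_n) s, i < size (nbrs x) -> z \in nbrs x -> nth x (nbrs x) i = z ->
     cframe (ForNb rx rj rz c) s0 s -> regs s rj = i -> Inv i s ->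
     spec X c (set_reg s rz z) T (fun s' => Inv i.+1 (set_reg s' rj i.+1))) ->
  Inv 0 (set_reg s0 rj 0) ->
  spec X (ForNb rx rj rz c) s0 (dl * nb_cost T + 14)
    (fun s' => Inv (size (nbrs x)) s').
Proof.
move=> gm ex h1 h2 step inv0; apply: spec_le.
  exact: spec_nbrs_size gm ex h1 h2 step inv0.
by rewrite leq_add2r leq_mul2r dlE -(size_nat_nbrs adjl) size_nat_nbrs_max ?orbT.
Qed.

Section WithLayers.
Variable D : 'I_n -> nat.
Hypothesis lay : layering G a b D.
Hypothesis D_bound : forall x, D x <= 3 * n + 2.

Definition layer_mem (s : state) : Prop := forall x : 'I_n, cells s aD x = D x.

Definition path_mem (p : nat -> 'I_n) (s : state) : Prop :=
  regs s rL = D b /\ forall i, 0 < i <= D b -> cells s aP i = p i.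

Lemma path_scan s (y : 'I_n) t : pair_mem s -> layer_mem s -> regs s rY = y ->
  regs s rT = t -> 1 < D y -> let i0 := regs s rL - 1 - t in
  spec X (ForNb rY rK rZ
       (If removed_edge Skip
          (If (Cell aD #rZ +' $1 ==' Cell aD #rY)
             (aP @@ #rL -' $1 -' #rT <<- #rZ) Skip))) s (dl * nb_cost 100 + 14)
    (fun s' => exists z : 'I_n, [/\ del G A z y, (D z).+1 = D y, cells s' aP i0 = z
      & forall i, i != i0 -> cells s' aP i = cells s aP i]).
Proof.
move=> pm lm ey et Dy i0; have [gm _ _] := pm.
pose good (z : 'I_n) := del G A z y && ((D z).+1 == D y).
(* Several neighbors may be good, each overwriting the cell; only the presence of some good one is
   claimed. *)
pose Inv j (s' : state) := (forall i, i != i0 -> cells s' aP i = cells s aP i) /\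
  (has good (take j (nbrs y)) -> exists2 z : 'I_n, good z & cells s' aP i0 = z).
apply: spec_imp.
- apply: (spec_nbrs (Inv := Inv) (T := 100) gm ey) => //; last by rewrite /Inv take0.
  move=> i z s1 iy zy iz F ek [i1 i2].
  have pm2 : pair_mem (set_reg s1 rZ z).
    apply: pair_mem_frame pm (frame_trans F _) _; first exact: frame_set_reg.
    by [].
  have ey1 : regs s1 rY = y by rewrite (frame_reg F).
  have eL : regs s1 rL = regs s rL by rewrite (frame_reg F).
  have eT : regs s1 rT = t by rewrite (frame_reg F).
  have eD (x : 'I_n) : cells s1 aD x = D x by rewrite (frame_cell _ F).
  have Gyz : G y z by move: zy; have [_ ->] := adjl y; rewrite inE.
  have tE : has good (take i.+1 (nbrs y)) = good z || has good (take i (nbrs y)).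
    by rewrite (take_nth y) // has_rcons iz.
  apply: spec_le; first apply: spec_wpl; rewrite /wpl.
    rewrite (den_removed pm2 (y := y) (z := z)) //.
    case dA : ((y \in A) && (z \in A)) => /=.
      split=> //; rewrite tE; have -> : good z = false by rewrite /good /del andbC [_ && (y \in A)]andbC dA /= !andbF.
      exact: i2.
    rewrite ey1 !eD addn1 eL eT -/i0.
    have gE : good z = ((D z).+1 == D y) by rewrite /good /del adj_sym Gyz [_ && (y \in A)]andbC dA.
    rewrite -gE /Inv tE; case: (boolP (good z)) => gz /=.
      split; first exact: ordX.
      split=> [k ki|_]; last by exists z; rewrite //= eqxx.
      by rewrite /= (negbTE ki) i1.
    by split.
  by [].
- by [].
move=> s' F [i1 i2]; have [|z gz zE] := i2.
  rewrite take_size; case: lay => _ _ /(_ y Dy)[u [du uy]] _.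
  apply/hasP; exists u; last by rewrite /good du uy eqxx.
  have [_ ->] := adjl y; rewrite inE adj_sym; by case/andP: du.
by exists z; case/andP: gz => ? /eqP.
Qed.

Lemma find_path_ok s0 : pair_mem s0 -> layer_mem s0 -> 0 < D b ->
  spec X find_path s0 (1000 * (n.+1 * dl.+1))
    (fun s => exists2 p, shortest G a b D p & path_mem p s).
Proof.
move=> pm lm Db; have [gm ea eb] := pm.
have DbX : D b <= X by have := D_bound b; nia.
pose s1 := set_reg s0 rL (D b).
pose s2 := set_cell s1 aP (D b) b.
pose s3 := set_reg s2 rY b.
pose frs := [:: rL; rY; rT; rK; rZ].
have F3 : frame frs [:: aP] s0 s3.
  apply: (@frame_trans _ _ _ s1); first exact: frame_set_reg.
  apply: (@frame_trans _ _ _ s2); first exact: frame_set_cell.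
  exact: frame_set_reg.
(* The path is built backwards from [b]; after [t] rounds [p] is meaningful on the last [t + 1]
   positions. *)
pose Inv t (s : state) := exists2 p : nat -> 'I_n, p (D b) = b & [/\
   forall i, D b - t <= i < D b -> del G A (p i) (p i.+1) /\ D (p i) = i,
   forall i, D b - t <= i <= D b -> cells s aP i = p i
   & regs s rY = p (D b - t)].
apply: spec_le.
  apply: spec_seq.
    by apply: spec_wpl => /=; rewrite eb lm; split; [exact: DbX|exact: (erefl s1)].
  move=> _ _ <-; apply: spec_seq.
    apply: spec_wpl => /=; rewrite eb; split; last exact: (erefl s2).
    exact: ordX.
  move=> _ _ <-; apply: spec_seq.
    apply: spec_wpl => /=; rewrite eb; split; last exact: (erefl s3).
    exact: ordX.
  move=> _ _ <-.
  (* The generic key bound [3 * n + 2] is used for [D b]: the bound [n] comes from a shortest path,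
     which is only being built here. *)
  apply: (@spec_le _ _ _ ((D b - 1) * (dl * nb_cost 100 + 14 + 8 + for_cost (#rL -' $1)) + for_cost (#rL -' $1))
     ((3 * n + 2) * (dl * nb_cost 100 + 14 + 8 + for_cost (#rL -' $1)) + for_cost (#rL -' $1))); last first.
    by rewrite leq_add2r leq_mul2r; apply/orP; right; have := D_bound b; lia.
  apply: spec_imp.
  - apply: (spec_for_const (N := D b - 1) (T := dl * nb_cost 100 + 14 + 8) (Inv := Inv)) => //.
    + by lia.
    + by move=> s F /=; rewrite (frame_reg F).
    + move=> t s tN F et [p pb [pd pm' ey]].
      have Fs : frame frs [:: aP] s0 s by apply: frame_trans F3 _; apply: frame_sub F _.
      have pms : pair_mem s by apply: pair_mem_frame pm Fs _.
      have lms : layer_mem s by move=> x; rewrite (frame_cell _ Fs).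
      have eL : regs s rL = D b by rewrite (frame_reg F).
      have Dy : D (p (D b - t)) = D b - t.
        case: t {F et ey} tN pd pm' => [|t] tN pd pm'; first by rewrite subn0 pb.
        by have [] := pd (D b - t.+1) _; lia.
      have Dy1 : 1 < D (p (D b - t)) by rewrite Dy; lia.
      apply: spec_le.
        apply: spec_seq (path_scan pms lms ey et Dy1) _ => s4 F4 [z [dz Dz cz other]].
        have eL4 : regs s4 rL = D b by rewrite (frame_reg F4) // eL.
        have eT4 : regs s4 rT = t by rewrite (frame_reg F4).
        have iE : D b - 1 - t = D b - t.+1 by lia.
        rewrite eL iE in cz other.
        apply: spec_wpl => /=; rewrite eL4 eT4 iE cz; split; first exact: ordX.
        pose i0 := D b - t.+1.
        exists (fun i => if i == i0 then z else p i).
          by rewrite ifN //; apply/eqP; rewrite /i0; lia.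
        have iS : i0.+1 = D b - t by rewrite /i0; lia.
        split=> [i|i|] /=; last by rewrite eqxx.
          move=> /andP[l1 l2]; case: (eqVneq i i0) => [->|ne].
            rewrite iS ifN; last by apply/eqP; lia.
            by split=> //; apply: succn_inj; rewrite Dz Dy -iS.
          rewrite ifN; last by apply/eqP; rewrite /i0 in ne *; lia.
          by apply: pd; rewrite /i0 in ne; lia.
        move=> /andP[l1 l2]; case: (eqVneq i i0) => [->//|ne].
        by rewrite other // pm' //; rewrite /i0 in ne; lia.
      by rewrite /nb_cost /=; lia.
    + exists (fun=> b) => //; split=> [i|i|]; rewrite ?subn0 //; first by lia.
      move=> h; have -> : i = D b by lia.
      by rewrite /= eqxx.
  - by [].
  move=> s F [p pb [pd pm' _]].
  have E1 : D b - (D b - 1) = 1 by lia.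
  rewrite E1 in pd pm'; exists p; first by split.
  split; last exact: pm'.
  by rewrite (frame_reg F).
by rewrite /= /for_cost /nb_cost /=; nia.
Qed.

Section WithPath.
Variables (p : nat -> 'I_n) (K : 'I_n -> nat).
Hypotheses (sho : shortest G a b D p) (K_bound : forall x, K x <= 3 * n + 2).

Definition key_mem (s : state) : Prop := forall x : 'I_n, cells s aKEY x = K x.

Definition far (i : nat) (x : 'I_n) : bool := (0 < K x) && (K x + 2 * i <= 2 * n).

Local Notation B i := (cap2 G (p i) (p i.+1)).

Definition violation (i : nat) (x y : 'I_n) : bool :=
  [&& D x == i.+1, far i x, ~~ far i y, del G A x y & ~~ ((x \in B i) && (y \in B i))].

Lemma den_in_Q s e i (x : 'I_n) k : regs s rN = n -> key_mem s ->
  den s e = x -> den s i = k -> den s (in_Q e i) = far k x.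
Proof. by move=> en km ex ei; rewrite /= ex ei en km mulnb. Qed.

Lemma bool_neq0 (c : bool) : ((c : nat) != 0) = c.
Proof. by case: c. Qed.

Definition cut_mem (i : nat) (s : state) : Prop :=
  [/\ pair_mem s, regs s rI = i, regs s rU = p i & regs s rV = p i.+1].

Lemma cut_mem_frame (rs ars : seq nat) i s s' :
  cut_mem i s -> frame rs ars s s' ->
  [&& rI \notin rs, rU \notin rs, rV \notin rs, rA \notin rs, rB \notin rs, rN \notin rs,
      aDEG \notin ars, aNB \notin ars & aCL \notin ars] -> cut_mem i s'.
Proof.
move=> [pm ei eu ev] F /and4P[h1 h2 h3 h4]; split; last 3 first.
- by rewrite (frame_reg F).
- by rewrite (frame_reg F).
- by rewrite (frame_reg F).
exact: pair_mem_frame pm F h4.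
Qed.

Lemma den_in_B i s e (x : 'I_n) : cut_mem i s -> den s e = x ->
  den s (in_B e) = (x \in B i).
Proof. by move=> [[gm _ _] _ eu ev] ex; apply: den_in_cap. Qed.

Lemma den_in_A s e (x : 'I_n) : pair_mem s -> den s e = x ->
  den s (in_A e) = (x \in A).
Proof. by move=> [gm ea eb] ex; apply: den_in_cap. Qed.

Lemma scan_crossing_ok s i (x : 'I_n) :
  cut_mem i s -> key_mem s -> regs s rX = x -> regs s rY = x -> D x = i.+1 -> far i x ->
  spec X scan_crossing s (dl * nb_cost 200 + 14)
    (fun s' => forall k, (cells s' aBAD k != 0) =
       (cells s aBAD k != 0) || (k == i) && [exists y, violation i x y]).
Proof.
move=> cm km eX eY Dx fx; have [[gm _ _] ei _ _] := cm.
pose Inv j (s' : state) := forall k, (cells s' aBAD k != 0) =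
  (cells s aBAD k != 0) || (k == i) && has (violation i x) (take j (nbrs x)).
apply: spec_imp.
- apply: (spec_nbrs (Inv := Inv) (T := 200) gm eY) => //; last first.
    by move=> k; rewrite take0 andbF orbF.
  move=> j z s1 jx zx jz F ek inv.
  have F2 : frame [:: rK; rZ] [:: aBAD] s (set_reg s1 rZ z).
    by apply: (@frame_trans _ _ _ s1); [apply: frame_sub F _|apply: frame_set_reg].
  have cm2 : cut_mem i (set_reg s1 rZ z) by apply: cut_mem_frame cm F2 _.
  have [pm2 ei2 _ _] := cm2; have [[en2 _] _ _] := pm2.
  have eY2 : regs (set_reg s1 rZ z) rY = x by rewrite (frame_reg F2).
  have eX2 : regs (set_reg s1 rZ z) rX = x by rewrite (frame_reg F2).
  have km2 : key_mem (set_reg s1 rZ z) by move=> y; rewrite (frame_cell _ F2).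
  have Gxz : G x z by move: zx; have [_ ->] := adjl x; rewrite inE.
  have tE : has (violation i x) (take j.+1 (nbrs x)) =
      violation i x z || has (violation i x) (take j (nbrs x)).
    by rewrite (take_nth x) // has_rcons jz.
  have vE : violation i x z = [&& ~~ ((x \in A) && (z \in A)), ~~ far i z
      & ~~ ((x \in B i) && (z \in B i))].
    by rewrite /violation Dx eqxx fx /del Gxz /= andbCA.
  apply: spec_le; first apply: spec_wpl; rewrite /wpl.
    rewrite (den_removed pm2 (y := x) (z := z)) // (den_in_Q (x := z) (k := i)) //.
    have -> : den (set_reg s1 rZ z) (in_B #rX *' in_B #rZ) = (x \in B i) && (z \in B i).
      by rewrite -mulnb -(den_in_B (e := #rX) cm2 eX2) -(den_in_B (e := #rZ) (x := z) cm2).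
    rewrite !bool_neq0 /Inv tE vE.
    case: ((x \in A) && (z \in A)) => /=; first exact: inv.
    case: (far i z) => /=; first exact: inv.
    case: ((x \in B i) && (z \in B i)) => /=; first exact: inv.
    split; first exact: X_gt0.
    move=> k; rewrite -[regs s1 6]/(regs (set_reg s1 rZ z) rI) ei2 andbT.
    by have := inv k; case: (k == i) => /= h; rewrite ?orbT.
  by [].
- by [].
move=> s' F inv k; rewrite inv take_size; congr (_ || _ && _).
apply/hasP/existsP => [[y _ v]|[y v]]; exists y => //.
have [_ ->] := adjl x; rewrite inE; by case/and5P: v => _ _ _ /andP[].
Qed.

Lemma mark_bad_ok s0 : pair_mem s0 -> layer_mem s0 -> key_mem s0 -> path_mem p s0 ->
  spec X mark_bad s0 (1000 * (n.+1 * dl.+1))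
    (fun s => forall i, 0 < i < D b ->
       (cells s aBAD i != 0) = [exists x, exists y, violation i x y]).
Proof.
move=> pm lm km [eL pP]; have [gm _ _] := pm; have [en _] := gm.
pose frs := [:: rX; rI; rU; rV; rY; rK; rZ].
have Dbn := shortest_bound sho.
pose Inv k (s : state) := forall i, 0 < i < D b -> (cells s aBAD i != 0) =
  [exists x : 'I_n, (x < k) && [exists y, violation i x y]].
apply: spec_le.
  apply: spec_seq.
    apply: (spec_fill (N := n) (g := fun=> 0)) => //.
    by move=> s F /=; rewrite (frame_reg F).
  move=> s1 F1 clr.
  have Fs1 : frame frs [:: aBAD] s0 s1 by apply: frame_sub F1 _.
  apply: spec_imp.
  - apply: (spec_for_const (N := n) (T := dl * nb_cost 200 + 14 + 100) (Inv := Inv)) => //.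
    + by move=> s F /=; rewrite (frame_reg F) // (frame_reg Fs1).
    + move=> k s kn F ek inv.
      have Fs : frame frs [:: aBAD] s0 s by apply: frame_trans Fs1 _; apply: frame_sub F _.
      pose x := Ordinal kn; have ex : regs s rX = x by [].
      have lms : layer_mem s by move=> y; rewrite (frame_cell _ Fs).
      pose i := D x - 1.
      pose s2 := set_reg s rI i.
      have F2 : frame frs [:: aBAD] s0 s2 by apply: frame_trans Fs _; apply: frame_set_reg.
      have km2 : key_mem s2 by move=> y; rewrite (frame_cell _ F2).
      have en2 : regs s2 rN = n by rewrite (frame_reg F2).
      have eL2 : regs s2 rL = D b by rewrite (frame_reg F2).
      have newE (P : pred 'I_n) : [exists y : 'I_n, (y < k.+1) && P y] =
          [exists y : 'I_n, (y < k) && P y] || P x.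
        apply/existsP/orP => [[y /andP[yk Py]]|[/existsP[y /andP[yk Py]]|Px]].
        * move: yk; rewrite ltnS leq_eqVlt => /orP[/eqP yk|yk].
            by right; have <- : y = x by apply: val_inj.
          by left; apply/existsP; exists y; rewrite yk.
        * by exists y; rewrite ltnS ltnW.
        * by exists x; rewrite leqnn.
      apply: spec_le.
        apply: spec_seq.
          apply: spec_wpl => /=; rewrite ex lms; split; last exact: (erefl s2).
          by have := D_bound x; nia.
        move=> _ _ <-.
        have condE : den s2 (($1 <=' #rI) *' (#rI +' $1 <=' #rL) *' in_Q #rX #rI) =
            [&& 0 < i, i < D b & far i x].
          have eLs : regs s rL = D b by rewrite (frame_reg Fs).
          have ens : regs s rN = n by rewrite (frame_reg Fs).
          have kms y : cells s aKEY y = cells s2 aKEY y by [].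
          by rewrite /= ex eLs ens !kms km2 addn1 !mulnb -andbA.
        apply: (@spec_if _ _ _ _ _ (dl * nb_cost 200 + 24)); rewrite condE.
          rewrite bool_neq0 => /and3P[i0 ib fx].
          have Dx : D x = i.+1 by rewrite /i in i0 *; lia.
          pose s3 := set_reg s2 rU (p i); pose s4 := set_reg s3 rV (p i.+1).
          pose s5 := set_reg s4 rY x.
          have F5 : frame frs [:: aBAD] s0 s5.
            apply: frame_trans F2 _; apply: (@frame_trans _ _ _ s3); first exact: frame_set_reg.
            apply: (@frame_trans _ _ _ s4); exact: frame_set_reg.
          apply: (@spec_le _ _ _ (3 + (5 + (2 + (dl * nb_cost 200 + 14))))); last by lia.
          apply: spec_seq.
            apply: spec_wpl => /=; rewrite (frame_cell _ F2) // pP; last lia.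
            by split=> //; exact: (erefl s3).
          move=> _ _ <-; apply: spec_seq.
            apply: spec_wpl => /=; rewrite addn1 (frame_cell _ F2) // pP; last lia.
            by split=> //; exact: (erefl s4).
          move=> _ _ <-; apply: spec_seq.
            by apply: spec_wpl => /=; rewrite ex; split; [exact: ordX|exact: (erefl s5)].
          move=> _ _ <-; apply: spec_imp.
          * apply: (@scan_crossing_ok s5 i x) => //.
              by split=> //; apply: pair_mem_frame pm F5 _.
          * exact: leqnn.
          move=> s' F' post j jb; rewrite post newE //; congr (_ || _); first exact: inv.
          case: eqP => [->//|ne]; apply/esym/existsP => -[y /and5P[/eqP Dx2 _ _ _ _]].
          by apply: ne; apply: succn_inj; rewrite -Dx2.
        move=> /eqP; rewrite eqb0 => no.
        apply: (@spec_le _ _ _ 1); last by lia.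
        apply: spec_skip => j jb.
        have -> : cells (set_reg s2 rX k.+1) aBAD j = cells s aBAD j by [].
        rewrite newE inv //; apply/esym/orb_idr => /existsP[y /and5P[/eqP Dx2 fx _ _ _]].
        by case/negP: no; rewrite /i Dx2 subn1 /= fx; case/andP: jb => -> ->.
      by rewrite /=; lia.
    + move=> j jb; rewrite clr; last by lia.
      by apply/esym/existsP => -[y /andP[]].
  - exact: leqnn.
  move=> s' _ inv i ib; rewrite inv //.
  by apply: eq_existsb => x; rewrite ltn_ord.
by rewrite /= /for_cost /nb_cost /=; nia.
Qed.

Definition heavy_side (i : nat) : {set 'I_n} := [set x | far i x].
Local Notation Q i := (heavy_side i).

Definition cut_filled (i : nat) (s : state) : Prop :=
  [/\ output_set n s 1 = ~: Q i /\ output_set n s 2 = Q i,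
      output_set n s 3 = A :\: Q i /\ output_set n s 4 = B i :\: Q i
    & output_set n s 5 = A :&: Q i /\ output_set n s 6 = B i :&: Q i].

Definition both_inner (i : nat) : bool :=
  [exists x, ~~ far i x && (x \notin A :|: B i)] &&
  [exists x, far i x && (x \notin A :|: B i)].

Lemma exists_ltnS k (kn : k < n) (P : pred 'I_n) :
  [exists y : 'I_n, (y < k.+1) && P y] = [exists y : 'I_n, (y < k) && P y] || P (Ordinal kn).
Proof.
apply/existsP/orP => [[y /andP[yk Py]]|[/existsP[y /andP[yk Py]]|Px]].
- move: yk; rewrite ltnS leq_eqVlt => /orP[/eqP yk|yk].
    by right; have <- : y = Ordinal kn by apply: val_inj.
  by left; apply/existsP; exists y; rewrite yk.
- by exists y; rewrite ltnS ltnW.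
- by exists (Ordinal kn); rewrite leqnn.
Qed.

Lemma fill_ok s0 i : cut_mem i s0 -> key_mem s0 ->
  spec X fill_cut s0 (300 * n.+1)
    (fun s => cut_filled i s /\ regs s rOK = both_inner i).
Proof.
move=> cm km; have [[[en _] _ _] ei _ _] := cm.
pose frs := [:: rX; 18; 19; 20; 21; 22]; pose fas := [:: 1; 2; 3; 4; 5; 6].
pose s1 := set_reg s0 18 0; pose s2 := set_reg s1 19 0.
have F2 : frame frs fas s0 s2.
  by apply: (@frame_trans _ _ _ s1); apply: frame_set_reg.
pose out x : nat -> bool := fun a => match a with
  | 1 => ~~ far i x | 2 => far i x
  | 3 => (x \in A) && ~~ far i x | 4 => (x \in B i) && ~~ far i x
  | 5 => (x \in A) && far i x | _ => (x \in B i) && far i x end.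
pose Inv k (s : state) :=
  [/\ forall (x : 'I_n) c, x < k -> 0 < c < 7 -> cells s c x = out x c,
      regs s 18 = [exists x : 'I_n, (x < k) && (~~ far i x && (x \notin A :|: B i))]
    & regs s 19 = [exists x : 'I_n, (x < k) && (far i x && (x \notin A :|: B i))]].
apply: spec_le.
  apply: spec_seq.
    by apply: spec_wpl => /=; split; [|exact: (erefl s1)].
  move=> _ _ <-; apply: spec_seq.
    by apply: spec_wpl => /=; split; [|exact: (erefl s2)].
  move=> _ _ <-; apply: spec_seq.
    apply: (spec_for_const (N := n) (T := ccost fill_vertex) (Inv := Inv)) => //.
    + by move=> s F /=; rewrite (frame_reg F).
    + move=> k s kn F ek [i1 i2 i3].
      have Fs : frame frs fas s0 s by apply: frame_trans F2 _; apply: frame_sub F _.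
      pose x := Ordinal kn; have ex : regs s rX = x by [].
      have cms : cut_mem i s by apply: cut_mem_frame cm Fs _.
      have kms : key_mem s by move=> y; rewrite (frame_cell _ Fs).
      have [pms eis _ _] := cms; have [[ens _] _ _] := pms.
      have := den_in_Q (e := #rX) (i := #rI) ens kms ex eis; rewrite /= => EQ.
      have := den_in_A (e := #rX) pms ex; rewrite /= => EA.
      have := den_in_B (e := #rX) cms ex; rewrite /= => EB.
      have b1 m : m <= 1 -> m <= X by move=> m1; apply: leq_trans m1 X_gt0.
      have outS (s' : state) :
          (forall c j, cells s' c j =
             if (0 < c < 7) && (j == k) then out x c : nat else cells s c j) ->
          forall (y : 'I_n) c, y < k.+1 -> 0 < c < 7 -> cells s' c y = out y c.
        move=> E y c yk c7; rewrite E c7 /=; case: eqP => [yE|/eqP ne].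
          by have -> : y = x by apply: val_inj.
        by apply: i1 => //; move: yk; rewrite ltnS leq_eqVlt (negbTE ne).
      have cellsE (v1 v2 v3 : nat) : forall c j, cells
          (set_cell (set_cell (set_cell (set_cell (set_cell (set_cell
             (set_reg (set_reg (set_reg s 20 v1) 21 v2) 22 v3)
             1 x (1 - far i x)) 2 x (far i x)) 3 x ((x \in A) * (1 - far i x)))
             4 x ((x \in B i) * (1 - far i x))) 5 x ((x \in A) * far i x))
             6 x ((x \in B i) * far i x)) c j =
          if (0 < c < 7) && (j == k) then out x c : nat else cells s c j.
        move=> c j /=; case: (j == k); rewrite ?andbF // !andbT.
        by do 7?[case: c => [|c] //=]; rewrite /out; case: (far i x); case: (x \in A); case: (x \in B i).
      apply: spec_wpl => /=; rewrite !EQ !EA !EB ex.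
      do 9?[split; first by apply: b1; case: (far i x); case: (x \in A); case: (x \in B i)].
      have nAB : (x \notin A :|: B i) = ~~ ((x \in A) || (x \in B i)) by rewrite in_setU.
      have -> : ((x \in A) + (x \in B i) != 0) = (x \in A) || (x \in B i).
        by case: (x \in A); case: (x \in B i).
      have [AB|AB] := boolP ((x \in A) || (x \in B i)).
        split; first by apply: outS; apply: cellsE.
          by rewrite /= i2 (exists_ltnS kn) nAB AB !andbF orbF.
        by rewrite /= i3 (exists_ltnS kn) nAB AB !andbF orbF.
      rewrite bool_neq0; have [fx|fx] : far i x \/ ~~ far i x by apply/orP; case: (far i x).
        rewrite (ifT _ _ fx); split; first exact: X_gt0; split; first by apply: outS; apply: cellsE.
          by rewrite /= i2 (exists_ltnS kn) fx /= orbF.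
        by rewrite /= (exists_ltnS kn) nAB fx AB orbT.
      rewrite (ifN _ _ fx); split; first exact: X_gt0; split; first by apply: outS; apply: cellsE.
        by rewrite /= (exists_ltnS kn) nAB fx AB orbT.
      by rewrite /= i3 (exists_ltnS kn) (negbTE fx) /= orbF.
    split=> //=; [rewrite (_ : [exists _, _] = false) //|rewrite (_ : [exists _, _] = false) //];
      by apply/existsP => -[].
  move=> s F [i1 i2 i3]; apply: spec_wpl => /=; rewrite i2 i3 mulnb.
  have exE (P : pred 'I_n) : [exists x : 'I_n, (x < n) && P x] = [exists x, P x].
    by apply: eq_existsb => x; rewrite ltn_ord.
  rewrite !exE; split; first by apply: leq_trans X_gt0; case: (_ && _).
  split; last by [].
  have oE v c : 0 < c < 7 -> output_set n (set_reg s rOK v) c = [set x | out x c].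
    by move=> c7; apply/setP => x; rewrite !inE /= i1 // bool_neq0.
  split; split; rewrite oE //; apply/setP => x; rewrite !inE //= andbC !inE //; exact: andbC.
by rewrite /= /for_cost /=; nia.
Qed.

Definition cliqueb (K' : {set 'I_n}) : bool :=
  [forall x in K', forall y in K', (x != y) ==> G x y].

Lemma cliquebP K' : reflect (clique G K') (cliqueb K').
Proof.
apply: (iffP forall_inP) => [h x y xK yK|h x xK].
  by have /forall_inP/(_ y yK)/implyP := h x xK.
by apply/forall_inP => y yK; apply/implyP; apply: h.
Qed.

Definition cand_mem (s : state) : Prop := forall x y : 'I_n, G x y ->
  cells s aCAND (x * n + y) = cliqueb (cap2 G x y).

Definition bad (i : nat) : bool := [exists x, exists y, violation i x y].

Definition valid (i : nat) : bool :=
  [&& ~~ bad i, [disjoint A & B i] & cliqueb (B i)].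

Lemma disjoint_nbrs i : 0 < i < D b -> [disjoint A & B i] =
  ~~ ((p i \in A) || has (fun z => (z \in B i) && (z \in A)) (nbrs (p i))).
Proof.
move=> ib; have pG : G (p i) (p i.+1) by case: sho => _ /(_ i ib)[/andP[]].
have pB := cap2_l pG.
apply/idP/norP => [d|[h1 /hasPn h2]].
  split; first by apply/negP => pA; rewrite (disjointFr d pA) in pB.
  by apply/hasPn => z _; apply/negP => /andP[zB zA]; rewrite (disjointFr d zA) in zB.
apply/pred0P => z /=; apply/negP => /andP[zA zB].
have := zB; rewrite inE => /andP[/orP[/eqP E|Gz] _].
  by rewrite E zA in h1.
have := h2 z; have [_ ->] := adjl (p i); rewrite inE => /(_ Gz).
by rewrite zB zA.
Qed.

Definition found (i : nat) (s : state) : Prop :=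
  if valid i && both_inner i then cut_filled i s /\ regs s rOK = 1 else regs s rOK = 0.

(** The term linear in [n] is charged only if the cut is valid; the loop over all cuts relies on
    this. *)
Lemma check_cut_ok s0 t : pair_mem s0 -> path_mem p s0 -> key_mem s0 -> cand_mem s0 ->
  regs s0 rT = t -> t.+1 < D b -> (cells s0 aBAD t.+1 != 0) = bad t.+1 -> regs s0 rOK = 0 ->
  spec X check_cut s0
    (dl * nb_cost 100 + 200 + (if valid t.+1 then 300 * n.+1 else 0))
    (fun s => found t.+1 s /\
       forall k, k != t.+1 -> (cells s aBAD k != 0) = (cells s0 aBAD k != 0)).
Proof.
move=> pm [eL pP] km cm eT tb badE ok0; set i := t.+1 in tb badE *.
have [gm _ _] := pm; have [en _] := gm.
have ib : 0 < i < D b by [].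
have pG : G (p i) (p i.+1) by case: sho => _ /(_ i ib)[/andP[]].
have iX : i <= X by have := shortest_bound sho; have := nX; lia.
pose frs := [:: rI; rU; rV; rY; rK; rZ].
pose s1 := set_reg s0 rI i; pose s2 := set_reg s1 rU (p i).
pose s3 := set_reg s2 rV (p i.+1); pose s4 := set_reg s3 rY (p i).
have F4 : frame frs [:: aBAD] s0 s4.
  apply: (@frame_trans _ _ _ s1); first exact: frame_set_reg.
  apply: (@frame_trans _ _ _ s2); first exact: frame_set_reg.
  by apply: (@frame_trans _ _ _ s3); apply: frame_set_reg.
have cm4 : cut_mem i s4 by split=> //; apply: pair_mem_frame pm F4 _.
have [pm4 _ _ _] := cm4.
apply: spec_le.
  apply: spec_seq.
    by apply: spec_wpl => /=; rewrite eT addn1; split; [exact: iX|exact: (erefl s1)].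
  move=> _ _ <-; apply: spec_seq.
    apply: spec_wpl => /=; rewrite pP; last lia.
    by split; [exact: ordX|exact: (erefl s2)].
  move=> _ _ <-; apply: spec_seq.
    apply: spec_wpl => /=; rewrite addn1 pP; last lia.
    by split; [exact: ordX|exact: (erefl s3)].
  move=> _ _ <-; apply: spec_seq.
    by apply: spec_wpl => /=; split; [exact: ordX|exact: (erefl s4)].
  move=> _ _ <-; apply: spec_seq.
    apply: (spec_wpl (Q := fun s => forall k, (cells s aBAD k != 0) =
       (cells s0 aBAD k != 0) || (k == i) && (p i \in A))).
    rewrite /wpl (den_in_A (x := p i)) // bool_neq0.
    case: (p i \in A) => /=; last by move=> k; rewrite andbF orbF.
    split; first exact: X_gt0.
    by move=> k; rewrite andbT; case: (k == i) => /=; rewrite ?orbT ?orbF.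
  move=> s5 F5 bad5.
  have F5' : frame frs [:: aBAD] s0 s5 by apply: frame_trans F4 _; apply: frame_sub F5 _.
  have cm5 : cut_mem i s5 by apply: cut_mem_frame cm4 F5 _.
  have [pm5 _ _ _] := cm5; have [gm5 _ _] := pm5.
  have eY5 : regs s5 rY = p i by rewrite (frame_reg F5).
  pose hit z := (z \in B i) && (z \in A).
  pose Inv j (s : state) := forall k, (cells s aBAD k != 0) =
     (cells s5 aBAD k != 0) || (k == i) && has hit (take j (nbrs (p i))).
  apply: spec_seq.
    apply: (spec_nbrs (Inv := Inv) (T := 100) gm5 eY5) => //; last first.
      by move=> k; rewrite take0 andbF orbF.
    move=> j z s jx zx jz F ek inv.
    have F2 : frame frs [:: aBAD] s5 (set_reg s rZ z).
      by apply: (@frame_trans _ _ _ s); [apply: frame_sub F _|apply: frame_set_reg].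
    have cm2 : cut_mem i (set_reg s rZ z).
      apply: cut_mem_frame cm5 (_ : frame [:: rK; rZ] [:: aBAD] _ _) _ => //.
      by apply: (@frame_trans _ _ _ s); [apply: frame_sub F _|apply: frame_set_reg].
    have [pm2 ei2 _ _] := cm2.
    have tE : has hit (take j.+1 (nbrs (p i))) = hit z || has hit (take j (nbrs (p i))).
      by rewrite (take_nth (p i)) // has_rcons jz.
    apply: spec_le; first apply: spec_wpl; rewrite /wpl.
      have -> : den (set_reg s rZ z) (in_B #rZ *' in_A #rZ) = hit z.
        by rewrite /hit -mulnb -(den_in_B (e := #rZ) cm2) // -(den_in_A (e := #rZ) pm2).
      rewrite bool_neq0 /Inv tE; case: (hit z) => /=; last exact: inv.
      split; first exact: X_gt0.
      move=> k; rewrite -[regs s 6]/(regs (set_reg s rZ z) rI) ei2 andbT.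
      by have := inv k; case: (k == i) => /= h; rewrite ?orbT.
    by [].
  move=> s6 F6; rewrite /Inv take_size => bad6.
  have F6' : frame frs [:: aBAD] s0 s6 by apply: frame_trans F5' _; apply: frame_sub F6 _.
  have cm6 : cut_mem i s6 by apply: cut_mem_frame cm5 F6 _.
  have [[[en6 _] _ _] ei6 eu6 ev6] := cm6.
  have badE6 : (cells s6 aBAD i != 0) = bad i || ~~ [disjoint A & B i].
    by rewrite bad6 bad5 eqxx /= badE disjoint_nbrs // negbK orbA.
  have other k : k != i -> (cells s6 aBAD k != 0) = (cells s0 aBAD k != 0).
    by move=> /negbTE ki; rewrite bad6 bad5 ki !orbF.
  have ok6 : regs s6 rOK = 0 by rewrite (frame_reg F6').
  apply: (@spec_if _ _ _ _ _ (10 + (if valid i then 300 * n.+1 else 0))).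
    rewrite /= ei6 badE6 => h; apply: (@spec_le _ _ _ 1); last lia.
    apply: spec_skip; split=> //; rewrite /found /valid.
    by move: h; case: (bad i) => //= /negbTE->.
  move=> /eqP; rewrite -[_ == 0]negbK /= ei6 badE6 => h.
  have vE : valid i = cliqueb (B i).
    by move: h; rewrite /valid; case: (bad i) => //=; case: [disjoint _ & _].
  have cE : den s6 (Cell aCAND (#rU *' #rN +' #rV)) = cliqueb (B i).
    by rewrite /= eu6 ev6 en6 (frame_cell _ F6') // cm.
  apply: (@spec_le _ _ _ (7 + (1 + (if valid i then 300 * n.+1 else 0)))); last lia.
  apply: spec_if; rewrite cE -vE ?bool_neq0 => v.
    rewrite v; apply: spec_imp.
    - apply: fill_ok cm6 _ => x; by rewrite (frame_cell _ F6').
    - lia.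
    move=> s7 F7 [fl ok7]; split; last by move=> k ki; rewrite (frame_cell _ F7) // other.
    by rewrite /found v /= ; move: ok7; case: (both_inner i) => [->|->].
  move/eqP: v; rewrite eqb0 => v.
  rewrite (negbTE v); apply: (@spec_le _ _ _ 1); last by [].
  by apply: spec_skip; split=> //; rewrite /found (negbTE v).
by rewrite /nb_cost /=; lia.
Qed.

Lemma cut_filled_2join i s : G a b -> clique G A -> 0 < i < D b ->
  (forall x, far i x = connect (heavy G a b D i) b x) ->
  valid i && both_inner i -> cut_filled i s ->
  is_2join G (output_set n s 1) (output_set n s 2) (output_set n s 3)
    (output_set n s 4) (output_set n s 5) (output_set n s 6).
Proof.
move=> Gab cA ib fE /andP[/and3P[nbad dAB /cliquebP cB]].
move=> /andP[/existsP[x /andP[x1 x2]] /existsP[y /andP[y1 y2]]].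
move=> [[-> ->] [-> ->] [-> ->]].
have QE : Q i = [set x | connect (heavy G a b D i) b x].
  by apply/setP => z; rewrite !inE fE.
rewrite QE; apply: (cut_2join lay sho ib Gab cA cB dAB).
- move=> u v Du uQ vQ duv.
  have fu : far i u by rewrite fE; move: uQ; rewrite in_set.
  have fv : ~~ far i v by rewrite fE; move: vQ; rewrite in_set.
  apply/andP/negPn; apply: contra nbad => h.
  by apply/existsP; exists u; apply/existsP; exists v; rewrite /violation Du eqxx fu fv duv h.
- by exists y; rewrite // inE -fE.
by exists x; rewrite // inE -fE.
Qed.

(** A valid cut in the middle is accepted and ends the search, so a costly fill fails only near the
    ends of the path. *)
Lemma valid_middle i : 2 < i -> i.+2 < D b ->
  (forall x, far i x = connect (heavy G a b D i) b x) -> valid i -> both_inner i.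
Proof.
move=> i2 ib fE /and3P[_ dAB _]; have ib' : 0 < i < D b by lia.
have [y y1 y2] := heavy_interior lay sho ib' ib dAB.
have [x x1 x2] := light_interior lay sho ib' i2 dAB.
apply/andP; split; apply/existsP; [exists x|exists y]; rewrite fE.
  by move: x1; rewrite inE => ->.
by move: y1; rewrite inE => ->.
Qed.

(* If the cut number [t + 1] is valid, one of its sides may lack an inner vertex. *)
Definition near_end (N t : nat) : bool := (t < 2) || (N <= t + 2).

Lemma sum_near_end N : \sum_(t < N) near_end N t <= 4.
Proof.
have h1 M : \sum_(t < M) (t < 2 : nat) = minn M 2.
  elim: M => [|M IH]; first by rewrite big_ord0.
  by rewrite big_ord_recr /= IH; case: (ltnP M 2); lia.
have h2 K' M : \sum_(t < M) (K' <= t + 2 : nat) = M - (K' - 2).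
  elim: M => [|M IH]; first by rewrite big_ord0 sub0n.
  by rewrite big_ord_recr /= IH; case: (leqP K' (M + 2)); lia.
apply: leq_trans (_ : \sum_(t < N) ((t < 2 : nat) + (N <= t + 2 : nat)) <= _).
  by apply: leq_sum => t _; rewrite /near_end; case: (t < 2); case: (N <= t + 2).
rewrite big_split /= h1 h2; lia.
Qed.

Lemma check_cuts_ok s0 : G a b -> clique G A ->
  (forall i x, 0 < i < D b -> far i x = connect (heavy G a b D i) b x) ->
  pair_mem s0 -> path_mem p s0 -> key_mem s0 -> cand_mem s0 ->
  (forall i, 0 < i < D b -> (cells s0 aBAD i != 0) = bad i) -> regs s0 rOK = 0 ->
  spec X check_cuts s0 (2000 * (n.+1 * dl.+1)) (fun s =>
    (regs s rOK = 1 /\ is_2join G (output_set n s 1) (output_set n s 2)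
       (output_set n s 3) (output_set n s 4) (output_set n s 5) (output_set n s 6)) \/
    (regs s rOK = 0 /\ forall i, 0 < i < D b -> ~~ (valid i && both_inner i))).
Proof.
move=> Gab cA fE pm [eL pP] km cm badE ok0.
pose fc := 300 * n.+1; pose base := dl * nb_cost 100 + 210.
pose N := D b - 1.
pose frs := [:: rT; rI; rU; rV; rY; rK; rZ; rOK; rX; 18; 19; 20; 21; 22].
pose fas := [:: aBAD; 1; 2; 3; 4; 5; 6].
pose correct s := is_2join G (output_set n s 1) (output_set n s 2)
       (output_set n s 3) (output_set n s 4) (output_set n s 5) (output_set n s 6).
pose Inv t (s : state) := (forall i, t < i < D b -> (cells s aBAD i != 0) = bad i) /\
   ((regs s rOK = 1 /\ correct s) \/
    (regs s rOK = 0 /\ forall i, 0 < i <= t -> ~~ (valid i && both_inner i))).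
pose T t := base + near_end N t * fc.
(* Prepays the one successful fill, after which the remaining iterations do nothing. *)
pose pot s := if regs s rOK == 0 then fc else 0.
have DbX : N <= X.
  by have := shortest_bound sho; have := nX; rewrite /N; lia.
apply: spec_le.
  apply: spec_imp.
  - apply: (spec_for_pot (N := N) (T := T) (pot := pot) (Inv := Inv)) => //.
    + by move=> s F /=; rewrite (frame_reg F) //= eL.
    + move=> t s tN F et [bE [[ok1 cor]|[ok1 none]]].
        exists 3; apply: (@spec_if _ _ _ _ _ 1); rewrite /= ok1 // => _.
        apply: spec_skip; split; last by rewrite /pot /= ok1 /T /base; lia.
        by split=> [i ib|]; [apply: bE; lia|left].
      have Fs : frame frs fas s0 s by apply: frame_sub F _.
      have tb : t.+1 < D b by rewrite /N in tN; lia.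
      have ib : 0 < t.+1 < D b by lia.
      have bt : (cells s aBAD t.+1 != 0) = bad t.+1 by apply: bE; lia.
      exists (2 + (dl * nb_cost 100 + 200 + (if valid t.+1 then fc else 0))).
      apply: spec_if; rewrite /= ok1 // => _.
      apply: spec_imp.
      * apply: (check_cut_ok _ _ _ _ et tb bt ok1).
        - exact: pair_mem_frame pm Fs _.
        - split; first by rewrite (frame_reg Fs).
          by move=> i h; rewrite (frame_cell _ Fs) // pP.
        - by move=> x; rewrite (frame_cell _ Fs).
        - by move=> x y Gxy; rewrite (frame_cell _ Fs) // cm.
      * exact: leqnn.
      move=> s' F' [fd other].
      have bE' i : t.+1 < i < D b -> (cells s' aBAD i != 0) = bad i.
        by move=> h; rewrite other; [apply: bE; lia|apply/eqP; lia].
      rewrite /found in fd; case good : (valid t.+1 && both_inner t.+1) in fd.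
        case: fd => fl ok'; split.
          split; first exact: bE'.
          left; split; first exact: ok'.
          have := cut_filled_2join Gab cA ib (fun x => fE _ x ib) good fl; exact.
        rewrite /pot /= ok' ok1 /T /base; move: (near_end N t * fc) (dl * _) => q1 q2.
        by case: (valid _) => /=; lia.
      split.
        split; first exact: bE'.
        right; split; first exact: fd.
        move=> i /andP[i0]; rewrite leq_eqVlt => /orP[/eqP->|it]; first by rewrite good.
        by apply: none; rewrite i0.
      rewrite /pot /= fd ok1 /T /base /=; move: (dl * _) => q2; case v : (valid _); last first.
        by move: (near_end N t * fc) => q1; lia.
      (* The fill was paid for but failed, which [valid_middle] excludes away from both ends. *)
      have -> : near_end N t = true; last by rewrite mul1n; lia.
      apply/negPn/negP; rewrite negb_or => /andP[t2 tN2].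
      rewrite /N in tN2; have i2 : 2 < t.+1 by lia.
      have i3 : t.+3 < D b by lia.
      by rewrite v (valid_middle i2 i3 (fun x => fE _ x ib) v) in good.
    + split=> [i ib|]; first by apply: badE.
      by right; split=> // i; lia.
  - exact: leqnn.
  move=> s F [_ [h|[ok none]]]; first by left.
  right; split=> // i ib; apply: none; rewrite /N; lia.
have -> : \sum_(i < N) (T i + for_cost (#rL -' $1)) =
    N * (base + for_cost (#rL -' $1)) + (\sum_(i < N) near_end N i) * fc.
  rewrite big_distrl /= (eq_bigr (fun i : 'I_N => base + for_cost (#rL -' $1) + near_end N i * fc)).
    by rewrite big_split /= sum_nat_const card_ord.
  by move=> i _; rewrite /T addnAC.
have Nn : N <= n by have := shortest_bound sho; rewrite /N; lia.
have := sum_near_end N; move: (\sum_(i < N) _) => q q4.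
have p1 : N * (base + for_cost (#rL -' $1)) <= n * (base + for_cost (#rL -' $1)).
  by rewrite leq_mul2r Nn orbT.
have p2 : q * fc <= 4 * fc by rewrite leq_mul2r q4 orbT.
rewrite /pot /= ok0 /= /fc /base /for_cost /nb_cost /= in p1 p2 *.
by move: (N * _) (q * _) p1 p2 => r1 r2; nia.
Qed.

End WithPath.
End WithLayers.
End Phases.

(** * One pair of end vertices *)

Definition bfs_step : expr := #rW +' $1.
(* [u + (v - u)] is the maximum of [u] and [v]. *)
Definition heavy_step : expr :=
  #rW +' ($2 *' #rN +' $2 -' (Cell aD #rY +' Cell aD #rZ) -' #rW).

Definition solve_pair : cmd :=
  rS <<- #rA ;;;
  search removed_edge bfs_step ;;;
  For rX #rN (aD @@ #rX <<- Cell aKEY #rX) ;;;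
  If (Cell aD #rB)
    (find_path ;;;
     rS <<- #rB ;;;
     search removed_edge heavy_step ;;;
     mark_bad ;;;
     check_cuts)
    Skip.

Definition pair_cost : nat :=
  search_cost removed_edge bfs_step + search_cost removed_edge heavy_step + 4900.

Section Pair.
Variables (n : nat) (G : sgraph 'I_n) (nbrs : 'I_n -> seq 'I_n) (X dl : nat).
Hypothesis adjl : adjacency_lists G nbrs.
Hypothesis XH : 4 * (n + 2) * (n + 2) <= X.
Hypothesis dlE : dl = max_degree G.
Variables (a b : 'I_n).
Local Notation nb := (nat_nbrs nbrs).
Local Notation A := (cap2 G a b).

Lemma search_pair_ok s0 (src : 'I_n) f F :
  pair_mem nbrs a b s0 -> regs s0 rS = src ->
  (forall w y z, w <= f w y z) -> (forall w y z, f w y z <= maxn w.+1 (2 * n + 2)) ->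
  (forall s, frame search_rs search_as s0 s ->
     den s F = f (regs s rW) (regs s rY) (regs s rZ)) ->
  spec X (search removed_edge F) s0 (search_cost removed_edge F * (n.+1 * dl.+1))
    (fun s => search_post n nb src f (kept nbrs a b) (cells s)).
Proof.
move=> pm eS f1 f2 hF; have [gm _ _] := pm.
apply: (search_ok (ltn_ord src) XH _ _ _ f1 f2 _ _ gm eS).
- by move=> x z; apply: nat_nbrs_lt.
- by move=> x xn; apply: (size_nat_nbrs_n adjl).
- by move=> x xn; rewrite dlE; apply: (size_nat_nbrs_max adjl).
- move=> s F' yn zn.
  rewrite (den_removed adjl (y := Ordinal yn) (z := Ordinal zn) (pair_mem_frame pm F' _)) //.
  by rewrite bool_neq0 /kept negbK -!(nat_capE adjl).
by move=> s F' _ _; apply: hF.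
Qed.

Definition correct_sets (s : state) : Prop :=
  is_2join G (output_set n s 1) (output_set n s 2) (output_set n s 3)
    (output_set n s 4) (output_set n s 5) (output_set n s 6).

Lemma solve_pair_ok s0 : pair_mem nbrs a b s0 -> cand_mem G s0 -> regs s0 rOK = 0 ->
  G a b -> clique G A ->
  spec X solve_pair s0 (pair_cost * (n.+1 * dl.+1)) (fun s =>
    (regs s rOK = 1 /\ correct_sets s) \/ (regs s rOK = 0 /\ ~ seed G a b)).
Proof.
move=> pm cm ok0 Gab cA; have [gm ea eb] := pm; have [en _] := gm.
have nX : n <= X by nia.
have aX : a <= X by have := ltn_ord a; lia.
have bX : b <= X by have := ltn_ord b; lia.
have kX : 3 * n + 2 <= X by nia.
pose frs := [:: rS; rX; rW; rY; rK; rZ; rF]; pose fas := [:: aKEY; aCNT; aSTK; aD].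
pose s1 := set_reg s0 rS a.
have F1 : frame frs fas s0 s1 by apply: frame_set_reg.
apply: spec_le.
  apply: spec_seq.
    by apply: spec_wpl => /=; rewrite ea; split; [|exact: (erefl s1)].
  move=> _ _ <-; apply: spec_seq.
    apply: (search_pair_ok (src := a) (f := bfs_next) (pair_mem_frame pm F1 isT)) => //.
    - by move=> w y z; rewrite /bfs_next leq_max leqnn.
    by move=> s F' /=; rewrite addn1.
  move=> s2 Fr2 post2; have F2 : frame frs fas s0 s2.
    by apply: frame_trans F1 _; apply: frame_sub Fr2 _.
  pose D (x : 'I_n) := cells s2 aKEY x.
  have lay : layering G a b D by apply: (bfs_layering adjl post2).
  have D_bound x : D x <= 3 * n + 2 by have [_ _ h _] := post2; apply: h.
  apply: spec_seq.
    apply: (spec_fill (N := n) (g := fun x => cells s2 aKEY x)) => //.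
      by move=> s F /=; rewrite (frame_reg F) // (frame_reg F2).
    move=> s i F lt ei /=; rewrite ei (frame_cell _ F) //; split=> //.
    by apply: leq_trans (D_bound (Ordinal lt)) kX.
  move=> s3 Fr3 D3; have F3 : frame frs fas s0 s3.
    by apply: frame_trans F2 _; apply: frame_sub Fr3 _.
  have lm3 : layer_mem D s3 by move=> x; rewrite D3.
  have pm3 := pair_mem_frame pm F3 isT.
  have eb3 : regs s3 rB = b by case: pm3.
  apply: (@spec_if _ _ _ _ _ ((search_cost removed_edge heavy_step + 4500) * (n.+1 * dl.+1))) => /=;
      rewrite eb3 D3 // -/(D b) => Db; last first.
    apply: (@spec_le _ _ _ 1); last by rewrite muln_gt0 addn_gt0 orbT.
    apply: spec_skip; right; split; first by rewrite (frame_reg F3).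
    (* [b] is unreachable once the edges inside [A] are deleted, which a seed excludes. *)
    move=> sd; have [_ _ cab] := seed_edge sd.
    by have := layering_reach lay cab; rewrite Db.
  have D0 : 0 < D b by rewrite lt0n.
  apply: (@spec_le _ _ _ (1000 * (n.+1 * dl.+1) + (2 +
     (search_cost removed_edge heavy_step * (n.+1 * dl.+1) + (1000 * (n.+1 * dl.+1) +
      2000 * (n.+1 * dl.+1)))))); last first.
    have : 0 < n.+1 * dl.+1 by [].
    by rewrite mulnDl; move: (n.+1 * dl.+1) => q q0; move: (search_cost _ _ * q) => r; lia.
  apply: spec_seq.
    exact: (find_path_ok adjl XH dlE lay D_bound pm3 lm3 D0).
  move=> s4 Fr4 [p sho pP4].
  pose frs' := frs ++ [:: rL; rT]; pose fas' := aP :: fas.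
  have F4 : frame frs' fas' s0 s4.
    by apply: frame_trans (frame_sub F3 _) _ => //; apply: frame_sub Fr4 _.
  pose s5 := set_reg s4 rS b.
  have F5 : frame frs' fas' s0 s5 by apply: frame_trans F4 _; apply: frame_set_reg.
  have eb4 : regs s4 rB = b by rewrite (frame_reg F4).
  have lm5 : layer_mem D s5 by move=> x; rewrite /= (frame_cell _ Fr4).
  have en5 : regs s5 rN = n by rewrite (frame_reg F5).
  apply: spec_seq.
    by apply: spec_wpl => /=; rewrite eb4; split; [|exact: (erefl s5)].
  move=> _ _ <-; apply: spec_seq.
    apply: (search_pair_ok (src := b) (f := heavy_next n (fun x => cells s5 aD x)) (pair_mem_frame pm F5 isT)) => //.
    - by move=> w y z; rewrite /heavy_next leq_maxl.
    - by move=> w y z; rewrite /heavy_next; lia.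
    by move=> s F' /=; rewrite (frame_reg (r := rN) F') // en5 !(frame_cell (a := aD) _ F') // /heavy_next maxnE.
  move=> s6 Fr6 post6; have F6 : frame frs' fas' s0 s6.
    by apply: frame_trans F5 _; apply: frame_sub Fr6 _.
  pose K (x : 'I_n) := cells s6 aKEY x.
  have K_bound x : K x <= 3 * n + 2 by have [_ _ h _] := post6; apply: h.
  have pm6 := pair_mem_frame pm F6 isT.
  have lm6 : layer_mem D s6 by move=> x; rewrite (frame_cell _ Fr6).
  have km6 : key_mem K s6 by [].
  have pP6 : path_mem b D p s6.
    case: pP4 => eL eP; split; first by rewrite (frame_reg Fr6).
    by move=> i /eP; rewrite (frame_cell _ Fr6).
  have fE i (x : 'I_n) : 0 < i < D b -> far K i x = connect (heavy G a b D i) b x.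
    by move=> ib; apply: (heavy_keys adjl lm5 _ ib (shortest_bound sho) post6).
  apply: spec_seq.
    exact: (mark_bad_ok adjl XH dlE D_bound sho pm6 lm6 km6 pP6).
  move=> s7 Fr7 bad7.
  pose frs7 := frs' ++ [:: rI; rU; rV]; pose fas7 := aBAD :: fas'.
  have F7 : frame frs7 fas7 s0 s7.
    by apply: frame_trans (frame_sub F6 _) _ => //; apply: frame_sub Fr7 _.
  have pm7 := pair_mem_frame pm F7 isT.
  apply: spec_imp.
  - apply: (check_cuts_ok adjl XH dlE lay sho Gab cA fE pm7 _ _ _ bad7).
    + case: pP6 => eL eP; split; first by rewrite (frame_reg Fr7).
      by move=> i /eP; rewrite (frame_cell _ Fr7).
    + by move=> x; rewrite (frame_cell _ Fr7) // km6.
    + by move=> x y Gxy; rewrite (frame_cell _ F7) // cm.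
    by rewrite (frame_reg F7).
  - exact: leqnn.
  move=> s8 _ [h|[ok8 none]]; first by left.
  right; split=> // sd.
  have [i [ib cB dAB sep [[x x1 x2] [y y1 y2]]]] := seed_cut sd lay sho.
  case/negP: (none i ib); apply/andP; split.
    apply/and3P; split=> //; last exact/cliquebP.
    apply/negP => /existsP[u /existsP[v /and5P[/eqP Du fu fv duv]]].
    case/negP; apply/andP; apply: sep Du _ _ duv.
      by rewrite in_set -fE.
    by rewrite in_set -fE.
  apply/andP; split; apply/existsP; by [exists y; rewrite fE // y1|exists x; rewrite fE // x1].
rewrite /for_cost /pair_cost.
move: (search_cost _ bfs_step) (search_cost _ heavy_step) => c1 c2 /=; nia.
Qed.

End Pair.

(** * All pairs *)

Definition solve_all : cmd :=
  For rA #rN (ForNb rA rJ rB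
    (If #rOK Skip
      (If (Cell aCAND (#rA *' #rN +' #rB)) solve_pair Skip))).

Definition all_adjacent : cmd :=
  If (Cell aCL (#rB *' #rN +' #rY) *' Cell aCL (#rB *' #rN +' #rZ))
    (If (Cell aCL (#rY *' #rN +' #rZ)) Skip (rI <<- $0)) Skip.

(** Tabulates for each edge whether its common closed neighborhood is a clique. Testing all pairs of
    neighbors of one end is quadratic in the maximum degree, which is within the budget of one
    edge. *)
Definition mark_cliques : cmd :=
  For rA #rN (ForNb rA rJ rB
    (rI <<- $1 ;;;
     ForNb rA rK rY (ForNb rA rX rZ all_adjacent) ;;;
     aCAND @@ #rA *' #rN +' #rB <<- #rI)).

(** Double counting: ordered adjacent pairs are grouped by their underlying edge, and each group
    lies in the two orientations of one of its members. *)
Lemma sum_degree (T : finType) (G : sgraph T) :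
  \sum_(x : T) degree G x <= 2 * nb_edges G.
Proof.
pose P := [set u : T * T | G u.1 u.2]; pose h (u : T * T) := [set u.1; u.2].
have -> : \sum_(x : T) degree G x = #|P|.
  rewrite -sum1_card (eq_bigl (fun u : T * T => G u.1 u.2)); last by move=> u; rewrite inE.
  rewrite -(pair_big_dep xpredT (fun x y => G x y) (fun _ _ => 1)) /=.
  by apply: eq_bigr => x _; rewrite /degree sum1dep_card.
rewrite -sum1_card (partition_big h [in edge_set G]) /=; last first.
  move=> [x y]; rewrite !inE /= => xy; apply/existsP; exists x; apply/existsP; exists y.
  by rewrite xy eqxx.
rewrite mulnC /nb_edges -sum_nat_const; apply: leq_sum => E _.
rewrite sum1_card; have [/existsP[u /andP[_ /eqP hu]]|no] := boolP [exists u, (u \in P) && (h u == E)].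
  apply: (@leq_trans #|[set u; (u.2, u.1)]|); last by rewrite cards2; case: eqP.
  apply: subset_leq_card; apply/subsetP => -[x y] /andP[xyP /eqP hE].
  have {xyP} xy : G x y by move: xyP; rewrite /P inE.
  case: u hu => x' y' hu; rewrite -hu in hE; move/setP: hE => hE.
  have := hE x; have := hE y; rewrite /h !inE /= !eqxx /= ?orbT !xpair_eqE.
  have nxy : x != y by apply/eqP => e; rewrite e (adj_irr G y) in xy.
  case: (eqVneq x x') => [ex|_]; case: (eqVneq x y') => [ey|_];
    case: (eqVneq y x') => [fx|_]; case: (eqVneq y y') => [fy|_] => //= *;
    by case/eqP: nxy; congruence.
rewrite eq_card0 // => u; apply/negP => hu; case/negP: no.
by apply/existsP; exists u.
Qed.

Lemma sum_degree_cost n (G : sgraph 'I_n) (deg : nat -> nat) (c : nat) :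
  (forall x : 'I_n, deg x = degree G x) ->
  \sum_(i < n) (deg i * c + 14 + for_cost #rN) + for_cost #rN <=
  2 * nb_edges G * c + n * 30 + 20.
Proof.
move=> degE; rewrite (eq_bigr (fun i : 'I_n => degree G i * c + (14 + for_cost #rN))).
  rewrite big_split /= sum_nat_const card_ord -big_distrl /=.
  have := leq_mul (sum_degree G) (leqnn c).
  by move: (_ * c) (_ * c) => q1 q2; rewrite /for_cost /=; lia.
by move=> i _; rewrite degE addnA.
Qed.

Section Outer.
Variables (n : nat) (G : sgraph 'I_n) (nbrs : 'I_n -> seq 'I_n) (X dl : nat).
Hypothesis adjl : adjacency_lists G nbrs.
Hypothesis XH : 4 * (n + 2) * (n + 2) <= X.
Hypothesis dlE : dl = max_degree G.
Local Notation nb := (nat_nbrs nbrs).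

Let nX : n <= X. Proof. by move: XH; clear; nia. Qed.

Definition answer (s : state) : Prop :=
  (regs s rOK = 1 /\ correct_sets G s) \/ (regs s rOK = 0 /\ ~ has_2join G).

Lemma solve_all_ok s0 : connected G -> ~ has_1join G ->
  graph_mem n nb s0 -> cand_mem G s0 -> regs s0 rOK = 0 ->
  spec X solve_all s0
    (2 * nb_edges G * nb_cost (pair_cost * (n.+1 * dl.+1) + 10) + n * 30 + 20) answer.
Proof.
move=> conn no1 gm cm ok0; have [en _] := gm.
pose Tp := pair_cost * (n.+1 * dl.+1) + 10.
pose Inv k (s : state) := (regs s rOK = 1 /\ correct_sets G s) \/
  (regs s rOK = 0 /\ forall x y : 'I_n, x < k -> G x y -> ~ seed G x y).
pose deg k := if insub k is Some x then degree G (x : 'I_n) else 0.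
have degE (x : 'I_n) : deg x = degree G x by rewrite /deg valK.
apply: spec_imp.
- apply: (spec_for (N := n) (T := fun k => deg k * nb_cost Tp + 14) (Inv := Inv)) => //.
  + by move=> s F /=; rewrite (frame_reg F).
  + move=> k s kn F ek inv.
    pose x := Ordinal kn; have ex : regs s rA = x by [].
    have gms := graph_mem_frame gm F isT.
    pose Inv2 j (s : state) := (regs s rOK = 1 /\ correct_sets G s) \/
      (regs s rOK = 0 /\ (forall u v : 'I_n, u < k -> G u v -> ~ seed G u v) /\
       forall y, y \in take j (nbrs x) -> ~ seed G x y).
    rewrite (degE x); apply: spec_imp.
    * apply: (spec_nbrs_size adjl XH (T := Tp) (Inv := Inv2) gms ex) => //; last first.
        case: inv => [h|[ok none]]; [by left|right; split=> //; split=> // y].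
        by rewrite take0.
      move=> j y s1 jx yx jy F1 ej inv1.
      have Gxy : G x y by move: yx; have [_ ->] := adjl x; rewrite inE.
      pose s2 := set_reg s1 rB y.
      have F2 : cframe solve_all s0 s2.
        apply: frame_trans F _; apply: (@frame_trans _ _ _ s1).
          by apply: frame_sub F1 _.
        exact: frame_set_reg.
      have gm2 : graph_mem n nb s2 by apply: graph_mem_frame gm F2 _.
      have en2 : regs s2 rN = n by case: gm2.
      have ex2 : regs s2 rA = x by rewrite /= (frame_reg F1).
      have takeS z : z \in take j.+1 (nbrs x) -> z \in take j (nbrs x) \/ z = y.
        by rewrite (take_nth x) // mem_rcons inE jy => /orP[/eqP->|->]; [right|left].
      case: inv1 => [[ok1 cor]|[ok1 [none1 none2]]].
        apply: (@spec_le _ _ _ (2 + 1)); last by rewrite /Tp; lia.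
        by apply: spec_if; rewrite /= ok1 // => _; apply: spec_skip; left.
      have pm2 : pair_mem nbrs x y s2 by split.
      have cE : den s2 (Cell aCAND (#rA *' #rN +' #rB)) = cliqueb G (cap2 G x y).
        have eB : regs s2 rB = y by [].
        by rewrite /den -/den /apply_binop en2 ex2 eB (frame_cell _ F2) // cm.
      apply: (@spec_le _ _ _ (2 + (7 + (pair_cost * (n.+1 * dl.+1) + 1)))); last by rewrite /Tp; lia.
      apply: spec_if; rewrite ?[den _ #rOK]/= ?ok1 // => _.
      apply: spec_if; rewrite cE ?bool_neq0 => cl.
        apply: spec_imp.
        - have cm2 : cand_mem G s2 by move=> u v Guv; rewrite (frame_cell _ F2) // cm.
          by apply: (solve_pair_ok adjl XH dlE pm2 cm2 ok1 Gxy); apply/cliquebP.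
        - exact: leq_addr.
        move=> s3 F3 [h|[ok3 ns]]; first by left.
        right; split=> //; split=> // z /takeS[|->//]; exact: none2.
      apply: (@spec_le _ _ _ 1); last exact: leq_addl.
      apply: spec_skip; right; split=> //; split=> // z /takeS[|->]; first exact: none2.
      by move=> /seed_edge[_ /cliquebP cl' _]; rewrite cl' in cl.
    * exact: leqnn.
    move=> s' F' [h|[ok [none1 none2]]]; first by left.
    right; split=> // u v; rewrite ltnS leq_eqVlt => /orP[/eqP uk|]; last exact: none1.
    have -> : u = x by apply: val_inj.
    move=> Gxv; apply: none2; rewrite take_size; have [_ ->] := adjl x; by rewrite inE.
  by right; split.
- exact: sum_degree_cost degE.
move=> s F [h|[ok none]]; [by left|right; split=> // j].
by have [x [y sd]] := seed_exists conn no1 j; have [Gxy _ _] := seed_edge sd; apply: none Gxy sd.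
Qed.

Lemma max_degree_le : max_degree G <= n.
Proof.
apply/bigmax_leqP => x _; rewrite /degree -[X in _ <= X]card_ord; exact: max_card.
Qed.

(** Every vertex of [cap2 G x y] other than [x] is a neighbor of [x], so pairs involving [x] are
    settled and the test runs over neighbors of [x] only. *)
Lemma cliqueb_cap2 (x y : 'I_n) : G x y -> cliqueb G (cap2 G x y) =
  all (fun u => all (fun v => cladj G y u && cladj G y v ==> cladj G u v) (nbrs x)) (nbrs x).
Proof.
move=> Gxy; apply/cliquebP/allP => [c u ux|h u v].
  apply/allP => v vx; apply/implyP => /andP[yu yv].
  have nbE z : z \in nbrs x -> cladj G x z.
    by have [_ ->] := adjl x; rewrite inE /cladj => ->; rewrite orbT.
  by apply: clique_cladj c _ _; rewrite inE nbE.
have inN z : cladj G x z -> z != x -> z \in nbrs x.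
  rewrite /cladj; have [_ ->] := adjl x; rewrite inE eq_sym => /orP[->//|//].
rewrite !inE => /andP[xu yu] /andP[xv yv] ne.
have [ux|ux] := eqVneq u x.
  by move: xv; rewrite /cladj -ux (negbTE ne).
have [vx|vx] := eqVneq v x.
  by move: xu; rewrite /cladj -vx eq_sym (negbTE ne) adj_sym.
have /allP/(_ v (inN v xv vx)) := h u (inN u xu ux).
by rewrite yu yv /= /cladj (negbTE ne).
Qed.

Lemma all_adjacent_ok s (x y u : 'I_n) (c0 : bool) :
  graph_mem n nb s -> regs s rA = x -> regs s rB = y -> regs s rY = u -> regs s rI = c0 ->
  spec X (ForNb rA rX rZ all_adjacent) s (dl * nb_cost 40 + 14) (fun s' =>
    regs s' rI = c0 &&
      all (fun v => cladj G y u && cladj G y v ==> cladj G u v) (nbrs x)).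
Proof.
move=> gm ex ey eu ec.
pose P v := cladj G y u && cladj G y v ==> cladj G u v.
pose Inv j (s' : state) := regs s' rI = c0 && all P (take j (nbrs x)).
apply: spec_imp.
- apply: (spec_nbrs adjl XH dlE (T := 40) (Inv := Inv) gm ex) => //; last first.
    by rewrite /Inv take0 andbT.
  move=> j v s1 jx vx jv F ej inv.
  have F2 : frame [:: rX; rZ; rI] [::] s (set_reg s1 rZ v).
    by apply: (@frame_trans _ _ _ s1); [apply: frame_sub F _|apply: frame_set_reg].
  have [en2 gm2] := graph_mem_frame gm F2 isT.
  have ey2 : regs (set_reg s1 rZ v) rB = y by rewrite (frame_reg F2).
  have eu2 : regs (set_reg s1 rZ v) rY = u by rewrite (frame_reg F2).
  have clE (e1 e2 : expr) (z t : 'I_n) : den (set_reg s1 rZ v) e1 = z ->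
      den (set_reg s1 rZ v) e2 = t ->
      den (set_reg s1 rZ v) (Cell aCL (e1 *' #rN +' e2)) = cladj G z t.
    move=> E1 E2; rewrite [LHS]/= E1 E2 -[regs s1 1]/(regs (set_reg s1 rZ v) rN) en2.
    by have [_ _ ->] := gm2 z (ltn_ord z); rewrite ?(closed_nat_nbrs adjl).
  have tE : all P (take j.+1 (nbrs x)) = all P (take j (nbrs x)) && P v.
    by rewrite (take_nth x) // all_rcons jv andbC.
  apply: spec_le; first apply: spec_wpl; rewrite /all_adjacent /wpl.
    have -> : den (set_reg s1 rZ v)
        (Cell aCL (#rB *' #rN +' #rY) *' Cell aCL (#rB *' #rN +' #rZ)) =
        cladj G y u && cladj G y v.
      by rewrite -mulnb -(clE #rB #rY _ _ ey2 eu2) -(clE #rB #rZ _ _ ey2 erefl).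
    rewrite (clE #rY #rZ _ _ eu2 erefl) !bool_neq0 /Inv tE /P.
    case: (cladj G y u && cladj G y v) => /=; last by rewrite andbT.
    case: (cladj G u v) => /=; first by rewrite andbT.
    by rewrite !andbF.
  by [].
- exact: leqnn.
by move=> s' F; rewrite /Inv take_size.
Qed.

Lemma clique_test_ok s (x y : 'I_n) : graph_mem n nb s -> regs s rA = x ->
  regs s rB = y -> G x y -> regs s rI = 1 ->
  spec X (ForNb rA rK rY (ForNb rA rX rZ all_adjacent)) s
    (dl * nb_cost (dl * nb_cost 40 + 14) + 14)
    (fun s' => regs s' rI = cliqueb G (cap2 G x y)).
Proof.
move=> gm ex ey Gxy ei.
pose P u := all (fun v => cladj G y u && cladj G y v ==> cladj G u v) (nbrs x).
pose Inv j (s' : state) := regs s' rI = all P (take j (nbrs x)).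
apply: spec_imp.
- apply: (spec_nbrs adjl XH dlE (Inv := Inv) gm ex) => //; last first.
    by rewrite /Inv take0.
  move=> j u s1 jx ux ju F ej inv.
  pose frs := [:: rK; rY; rX; rZ; rI].
  have F2 : frame frs [::] s (set_reg s1 rY u).
    by apply: (@frame_trans _ _ _ s1); [apply: frame_sub F _|apply: frame_set_reg].
  have tE : all P (take j.+1 (nbrs x)) = all P (take j (nbrs x)) && P u.
    by rewrite (take_nth x) // all_rcons ju andbC.
  apply: spec_imp.
  + apply: (all_adjacent_ok (x := x) (y := y) (u := u) (graph_mem_frame gm F2 isT) _ _ _ inv) => //.
      by rewrite (frame_reg F2).
    by rewrite (frame_reg F2).
  + exact: leqnn.
  by move=> s' _; rewrite /Inv tE.
- exact: leqnn.
by move=> s' F; rewrite /Inv take_size cliqueb_cap2.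
Qed.

Lemma mark_cliques_ok s0 : graph_mem n nb s0 ->
  spec X mark_cliques s0
    (2 * nb_edges G * nb_cost (200 * (n.+1 * dl.+1)) + n * 30 + 20) (cand_mem G).
Proof.
move=> gm; have [en _] := gm.
pose Tp := 200 * (n.+1 * dl.+1).
pose ok (s : state) (x y : 'I_n) := cells s aCAND (x * n + y) = cliqueb G (cap2 G x y).
pose Inv k (s : state) := forall x y : 'I_n, x < k -> G x y -> ok s x y.
pose deg k := if insub k is Some x then degree G (x : 'I_n) else 0.
have degE (x : 'I_n) : deg x = degree G x by rewrite /deg valK.
apply: spec_imp.
- apply: (spec_for (N := n) (T := fun k => deg k * nb_cost Tp + 14) (Inv := Inv)) => //.
  + by move=> s F /=; rewrite (frame_reg F).
  + move=> k s kn F ek inv.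
    pose x := Ordinal kn; have ex : regs s rA = x by [].
    have gms := graph_mem_frame gm F isT.
    pose Inv2 j (s : state) := (forall u v : 'I_n, u < k -> G u v -> ok s u v) /\
       forall y, y \in take j (nbrs x) -> ok s x y.
    rewrite (degE x); apply: spec_imp.
    * apply: (spec_nbrs_size adjl XH (T := Tp) (Inv := Inv2) gms ex) => //; last first.
        by split=> // y; rewrite take0.
      move=> j y s1 jx yx jy F1 ej [inv1 inv2].
      have Gxy : G x y by move: yx; have [_ ->] := adjl x; rewrite inE.
      pose s2 := set_reg s1 rB y; pose s3 := set_reg s2 rI 1.
      have F3 : cframe mark_cliques s0 s3.
        apply: frame_trans F _; apply: (@frame_trans _ _ _ s1).
          by apply: frame_sub F1 _.
        by apply: (@frame_trans _ _ _ s2); apply: frame_set_reg.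
      have gm3 : graph_mem n nb s3 by apply: graph_mem_frame gm F3 _.
      have ex3 : regs s3 rA = x by rewrite /= (frame_reg F1).
      have takeS z : z \in take j.+1 (nbrs x) -> z \in take j (nbrs x) \/ z = y.
        by rewrite (take_nth x) // mem_rcons inE jy => /orP[/eqP->|->]; [right|left].
      apply: (@spec_le _ _ _ (2 + (dl * nb_cost (dl * nb_cost 40 + 14) + 14 + 7))); last first.
        (* The square of the maximum degree is at most [n] times the maximum degree. *)
        have := max_degree_le; rewrite -dlE /Tp /nb_cost => dn.
        have := leq_mul (leqnn dl) dn; nia.
      apply: spec_seq.
        by apply: spec_wpl => /=; split; [nia|exact: (erefl s3)].
      move=> _ _ <-; apply: spec_seq.
        exact: (clique_test_ok gm3 ex3 erefl Gxy erefl).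
      move=> s4 F4 ei4.
      have [en4 _] := graph_mem_frame gm3 F4 isT.
      have ex4 : regs s4 rA = x by rewrite (frame_reg F4).
      have ey4 : regs s4 rB = y by rewrite (frame_reg F4).
      apply: spec_wpl => /=; rewrite ei4 ex4 ey4 en4.
      split; first by apply: leq_trans (leq_b1 _) _; nia.
      have okS u v : (u = x /\ v = y) \/ ok s1 u v ->
         ok (set_reg (set_cell s4 aCAND (x * n + y) (cliqueb G (cap2 G x y))) rJ j.+1) u v.
        rewrite /ok /= pair_index_inj ?ltn_ord // !(inj_eq val_inj).
        have [->|ne] := eqVneq u x; last first.
          have -> : (nat_of_ord u == k) = false by rewrite -[k]/(val x) val_eqE (negbTE ne).
          by case=> [[e _]|h]; [rewrite e eqxx in ne | rewrite /= (frame_cell _ F4)].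
        have [->|ne] := eqVneq v y; first by rewrite /= !eqxx.
        by rewrite andbF; case=> [[_ e]|h]; [rewrite e eqxx in ne | rewrite (frame_cell _ F4)].
      split=> [u v uk Guv|z /takeS[zt|->]]; apply: okS.
      - by right; apply: inv1.
      - by right; apply: inv2.
      by left.
    * exact: leqnn.
    move=> s' F' [inv1 inv2] u v; rewrite ltnS leq_eqVlt => /orP[/eqP uk|]; last exact: inv1.
    have -> : u = x by apply: val_inj.
    by move=> Gxv; apply: inv2; rewrite take_size; have [_ ->] := adjl x; rewrite inE.
- exact: sum_degree_cost degE.
by move=> s F inv x y; apply: inv.
Qed.

End Outer.

(** * Reading the input *)

Definition read_neighbor : cmd :=
  rB <<- Cell 0 #rT ;;;
  aNB @@ #rA *' #rN +' #rJ <<- #rB ;;;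
  aCL @@ #rA *' #rN +' #rB <<- $1 ;;;
  rT <<- #rT +' $1.

Definition read_row : cmd :=
  rK <<- Cell 0 #rT ;;;
  aDEG @@ #rA <<- #rK ;;;
  rT <<- #rT +' $1 ;;;
  For rJ #rK read_neighbor ;;;
  aCL @@ #rA *' #rN +' #rA <<- $1.

Definition read_graph : cmd :=
  rN <<- Cell 0 $0 ;;; rT <<- $1 ;;; For rA #rN read_row.

Section Read.
Variables (n : nat) (G : sgraph 'I_n) (nbrs : 'I_n -> seq 'I_n) (X dl : nat).
Hypothesis adjl : adjacency_lists G nbrs.
Hypothesis XH : 4 * (n + 2) * (n + 2) <= X.
Hypothesis dlE : dl = max_degree G.
Local Notation nb := (nat_nbrs nbrs).
Local Notation w := (encode_graph nbrs).

Let nX : n <= X. Proof. by move: XH; clear; nia. Qed.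
Let X_gt0 : 0 < X. Proof. by move: XH; clear; nia. Qed.
Let ordX (z : 'I_n) : z <= X. Proof. exact: leq_trans (ltnW (ltn_ord z)) nX. Qed.

Definition row (x : 'I_n) : seq nat := size (nbrs x) :: map val (nbrs x).
Definition rows : seq (seq nat) := [seq row x | x <- enum 'I_n].

Lemma drop_rows (x : 'I_n) : drop x rows = row x :: drop x.+1 rows.
Proof.
have sz : size (enum 'I_n) = n by rewrite size_enum_ord.
have lt : x < size rows by rewrite size_map sz.
by rewrite (drop_nth [::] lt) (nth_map x) ?sz // nth_ord_enum.
Qed.

Lemma size_nbrs (x : 'I_n) : size (nbrs x) <= dl /\ size (nbrs x) <= n.
Proof.
have E : size (nbrs x) = size (nb x) by rewrite nat_nbrsE size_map.
rewrite E dlE; split; first exact: (size_nat_nbrs_max adjl).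
exact: (size_nat_nbrs_n adjl).
Qed.

(** The matrix clause also covers the rows still to be read: they are zero in the initial state, so
    the matrix costs no pass over its [n * n] cells. The bound on the cursor keeps it storable. *)
Definition read_mem (k : nat) (s : state) : Prop :=
  [/\ drop (regs s rT) w = flatten (drop k rows), regs s rT <= 1 + k * n.+1,
      forall x : 'I_n, x < k -> cells s aDEG x = size (nbrs x) /\
        forall j, j < size (nbrs x) -> cells s aNB (x * n + j) = nth 0 (map val (nbrs x)) j
    & forall x y : 'I_n, cells s aCL (x * n + y) = (x < k) && cladj G x y].

Lemma read_row_ok s (x : 'I_n) : regs s rN = n -> regs s rA = x ->
  (forall i, cells s 0 i = nth 0 w i) -> read_mem x s ->
  spec X read_row s (dl * 50 + 50) (read_mem x.+1).
Proof.
move=> en ex mem [dr rb m1 m2].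
have [szd szn] := size_nbrs x.
pose t0 := regs s rT.
have rX' : t0 + n.+1 <= X.
  have xn : x * n.+1 <= n * n.+1 by rewrite leq_mul2r (ltnW (ltn_ord x)) orbT.
  by move: XH rb xn; rewrite -/t0; clear; nia.
have inp j : nth 0 w (t0 + j) = nth 0 (row x ++ flatten (drop x.+1 rows)) j.
  by rewrite -nth_drop dr drop_rows.
have inp0 : nth 0 w t0 = size (nbrs x) by rewrite -[t0]addn0 inp.
have inpS j : j < size (nbrs x) -> nth 0 w (t0 + 1 + j) = nth 0 (map val (nbrs x)) j.
  move=> jx; rewrite -addnA inp nth_cat /= size_map add1n ltnS jx //.
pose s1 := set_reg s rK (size (nbrs x)).
pose s2 := set_cell s1 aDEG x (size (nbrs x)).
pose s3 := set_reg s2 rT (t0 + 1).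
pose frs := [:: rB; rJ; rT; rK]; pose fas := [:: aDEG; aNB; aCL].
have F3 : frame frs fas s s3.
  apply: (@frame_trans _ _ _ s1); first exact: frame_set_reg.
  by apply: (@frame_trans _ _ _ s2); [apply: frame_set_cell|apply: frame_set_reg].
pose Inv j (s' : state) := [/\ regs s' rT = t0 + 1 + j,
   forall (u : 'I_n) i, i < size (nbrs u) -> (u < x) || (u == x) && (i < j) ->
     cells s' aNB (u * n + i) = nth 0 (map val (nbrs u)) i
   & forall u v : 'I_n, cells s' aCL (u * n + v) =
     (u < x) && cladj G u v || (u == x) && (v \in take j (nbrs x))].
apply: spec_le.
  apply: spec_seq.
    apply: spec_wpl => /=; rewrite mem inp0; split; last exact: (erefl s1).
    exact: leq_trans szn nX.
  move=> _ _ <-; apply: spec_seq.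
    apply: spec_wpl => /=; rewrite ex; split; last exact: (erefl s2).
    exact: leq_trans szn nX.
  move=> _ _ <-; apply: spec_seq.
    apply: spec_wpl => /=; split; last exact: (erefl s3).
    by rewrite -/t0; apply: leq_trans rX'; rewrite leq_add2l.
  move=> _ _ <-; apply: spec_seq.
    apply: (spec_for_const (N := size (nbrs x)) (T := 30) (Inv := Inv)) => //.
    - exact: leq_trans szn nX.
    - by move=> s' F /=; rewrite (frame_reg F).
    - move=> j s4 jx Fr4 ej [i1 i2 i3].
      have F4 : frame frs fas s s4 by apply: frame_trans F3 _; apply: frame_sub Fr4 _.
      pose y := nth x (nbrs x) j.
      have yE : nth 0 (map val (nbrs x)) j = y by rewrite (nth_map x).
      have en4 : regs s4 rN = n by rewrite (frame_reg F4).
      have ex4 : regs s4 rA = x by rewrite (frame_reg F4).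
      have mem4 : cells s4 0 (t0 + 1 + j) = y by rewrite (frame_cell _ F4) // mem inpS.
      apply: spec_le; first apply: spec_wpl => /=.
        rewrite i1 mem4 ex4 en4 ej; split; first exact: ordX.
        split; first exact: ordX.
        split; first exact: X_gt0.
        split.
          apply: leq_trans rX'; rewrite -2!addnA leq_add2l; move: jx szn; clear; lia.
        split=> /=; first by clear; lia.
          move=> u i iu; have un := size_nbrs u.
          rewrite pair_index_inj; first last.
          - by apply: leq_trans jx szn.
          - by case: un => _; apply: leq_trans.
          rewrite val_eqE; case: (eqVneq u x) iu => [->|ux] iu.
            rewrite ltnn ltnS /= leq_eqVlt; have [->|ij] := eqVneq i j => //= il.
            by apply: i2 => //; rewrite eqxx il orbT.
          by rewrite /= orbF => lx; apply: i2 => //; rewrite lx.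
        move=> u v; rewrite pair_index_inj ?ltn_ord // !val_eqE i3.
        have [->|ux] := eqVneq u x; last by rewrite /= !orbF.
        by rewrite ltnn /= (take_nth x) // mem_rcons inE -/y; case: (v == y).
      by [].
    split=> [|u i iu|u v]; first by rewrite addn0.
      rewrite andbF orbF => ux; case: (m1 u ux) => _; exact.
    by rewrite take0 in_nil andbF orbF; apply: m2.
  move=> s5 F5 [i1 i2 i3].
  have F5' : frame frs fas s s5 by apply: frame_trans F3 _; apply: frame_sub F5 _.
  have en5 : regs s5 rN = n by rewrite (frame_reg F5').
  have ex5 : regs s5 rA = x by rewrite (frame_reg F5').
  apply: spec_wpl => /=; rewrite en5 ex5; split; first exact: X_gt0.
  split=> /=.
  - have -> : regs s5 rT = (1 + size (nbrs x)) + t0 by rewrite i1; clear; lia.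
    by rewrite -drop_drop dr drop_rows /= drop_size_cat ?size_map.
  - rewrite i1 mulSn; move: rb szn; rewrite -/t0; clear; lia.
  - move=> u; rewrite ltnS leq_eqVlt => ux; split.
      rewrite (frame_cell _ F5) //=; case: (eqVneq (u : nat) x) ux => [/val_inj->//|_ /= ux].
      by case: (m1 u ux).
    move=> j jx; apply: i2 => //; case/orP: ux => [/eqP/val_inj e|->//].
    by move: jx; rewrite e eqxx => ->; rewrite orbT.
  move=> u v; rewrite pair_index_inj ?ltn_ord // !val_eqE i3 take_size ltnS.
  have [->|ux] := eqVneq u x; last first.
    have /negbTE ne : (u : nat) != x by apply: contra ux => /eqP/val_inj->.
    by rewrite /= orbF [u <= x]leq_eqVlt ne.
  rewrite ltnn leqnn /= /cladj; have [_ ->] := adjl x; rewrite inE eq_sym; by case: (x == v).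
rewrite /= /for_cost /=.
move: szd; clear; nia.
Qed.

Lemma encode_graph_le i : nth 0 w i <= X.
Proof.
suff /(all_nthP 0) h : all (fun v => v <= X) w.
  by have [lt|ge] := ltnP i (size w); [apply: h | rewrite nth_default].
rewrite /encode_graph /= nX; apply/allP => v /flattenP[r /mapP[x _ ->]].
rewrite inE => /orP[/eqP->|/mapP[z _ ->]]; last exact: ordX.
by have [_ xn] := size_nbrs x; apply: leq_trans xn nX.
Qed.

Lemma read_graph_ok :
  spec X read_graph (init_state w) (100 * (n.+1 * dl.+1)) (graph_mem n nb).
Proof.
pose s0 := init_state w.
pose s1 := set_reg s0 rN n; pose s2 := set_reg s1 rT 1.
have F2 : frame [:: rN; rT] [::] s0 s2.
  by apply: (@frame_trans _ _ _ s1); apply: frame_set_reg.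
apply: spec_le.
  apply: spec_seq.
    by apply: spec_wpl => /=; split; [exact: nX|exact: (erefl s1)].
  move=> _ _ <-; apply: spec_seq.
    by apply: spec_wpl => /=; split; [exact: X_gt0|exact: (erefl s2)].
  move=> _ _ <-; apply: spec_imp.
  - apply: (spec_for_const (N := n) (T := dl * 50 + 50) (Inv := read_mem)) => //.
    + by move=> s F /=; rewrite (frame_reg F).
    + move=> k s kn F ek rm; pose x := Ordinal kn.
      apply: spec_imp.
      * apply: (@read_row_ok s x) => //; first by rewrite (frame_reg F).
        by move=> i; rewrite (frame_cell _ F).
      * exact: leqnn.
      by [].
    + by split=> //=; rewrite !drop0.
  - exact: leqnn.
  move=> s F [_ _ m1 m2]; split; first by rewrite (frame_reg F).
  move=> k kn; pose x := Ordinal kn; have [dE nE] := m1 x kn.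
  have E : nb k = map val (nbrs x) by rewrite -(nat_nbrsE nbrs x).
  split; rewrite ?E ?size_map //.
  by move=> y yn; rewrite (m2 x (Ordinal yn)) kn -(closed_nat_nbrs adjl).
rewrite /= /for_cost /=; clear; nia.
Qed.

End Read.

(** * The whole algorithm and its time bound *)

Definition find_2join : cmd := read_graph ;;; mark_cliques ;;; solve_all.

Lemma inv_ackermann_gt0 m n : 0 < inv_ackermann m n.
Proof. by rewrite /inv_ackermann; case: ex_minnP => i /andP[]. Qed.

Lemma no_edges (n : nat) (G : sgraph 'I_n) :
  connected G -> nb_edges G = 0 -> n = 1 /\ max_degree G = 0.
Proof.
move=> [n0 conn] m0.
have d0 x : degree G x = 0.
  by apply/eqP; rewrite -leqn0; apply: leq_trans (leq_trans (sum_degree G) _);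
    [rewrite (bigD1 x) //= leq_addr|rewrite m0].
have noE x y : G x y = false.
  apply/negP => xy; have := d0 x; rewrite /degree => /eqP; rewrite cards_eq0 => /eqP/setP/(_ y).
  by rewrite !inE xy.
split; last by apply/eqP; rewrite -leqn0; apply/bigmax_leqP => x _; rewrite d0.
rewrite card_ord in n0; apply/eqP; rewrite eqn_leq n0 andbT.
rewrite -[n]card_ord; apply/fintype_le1P => x y.
have /connectP[[|z q] /=] := conn x y; first by move=> _ ->.
by rewrite noE.
Qed.

(** The factor 4 is absorbed by two further factors [n + 2], also for [n = 0]; hence the exponent 4
    in the bound on stored values. *)
Lemma word_bound n : 4 * (n + 2) * (n + 2) <= (n + 2) ^ 4.
Proof.
have n2 : 2 * 2 <= (n + 2) * (n + 2) by rewrite leq_mul // leq_addl.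
by rewrite (expnD _ 2 2) !expnS expn0 !muln1 -mulnA leq_mul2r n2 orbT.
Qed.

Lemma find_2join_ok (n : nat) (G : sgraph 'I_n) (nbrs : 'I_n -> seq 'I_n) :
  adjacency_lists G nbrs -> connected G -> ~ has_1join G ->
  spec ((n + 2) ^ 4) find_2join (init_state (encode_graph nbrs))
    ((8 * pair_cost + 4000) * (n * nb_edges G * (max_degree G).+1 + 1)) (answer G).
Proof.
move=> adjl conn no1; set X := (n + 2) ^ 4.
have XH : 4 * (n + 2) * (n + 2) <= X := word_bound n.
apply: spec_le.
  apply: spec_seq (read_graph_ok adjl XH erefl) _ => s1 F1 gm1.
  apply: spec_seq (mark_cliques_ok adjl XH erefl gm1) _ => s2 F2 cm2.
  apply: (solve_all_ok adjl XH erefl conn no1 _ cm2).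
    exact: graph_mem_frame gm1 F2 isT.
  by rewrite (frame_reg F2) // (frame_reg F1).
have [m0|m0] := posnP (nb_edges G).
  by have [n1 d0] := no_edges conn m0; rewrite m0 d0 n1 /nb_cost; move: pair_cost; clear; lia.
have n0 : 0 < n by case: conn; rewrite card_ord.
move: (max_degree G) (nb_edges G) pair_cost m0 n0 => d m c m0 n0; rewrite /nb_cost.
set R := n * m * d.+1.
(* With a vertex and an edge present, [n + 1 <= 2 * n] and [1 <= m] put every cost term below a
   multiple of [R]. *)
have qR : n.+1 * d.+1 <= 2 * R.
  by rewrite /R !mulnA leq_mul2r; move: n0 m0; clear; nia.
have mqR : m * (n.+1 * d.+1) <= 2 * R.
  have n2 : n.+1 <= 2 * n by lia.
  by rewrite /R (mulnC n) !mulnA leq_mul2r (mulnC 2) -mulnA leq_mul2l n2 !orbT.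
have mR : m <= R /\ n <= R by rewrite /R; move: n0 m0; clear; split; nia.
clearbody R; have cqR := leq_mul (leqnn c) mqR.
have -> : 2 * m * (200 * (n.+1 * d.+1) + 21) = 400 * (m * (n.+1 * d.+1)) + 42 * m.
  by move: (n.+1 * d.+1) => q; clear; nia.
have -> : 2 * m * (c * (n.+1 * d.+1) + 10 + 21) = 2 * (c * (m * (n.+1 * d.+1))) + 62 * m.
  by move: (n.+1 * d.+1) => q; clear; nia.
have -> : (8 * c + 4000) * (R + 1) = 4 * (c * (2 * R)) + 8 * c + 4000 * R + 4000.
  by clear; nia.
move: cqR mqR qR mR; move: (n.+1 * d.+1) => q; move: (m * q) => mq.
by move: (c * mq) (c * (2 * R)) => r1 r2; clear; lia.
Qed.

(* Words have O(log n) bits: k is a constant of the algorithm.  The "+ 1" in the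
   time bound only matters for the one-vertex graph, where n * m = 0. *)
Theorem theorem19 :
  exists (P : cmd) (k C : nat),
    forall (n : nat) (G : sgraph 'I_n) (nbrs : 'I_n -> seq 'I_n),
      adjacency_lists G nbrs ->
      connected G ->
      ~ has_1join G ->
      exists (t : nat) (s : state),
        exec ((n + 2) ^ k) P (init_state (encode_graph nbrs)) t s /\
        correct_2join_output G s /\
        t <= C * (n * nb_edges G *
                  (max_degree G + inv_ackermann (nb_edges G) (max_degree G))
                  + 1).
Proof.
(* Stored values are at most [(n + 2) ^ 4], raised to [csz] for intermediate results; the additional
   factor [n + 2] makes the inequality strict. *)
exists find_2join, (4 * csz find_2join).+1, (8 * pair_cost + 4000) => n G nbrs adjl conn no1.
have [t [s [st tT ans]]] := find_2join_ok adjl conn no1.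
have X1 : 1 < (n + 2) ^ 4 by rewrite -{1}(exp1n 4) ltn_exp2r // addn2.
have XW : ((n + 2) ^ 4) ^ csz find_2join < (n + 2) ^ (4 * csz find_2join).+1.
  by rewrite -expnM ltn_exp2l // addn2.
have bnd : bounded ((n + 2) ^ 4) (init_state (encode_graph nbrs)).
  split=> [r|a i]; first exact: leq0n.
  rewrite [cells _ _ _]/=; case: ifP => _; last exact: leq0n.
  exact: (encode_graph_le adjl (word_bound n) erefl).
have [ex _] := steps_exec X1 XW (leqnn _) bnd st.
exists t, s; split; first exact: ex.
split; first exact: ans.
(* The algorithm runs within the stronger bound with 1 in place of the inverse Ackermann term, which
   is at least 1 by definition. *)
have le : (max_degree G).+1 <=
    max_degree G + inv_ackermann (nb_edges G) (max_degree G).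
  by rewrite -[X in X < _]addn0 ltn_add2l inv_ackermann_gt0.
apply: leq_trans tT _; rewrite leq_mul2l; apply/orP; right.
by rewrite leq_add2r leq_mul2l le orbT.
Qed.
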